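(* Let $S$ be an integral scheme, dominant and of finite type over $\mathbb{Z}$, with generic point $\mu$, and let $M$ be a coherent left $D_{\mathbb{A}^n_S/S}$-module. Suppose that $M_{\mu}$ is a nonzero holonomic left $D_{\mathbb{A}^n_{k(\mu)}}$-module. Then there is a dense open subset $U$ of $S$ such that for each closed point $u\in U$, with $p$ the characteristic of $k(u)$, and each generic point $z$ of an irreducible component of the $p$-support of $M_u$, $$\deg(\overline{\{z\}})\leq e(M_\mu)\quad\text{and}\quad \mathrm{rk}_z(M_u)\leq e(M_\mu)\,p^n .$$ Here $e(M_\mu)$ is the multiplicity of $M_\mu$ for the Bernstein filtration, $\deg(\overline{\{z\}})$ is the degree of the reduced closure of the image of $z$ in $\mathbb{P}^{2n}_{k(u)}$ under the open immersion $T^*_{(\mathbb{A}^n_{k(u)})'}\hookrightarrow \mathbb{P}^{2n}_{k(u)}$ given by the Rees construction, and $\mathrm{rk}_z(M_u):=\dim_{k(z)}\big((F_*M_u)_z\otimes k(z)\big)$.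
   Context: Schemes are Noetherian. ''Dominant over $\mathbb{Z}$'' means that $S\to \operatorname{Spec}\mathbb{Z}$ is dominant. Differential operators. $D_{X/S}$ is the sheaf of crystalline differential operators of a smooth $S$-scheme $X$: the sheaf of rings generated by $\mathcal{O}_X$ and $T_{X/S}$ subject to $f\cdot\partial=f\partial$, $\partial\cdot f-f\cdot\partial=\partial(f)$, $\partial\cdot\partial'-\partial'\cdot\partial=[\partial,\partial']$. For $s\in S$, $M_s:=k(s)\otimes_{\mathcal{O}_S}M$ is the induced left $D_{X_s}$-module on the fiber $X_s$. Fix coordinates $x_1,\dots,x_n$ on $\mathbb{A}^n_S$. For $S=\operatorname{Spec}R$ affine, global sections of $D_{\mathbb{A}^n_S/S}$ form the Weyl algebra $A_n(R)$ generated over $R$ by $x_i,\partial_i$ with $[x_i,x_j]=[\partial_i,\partial_j]=0$, $[\partial_i,x_j]=\delta_{ij}$. Over a field of characteristic $0$, a coherent left $D_{\mathbb{A}^n}$-module is holonomic (in the usual sense) if it is zero or its singular support has dimension $n$. Multiplicity. The Bernstein filtration of $A_n(K)$, $K$ a field, is $\mathcal{B}_lA_n(K)=\bigoplus_{|\alpha|+|\beta|\le l}Kx^\alpha\partial^\beta$. A good filtration $\Gamma$ of a finitely generated left $A_n(K)$-module $N$ is an increasing exhaustive filtration indexed by $\mathbb{Z}$, compatible with $\mathcal{B}$, bounded below, such that $gr^\Gamma N$ is finitely generated over $gr^{\mathcal{B}}A_n(K)$. For $l\gg 0$, $\dim_K\Gamma_lN$ is a polynomial $\mathcal{H}_{N,\Gamma}(l)$;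 if $d$ is its degree and $a_d$ its leading coefficient, then $d(N):=d$ and $e(N):=d!\,a_d$ (the multiplicity) are independent of $\Gamma$. $p$-support. For $Y$ smooth of pure dimension $n$ over a perfect field $k$ of characteristic $p>0$, with relative Frobenius $F:Y\to Y'$ ($Y'$ the base change of $Y$ by the Frobenius of $k$), the $\mathcal{O}_{Y'}$-linear map $T_{Y'}\to F_*D_Y$, $\partial\mapsto\partial^p-\partial^{[p]}$ ($\partial^{[p]}$ the $p$-th power of the derivation) identifies $\mathcal{O}_{T^*_{Y'}}$ with $F_*$ of the center of $D_Y$. Thus for a coherent left $D_Y$-module $N$, $F_*N$ is a coherent sheaf on $T^*_{Y'}$; its support, with reduced structure, is the $p$-support of $N$. Projective embedding. For $k=k(u)$ and $Y=\mathbb{A}^n_k$, the center of $A_n(k)$ is the polynomial ring $k[x_1^p,\dots,x_n^p,\partial_1^p,\dots,\partial_n^p]$, so $T^*_{(\mathbb{A}^n_k)'}=\operatorname{Spec}k[x_i^p,\partial_j^p]$. Filtering this ring by degree with each $x_i^p$, $\partial_j^p$ of degree $1$, its Rees ring is $k[t_0,x_1^p,\dots,x_n^p,\partial_1^p,\dots,\partial_n^p]$ with all variables in degree $1$, and the open immersion is $T^*_{(\mathbb{A}^n_k)'}=D_+(t_0)\hookrightarrow \operatorname{Proj}k[t_0,x_i^p,\partial_j^p]=\mathbb{P}^{2n}_k$. *)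

(* Defs.v *)
From HB Require Import structures.
From mathcomp Require Import all_boot all_order all_algebra.
From mathcomp Require Import boolp classical_sets topology_structure.
From mathcomp Require Import mpoly.

Set Implicit Arguments.
Unset Strict Implicit.
Unset Printing Implicit Defensive.

Import Order.TTheory GRing.Theory Num.Theory.
Local Open Scope classical_set_scope.
Local Open Scope ring_scope.

Definition prime_ideal (R : comPzRingType) (P : set R) : Prop :=
  [/\ P 0 /\ (forall f g, P f -> P g -> P (f + g)),
      forall f g, P g -> P (f * g),
      ~ P 1 &
      forall f g, P (f * g) -> P f \/ P g].

Definition fg_ring (R : comPzRingType) : Prop :=
  exists (r : nat) (g : 'I_r -> R),
    forall A : set R, (forall i, A (g i)) -> A 1 ->
      (forall a b, A a -> A b -> A (a - b)) ->
      (forall a b, A a -> A b -> A (a * b)) ->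
    forall f, A f.

Definition domain (R : comPzRingType) : Prop :=
  (1 : R) <> 0 /\ forall f g : R, f * g = 0 -> f = 0 \/ g = 0.

(* [phi : R -> K] exhibits [K] as the residue field of [R] at the prime [P]. *)
Definition residue_field_at (R : comPzRingType) (P : set R) (K : fieldType)
    (phi : {rmorphism R -> K}) : Prop :=
  (forall f, phi f = 0 <-> P f) /\
  (forall c, exists f g, phi g != 0 /\ c = phi f / phi g).

Definition semilinear (R : pzRingType) (M : zmodType) (act : R -> M -> M)
    (K : fieldType) (phi : R -> K) (Q : lmodType K) (g : M -> Q) : Prop :=
  (forall u v, g (u + v) = g u + g v) /\
  (forall a u, g (act a u) = phi a *: g u).

(* [W], with [j : M -> W], is [K (x)_R M], the [R]-module structure of [M]
   being given by [act]. *)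
Definition base_change (R : pzRingType) (M : zmodType) (act : R -> M -> M)
    (K : fieldType) (phi : R -> K) (W : lmodType K) (j : M -> W) : Prop :=
  semilinear act phi j /\
  forall (Q : lmodType K) (g : M -> Q), semilinear act phi g ->
    exists h : {linear W -> Q}, (forall u, h (j u) = g u) /\
      forall h' : {linear W -> Q}, (forall u, h' (j u) = g u) -> h' =1 h.

(* [dim_K (A / B) = r], for subspaces [B] and [A] of [V] with [B] in [A]. *)
Definition quot_dim (K : fieldType) (V : lmodType K) (A B : set V) (r : nat)
    : Prop :=
  exists b : 'I_r -> V, (forall i, A (b i)) /\
    forall v, A v -> exists c : 'I_r -> K, B (v - \sum_i c i *: b i) /\
      forall c' : 'I_r -> K, B (v - \sum_i c' i *: b i) -> c' =1 c.

Definition hilbert_poly (h : nat -> nat -> Prop) (q : {poly rat}) : Prop :=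
  exists l0 : nat, forall l : nat, (l0 <= l)%N ->
    exists r : nat, h l r /\ q.[l%:R] = r%:R.

Definition hilbert_mult (q : {poly rat}) : rat :=
  ((size q).-1)`!%:R * lead_coef q.

Record opens (T : topologicalType) := Opens {
  oset :> set T;
  open_oset : open oset }.

Definition otop (T : topologicalType) : opens T := Opens (@openT T).

Lemma sub_otop (T : topologicalType) (U : opens T) : U `<=` otop T.
Proof. by move=> x _. Qed.

Definition opreim (X S : topologicalType) (f : X -> S)
    (cf : forall V : opens S, open (f @^-1` V)) (V : opens S) : opens X :=
  Opens (cf V).

Definition is_sheaf (T : topologicalType) (F : opens T -> Type)
    (res : forall U V : opens T, V `<=` U -> F U -> F V) : Prop :=
  (forall (U : opens T) (UU : U `<=` U) f, res U U UU f = f) /\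
  (forall (U V W : opens T) (VU : V `<=` U) (WV : W `<=` V) (WU : W `<=` U) f,
     res V W WV (res U V VU f) = res U W WU f) /\
  (forall (U : opens T) (I : Type) (V : I -> opens T)
     (VU : forall i, V i `<=` U), U `<=` \bigcup_i V i ->
     (forall f g : F U, (forall i, res U (V i) (VU i) f = res U (V i) (VU i) g) ->
        f = g) /\
     (forall s : forall i, F (V i),
        (forall i j (W : opens T) (Wi : W `<=` V i) (Wj : W `<=` V j),
           res (V i) W Wi (s i) = res (V j) W Wj (s j)) ->
        exists f : F U, forall i, res U (V i) (VU i) f = s i)).

Record ringed_space := RingedSpace {
  rs_space :> topologicalType;
  Osh : opens rs_space -> comPzRingType;
  Ores : forall U V : opens rs_space, V `<=` U -> {rmorphism Osh U -> Osh V};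
  Osh_sheaf : is_sheaf (fun U V VU => Ores VU : Osh U -> Osh V) }.

Section RingedSpace.
Variable T : ringed_space.

(* The germ of [f] at [x] is a unit of the stalk. *)
Definition unit_at (U : opens T) (f : Osh U) (x : T) : Prop :=
  exists V : opens T, oset V x /\
    exists (VU : V `<=` U) (g : Osh V), Ores VU f * g = 1.

Definition basic_open (U : opens T) (f : Osh U) : set T :=
  [set x | unit_at f x].

(* [(U, O|U)] is isomorphic to [Spec O(U)]: the map sending [x] to the prime
   of the sections whose germ at [x] is not a unit is a homeomorphism
   [U -> Spec O(U)], and [O(D(f)) = O(U)_f] for every [f]. *)
Definition affine (U : opens T) : Prop :=
  [/\ forall x, oset U x -> prime_ideal [set f : Osh U | ~ unit_at f x],
      forall P : set (Osh U), prime_ideal P ->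
        exists! x, oset U x /\ P = [set f : Osh U | ~ unit_at f x],
      forall (W : opens T) x, W `<=` U -> oset W x ->
        exists f : Osh U, unit_at f x /\ basic_open f `<=` W &
      forall (f : Osh U) (V : opens T) (VU : V `<=` U),
        V = basic_open f :> set T ->
        (forall g : Osh V, exists (N : nat) (a : Osh U),
           Ores VU a = Ores VU f ^+ N * g) /\
        (forall a : Osh U, Ores VU a = 0 -> exists N : nat, f ^+ N * a = 0)].

End RingedSpace.

Record scheme := Scheme {
  sch_rs :> ringed_space;
  sch_affine : forall x : sch_rs, exists U : opens sch_rs, oset U x /\ affine U }.

Definition integral_scheme (S : scheme) : Prop :=
  (exists x : S, True) /\
  forall U : opens S, U !=set0 -> domain (Osh U).

Definition finite_type_over_Z (S : scheme) : Prop :=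
  exists (r : nat) (V : 'I_r -> opens S),
    (forall x : S, exists i, oset (V i) x) /\
    forall i, affine (V i) /\ fg_ring (Osh (V i)).

(* The image of [S] meets every nonempty basic open subset [D(m)], [m <> 0],
   of [Spec Z]; [x] is mapped into [D(m)] iff [m] is a unit at [x]. *)
Definition dominant_over_Z (S : scheme) : Prop :=
  forall m : int, m != 0 -> exists x : S, unit_at (m%:~R : Osh (otop S)) x.

Definition generic_point (S : scheme) (x : S) : Prop := closure [set x] = setT.

Record residue_field (S : scheme) (s : S) := ResidueField {
  rf_field :> fieldType;
  rf_ev : forall V : opens S, oset V s -> {rmorphism Osh V -> rf_field};
  rf_res : forall (U V : opens S) (VU : V `<=` U) (Us : oset U s) (Vs : oset V s) f,
    rf_ev Vs (Ores VU f) = rf_ev Us f;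
  rf_ker : forall (V : opens S) (Vs : oset V s) f,
    rf_ev Vs f = 0 <-> ~ unit_at f s;
  rf_surj : forall c, exists (V : opens S) (Vs : oset V s) (f : Osh V),
    rf_ev Vs f = c }.

(* [A^n_S] with coordinates [as_x i] and the vector fields [as_der i] dual to
   [d x_i].  The condition [as_free] says that over an affine open [V] of [S]
   the space is [Spec] of the polynomial ring over [O(V)]. *)
Record affine_space (n : nat) (S : scheme) := AffineSpace {
  as_sch :> scheme;
  as_pi : as_sch -> S;
  as_cont : forall V : opens S, open (as_pi @^-1` V);
  as_com : forall V : opens S, {rmorphism Osh V -> Osh (opreim as_cont V)};
  as_com_res : forall (U V : opens S) (VU : V `<=` U)
      (VU' : opreim as_cont V `<=` opreim as_cont U) f,
    as_com V (Ores VU f) = Ores VU' (as_com U f);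
  as_local : forall (V : opens S) (f : Osh V) (x : as_sch),
    oset V (as_pi x) -> unit_at (as_com V f) x -> unit_at f (as_pi x);
  as_x : 'I_n -> Osh (otop as_sch);
  as_affine : forall V : opens S, affine V -> affine (opreim as_cont V);
  as_free : forall V : opens S, affine V ->
    let mon (m : 'X_{1..n}) := \prod_i Ores (sub_otop (U := opreim as_cont V)) (as_x i) ^+ m i in
    (forall f : Osh (opreim as_cont V),
       exists (ms : seq 'X_{1..n}) (c : 'X_{1..n} -> Osh V),
         f = \sum_(m <- ms) as_com V (c m) * mon m) /\
    (forall (ms : seq 'X_{1..n}) (c : 'X_{1..n} -> Osh V), uniq ms ->
       \sum_(m <- ms) as_com V (c m) * mon m = 0 ->
       forall m, m \in ms -> c m = 0);
  as_der : 'I_n -> forall W : opens as_sch, Osh W -> Osh W;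
  as_derD : forall i (W : opens as_sch) (f g : Osh W),
    as_der i (f + g) = as_der i f + as_der i g;
  as_derM : forall i (W : opens as_sch) (f g : Osh W),
    as_der i (f * g) = as_der i f * g + f * as_der i g;
  as_der_res : forall i (U W : opens as_sch) (WU : W `<=` U) (f : Osh U),
    as_der i (Ores WU f) = Ores WU (as_der i f);
  as_der_com : forall i (V : opens S) (f : Osh V), as_der i (as_com V f) = 0;
  as_der_x : forall i j, as_der i (as_x j) = (i == j)%:R }.

Definition opi (n : nat) (S : scheme) (X : affine_space n S) (V : opens S)
  : opens X := opreim (@as_cont n S X) V.

(* A sheaf of left [D_{X/S}]-modules on [X = A^n_S].  The tangent sheaf is free
   on the commuting vector fields [as_der i], so [D_{X/S}] is generated over
   [O_X] by the [as_der i], which act here as [dm_der i]. *)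
Record dmodule (n : nat) (S : scheme) (X : affine_space n S) := DModule {
  dm : forall W : opens X, lmodType (Osh W);
  dm_res : forall U W : opens X, W `<=` U -> dm U -> dm W;
  dm_sheaf : is_sheaf (F := fun W => dm W) dm_res;
  dm_resD : forall (U W : opens X) (WU : W `<=` U) (u v : dm U),
    dm_res WU (u + v) = dm_res WU u + dm_res WU v;
  dm_resZ : forall (U W : opens X) (WU : W `<=` U) f (u : dm U),
    dm_res WU (f *: u) = Ores WU f *: dm_res WU u;
  dm_der : 'I_n -> forall W : opens X, dm W -> dm W;
  dm_der_res : forall i (U W : opens X) (WU : W `<=` U) (u : dm U),
    dm_der i (dm_res WU u) = dm_res WU (dm_der i u);
  dm_derD : forall i (W : opens X) (u v : dm W),
    dm_der i (u + v) = dm_der i u + dm_der i v;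
  dm_derZ : forall i (W : opens X) f (u : dm W),
    dm_der i (f *: u) = as_der i f *: u + f *: dm_der i u;
  dm_derC : forall i j (W : opens X) (u : dm W),
    dm_der i (dm_der j u) = dm_der j (dm_der i u) }.

Section DModules.
Variables (n : nat) (S : scheme) (X : affine_space n S) (M : dmodule X).

Definition fg_over_D (W : opens X) : Prop :=
  exists (r : nat) (g : 'I_r -> dm M W),
    forall B : set (dm M W), (forall i, B (g i)) -> B 0 ->
      (forall u v, B u -> B v -> B (u + v)) ->
      (forall f u, B u -> B (f *: u)) ->
      (forall i u, B u -> B (dm_der i u)) ->
    forall u, B u.

(* Quasi-coherent over [O_X], with finitely generated modules of sections over
   [D] on affine opens; [D] is a Noetherian sheaf of rings as [S] is
   Noetherian. *)
Definition coherent : Prop :=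
  forall W : opens X, affine W ->
    (forall (f : Osh W) (V : opens X) (VW : V `<=` W),
       V = basic_open f :> set X ->
       (forall v : dm M V, exists (N : nat) (u : dm M W),
          dm_res VW u = Ores VW f ^+ N *: v) /\
       (forall u : dm M W, dm_res VW u = 0 -> exists N : nat, f ^+ N *: u = 0)) /\
    fg_over_D W.

End DModules.

(* A left [A_n(K)]-module, through the generators [x_i], [d_i] of [A_n(K)] and
   their relations. *)
Record weyl_module (K : fieldType) (n : nat) := WeylModule {
  wm :> lmodType K;
  wx : 'I_n -> {linear wm -> wm};
  wd : 'I_n -> {linear wm -> wm};
  wxC : forall i j u, wx i (wx j u) = wx j (wx i u);
  wdC : forall i j u, wd i (wd j u) = wd j (wd i u);
  wdx : forall i j u, wd i (wx j u) - wx j (wd i u) = (i == j)%:R *: u }.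

(* The fiber [M_s] of [M] at [s], given by the [A_n(k(s))]-module of its global
   sections on [A^n_{k(s)}]: the sections of [M] over the preimage of an affine
   neighbourhood [V] of [s] are base changed along [O(V) -> k(s)]. *)
Record fiber (n : nat) (S : scheme) (X : affine_space n S) (M : dmodule X)
    (s : S) (k : residue_field s) := Fiber {
  fib_mod :> weyl_module k n;
  fib_map : forall V : opens S, oset V s -> dm M (opi X V) -> fib_mod;
  fib_res : forall (U V : opens S) (VU' : opi X V `<=` opi X U)
      (Us : oset U s) (Vs : oset V s) (u : dm M (opi X U)),
    fib_map Vs (dm_res VU' u) = fib_map Us u;
  fib_base_change : forall (V : opens S) (Vs : oset V s), affine V ->
    base_change (fun a (u : dm M (opi X V)) => as_com X V a *: u)
      (rf_ev k Vs) (fib_map Vs);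
  fib_x : forall (V : opens S) (Vs : oset V s) i (u : dm M (opi X V)),
    fib_map Vs (Ores (sub_otop (U := opi X V)) (as_x X i) *: u)
      = wx fib_mod i (fib_map Vs u);
  fib_d : forall (V : opens S) (Vs : oset V s) i (u : dm M (opi X V)),
    fib_map Vs (dm_der i u) = wd fib_mod i (fib_map Vs u) }.

Section Weyl.
Variables (K : fieldType) (n : nat) (N : weyl_module K n).

Definition powop (f : 'I_n -> N -> N) (a : 'I_n -> nat) (u : N) : N :=
  foldr (fun i => iter (a i) (f i)) u (enum 'I_n).

(* A multi-index [a] of length [n + n] stands for the pair [(alpha, beta)];
   [monop c a] is the operator [x^(c alpha) d^(c beta)]. *)
Definition monop (c : nat) (a : 'X_{1..n + n}) (u : N) : N :=
  powop (wx N) (fun i => c * a (lshift n i))%N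
    (powop (wd N) (fun i => c * a (rshift n i))%N u).

Definition polyop (c : nat) (f : {mpoly K[n + n]}) (u : N) : N :=
  \sum_(a <- msupp f) f@_a *: monop c a u.

Definition bernstein_weight (a : 'X_{1..n + n}) : nat := mdeg a.

Definition order_weight (a : 'X_{1..n + n}) : nat :=
  (\sum_(i < n) a (rshift n i))%N.

(* Good filtrations of [N] with respect to the filtration of [A_n(K)] whose
   [l]-th step is spanned by the [x^alpha d^beta] of weight at most [l].  The
   last clause is finite generation of the graded module: [gr N] is generated
   by the classes of the [g j] in degrees [d j]. *)
Definition good_filtration (w : 'X_{1..n + n} -> nat) (F : int -> set N) : Prop :=
  [/\ forall i, F i 0 /\
        forall (c : K) u v, F i u -> F i v -> F i (c *: u + v),
      (forall i, F i `<=` F (i + 1)) /\ (forall u, exists i, F i u),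
      exists i0 : int, forall i, i <= i0 -> F i = [set 0],
      forall a i u, F i u -> F (i + (w a)%:Z) (monop 1 a u) &
      exists (r : nat) (g : 'I_r -> N) (d : 'I_r -> int),
        (forall j, F (d j) (g j)) /\
        forall i u, F i u -> exists c : 'I_r -> {mpoly K[n + n]},
          (forall j a, a \in msupp (c j) -> d j + (w a)%:Z = i) /\
          F (i - 1) (u - \sum_j polyop 1 (c j) (g j))].

(* The relation [e(N) = e]; the value does not depend on the good filtration. *)
Definition multiplicity (e : rat) : Prop :=
  exists F : int -> set N, good_filtration bernstein_weight F /\
    exists q : {poly rat},
      hilbert_poly (fun l => quot_dim (F l%:Z) [set 0]) q /\
      e = hilbert_mult q.

(* [f] annihilates the class of [u] in [F i / F (i - 1)]; the homogeneous
   component of [f] of degree [d] maps this class into [F (i+d) / F (i+d-1)]. *)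
Definition gr_kills (F : int -> set N) (i : int) (u : N)
    (f : {mpoly K[n + n]}) : Prop :=
  forall d : nat,
    F (i + d%:Z - 1)
      (\sum_(a <- msupp f | order_weight a == d) f@_a *: monop 1 a u).

(* The support of [gr N] in [Spec K[x, xi]]; [gr N] is generated by its
   homogeneous elements, so its support is the union of theirs. *)
Definition singular_support (F : int -> set N) : set (set {mpoly K[n + n]}) :=
  [set P | prime_ideal P /\
    exists i u, F i u /\ forall f, gr_kills F i u f -> P f].

(* [Z] is a specialization-closed set of primes of Krull dimension [d]. *)
Definition krull_dim (Z : set (set {mpoly K[n + n]})) (d : nat) : Prop :=
  let chain (r : nat) := exists P : 'I_r.+1 -> set {mpoly K[n + n]},
    (forall i, Z (P i)) /\ forall i j : 'I_r.+1, (i < j)%N -> P i `<` P j in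
  chain d /\ ~ chain d.+1.

Definition holonomic : Prop :=
  exists F : int -> set N, good_filtration order_weight F /\
    ((forall u : N, u = 0) \/ krull_dim (singular_support F) n).

(* The polynomial ring [K[x^p, d^p]] acts on [N] through the center of
   [A_n(K)]; the variables [lshift n i] and [rshift n i] act as [x_i^p] and
   [d_i^p].  Points of the cotangent bundle of [(A^n)'] are its primes. *)
Definition center_act (p : nat) : {mpoly K[n + n]} -> N -> N := polyop p.

Definition p_support (p : nat) : set (set {mpoly K[n + n]}) :=
  [set P | prime_ideal P /\
    exists u, forall f, center_act p f u = 0 -> P f].

Definition p_support_generic (p : nat) (P : set {mpoly K[n + n]}) : Prop :=
  p_support p P /\ forall Q, p_support p Q -> Q `<=` P -> Q = P.

(* [rk_z N = r], for the point [z = P]: the dimension of [N (x) k(z)], which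
   equals [N_z (x) k(z)]; residue fields and base changes exist and are unique
   up to isomorphism. *)
Definition p_rank (p : nat) (P : set {mpoly K[n + n]}) (r : nat) : Prop :=
  forall (kz : fieldType) (phi : {rmorphism {mpoly K[n + n]} -> kz}),
    residue_field_at P phi ->
  forall (W : lmodType kz) (j : N -> W), base_change (center_act p) phi j ->
    quot_dim [set: W] [set 0] r.

End Weyl.

Section Degree.
Variables (K : fieldType) (m : nat).

Definition dehomog (f : {mpoly K[m.+1]}) : {mpoly K[m]} :=
  f \mPo (cons_tuple 1 [tuple 'X_i | i < m]).

(* [deg] of the reduced closure in [P^m] of the point [P] of [D_+(t_0) = A^m]:
   its homogeneous ideal consists in degree [l] of the forms of degree [l]
   whose dehomogenization lies in [P]. *)
Definition closure_degree (P : set {mpoly K[m]}) (d : rat) : Prop :=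
  exists q : {poly rat},
    hilbert_poly (fun l => quot_dim
      [set f : {mpoly K[m.+1]} | f \is l.-homog]
      [set f : {mpoly K[m.+1]} | f \is l.-homog /\ P (dehomog f)]) q /\
    d = hilbert_mult q.

End Degree.

(* Main.v *)
(* Let [N] be the generic fiber.  Holonomicity bounds the dimension of the [l]-th
   step of its Bernstein filtration by a constant times [l^n].  By a count of
   dimensions, there is then a linear symplectic change of coordinates
   [x'_m = x_m - sum_j s_mj d_j], with [s] symmetric and integral, after which [N] is
   finite over [K[x']].  If [rho] is its rank, comparing Hilbert polynomials gives
   [rho <= e].  The relations expressing finiteness and the independence of [rho]
   generators specialize to the fibers over a nonempty open set.  There the [l]-th
   step of the filtration has dimension at most [rho binom(l + c + n, n)], with [c]
   independent of the fiber.  Moreover the fiber has no torsion over [k[x']] for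
   large [p]: the torsion is killed by a fixed polynomial and it is stable under
   the [d_i], so it is killed by a nonzero constant.

   Let [P] be a generic point of the [p]-support and [C = k[x^p, d^p]].  There is a
   [w] with annihilator [P] in [C].  As [w] is not torsion, the Hilbert function [H]
   of [C / P] satisfies [binom(pl + n, n) <= p^(2n) H(l)].  If [t] elements of the fiber are
   independent over [C / P], then [t H(l) <= rho binom(pl + c' + n, n)].  Hence [H] has
   degree [n], with leading coefficient [D / n!] for an integer [D >= 1], the degree
   of the closure of [P], and [t D <= rho p^n].  The rank at [P] is such a number [t].
   As the Weyl algebra is Azumaya of rank [p^(2n)] over [C], the module generated by
   [w] contains [t >= p^n] independent elements, so that [D <= rho]. *)

Require Import Defs.
From HB Require Import structures.
From mathcomp Require Import all_boot all_order all_algebra.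
From mathcomp Require Import boolp classical_sets functions topology_structure.
From mathcomp Require Import mpoly ssrcomplements ring lra zify.

Set Implicit Arguments.
Unset Strict Implicit.
Unset Printing Implicit Defensive.

Import Order.TTheory GRing.Theory Num.Theory.
Local Open Scope classical_set_scope.
Local Open Scope ring_scope.

(** * Linear algebra *)

(** Holonomicity concerns the order filtration, while [e] and the degrees are read off the Bernstein
    filtration. The link is a rewriting of monomials that raises neither the order nor a degree in
    which the order is heavily weighted.

    The bound passes to the fibers through the rank rho and not through [e]: finiteness over a
    polynomial ring and independence of generators amount to finitely many relations, and one
    element of the base ring makes them all available in the fibers. The change of coordinates has
    to be common to all fibers, hence integral, and symmetric for the new coordinates to commute.

    In characteristic p, a central polynomial of degree l acts with Bernstein degree pl; this is the
    origin of p^n in t D <= rho p^n. It is cancelled by t >= p^n, which is a count: the p^(2n)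
    monomials with exponents below p act on the module generated by w as matrices of size t over the
    fraction field of C / P. If t^2 < p^(2n), some combination of them acts as zero, and commutators
    with the x_i and d_i reduce it to constants, which lie in P. *)

Section LinearAlgebra.
Variables (K : fieldType) (V : lmodType K).

Definition freefam (I : finType) (v : I -> V) : Prop :=
  forall c : I -> K, \sum_i c i *: v i = 0 -> forall i, c i = 0.

Definition subspace (A : set V) : Prop :=
  A 0 /\ forall (c : K) u v, A u -> A v -> A (c *: u + v).

(* In the applications [O] is all of [K] or a local ring in [K]. *)
Inductive lspan (O : set K) (A : set V) : V -> Prop :=
| LSpan0 : lspan O A 0
| LSpanS c u v : O c -> A u -> lspan O A v -> lspan O A (c *: u + v).

Lemma linear_relation (I J : finType) (C : I -> J -> K) : (#|J| < #|I|)%N ->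
  exists2 c : I -> K, exists i, c i != 0 & forall j, \sum_i c i * C i j = 0.
Proof.
move=> ltJI.
pose A := \matrix_(i < #|I|, j < #|J|) C (enum_val i) (enum_val j).
have /rowV0Pn [u /sub_kermxP uA u_neq0] : kermx A != 0.
  rewrite -mxrank_eq0 mxrank_ker subn_eq0 -ltnNge.
  exact: leq_ltn_trans (rank_leq_col A) ltJI.
exists (fun i => u 0 (enum_rank i)).
  have /matrix0Pn [i [j]] := u_neq0; rewrite [i]ord1 => uj.
  by exists (enum_val j); rewrite enum_valK.
move=> j; move/matrixP/(_ 0 (enum_rank j)): uA; rewrite !mxE => uA.
rewrite -[RHS]uA (reindex (@enum_val I I)) /=; last exact/onW_bij/enum_val_bij.
by apply: eq_bigr => i _; rewrite !mxE enum_valK enum_rankK.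
Qed.

Lemma free_card_le (I J : finType) (v : I -> V) (w : J -> V) : freefam v ->
  (forall i, exists c : J -> K, v i = \sum_j c j *: w j) -> (#|I| <= #|J|)%N.
Proof.
move=> fv /choice [C vE]; rewrite leqNgt; apply/negP => ltJI.
have [c [i ci] cC] := linear_relation C ltJI.
have /fv/(_ i)/eqP : \sum_i c i *: v i = 0; last by rewrite (negPf ci).
under eq_bigr => i' _ do rewrite vE scaler_sumr.
rewrite exchange_big big1 //= => j _.
under eq_bigr => i' _ do rewrite scalerA.
by rewrite -scaler_suml cC scale0r.
Qed.

Lemma lspan_mono (O : set K) (A B : set V) : A `<=` B -> lspan O A `<=` lspan O B.
Proof.
move=> AB u; elim=> [|c {}u v Oc Au _ IH]; first exact: LSpan0.
by apply: LSpanS => //; apply: AB.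
Qed.

Lemma lspanD (O : set K) (A : set V) u v :
  lspan O A u -> lspan O A v -> lspan O A (u + v).
Proof.
move=> + Av; elim=> [|c {}u w Oc Au _ IH]; first by rewrite add0r.
by rewrite -addrA; apply: LSpanS.
Qed.

Lemma lspan_bind (O : set K) (A B : set V) :
  (forall c u, O c -> A u -> lspan O B (c *: u)) -> lspan O A `<=` lspan O B.
Proof.
move=> AB u; elim=> [|c {}u v Oc Au _ IH]; first exact: LSpan0.
by apply: lspanD => //; apply: AB.
Qed.

Definition subring (O : set K) : Prop :=
  [/\ O 1, forall a b, O a -> O b -> O (a - b) &
      forall a b, O a -> O b -> O (a * b)].

Lemma subringT : subring setT. Proof. by []. Qed.

Section Subring.
Variables (O : set K).
Hypothesis sO : subring O.

Lemma subring0 : O 0.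
Proof. by case: sO => O1 OB _; rewrite -(subrr 1); apply: OB. Qed.

Lemma subringN a : O a -> O (- a).
Proof. by case: sO => _ OB _ Oa; rewrite -sub0r; apply: OB => //; exact: subring0. Qed.

Lemma subringD a b : O a -> O b -> O (a + b).
Proof.
by case: sO => _ OB _ Oa Ob; rewrite -(opprK b); apply/OB/subringN.
Qed.

Lemma subringM a b : O a -> O b -> O (a * b).
Proof. by case: sO => _ _; apply. Qed.

Lemma subring_nat m : O m%:R.
Proof.
case: sO => O1 _ _; elim: m => [|m IH]; first exact: subring0.
by rewrite -natr1; apply: subringD.
Qed.

Lemma lspanZ (A : set V) c u : O c -> lspan O A u -> lspan O A (c *: u).
Proof.
move=> Oc; elim=> [|d {}u v Od Au _ IH]; first by rewrite scaler0; exact: LSpan0.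
by rewrite scalerDr scalerA; apply: LSpanS => //; apply: subringM.
Qed.

Lemma lspanN (A : set V) u : lspan O A u -> lspan O A (- u).
Proof.
by rewrite -scaleN1r => Au; apply: lspanZ => //; apply: subringN; case: sO.
Qed.

Lemma lspanB (A : set V) u v : lspan O A u -> lspan O A v -> lspan O A (u - v).
Proof. by move=> Au Av; apply/lspanD/lspanN. Qed.

Lemma lspan1 (A : set V) u : A u -> lspan O A u.
Proof.
move=> Au; rewrite -[u]addr0 -[u]scale1r; apply: LSpanS => //.
  by case: sO.
exact: LSpan0.
Qed.

Lemma lspan_sub (A B : set V) :
  (forall u, A u -> lspan O B u) -> lspan O A `<=` lspan O B.
Proof. by move=> AB; apply: lspan_bind => c u Oc Au; apply/lspanZ/AB. Qed.

Lemma lspan_sum (A : set V) (I : Type) (r : seq I) (P : pred I) (F : I -> V) :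
  (forall i, P i -> lspan O A (F i)) -> lspan O A (\sum_(i <- r | P i) F i).
Proof.
move=> AF; apply: big_ind => [|u v|] //; first exact: LSpan0.
exact: lspanD.
Qed.

Lemma lspan_fin (J : finType) (w : J -> V) (A : set V) u :
  (forall v, A v -> exists j, v = w j) -> lspan O A u ->
  exists2 c : J -> K, forall j, O (c j) & u = \sum_j c j *: w j.
Proof.
move=> Aw; elim=> [|c {}u v Oc Au _ [d Od ->]].
  exists (fun=> 0) => [j|]; first exact: subring0.
  by rewrite big1 // => j _; rewrite scale0r.
have [j ->] := Aw _ Au.
exists (fun j' => (if j' == j then c else 0) + d j') => [j'|].
  by apply: subringD => //; case: ifP => _ //; exact: subring0.
under [RHS]eq_bigr => j' _ do rewrite scalerDl.
rewrite big_split /=; congr (_ + _); rewrite (bigD1 j) //= eqxx big1 ?addr0 // => j' /negPf ->.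
by rewrite scale0r.
Qed.

End Subring.

Lemma lspan_map (W : lmodType K) (f : {linear V -> W}) (O : set K) (A : set V)
    (B : W -> Prop) :
  B 0 -> (forall c u v, O c -> A u -> B v -> B (c *: f u + v)) ->
  forall u, lspan O A u -> B (f u).
Proof.
move=> B0 BS u; elim=> [|c {}u v Oc Au _ IH]; first by rewrite linear0.
by rewrite linearP; apply: BS.
Qed.

Lemma lspan_subspace (A B : set V) O : subspace B -> A `<=` B -> lspan O A `<=` B.
Proof.
by move=> [B0 BS] AB u; elim=> // c {}u v Oc /AB Bu _ Bv; apply: BS.
Qed.

Lemma subspace_lspan (A : set V) : subspace (lspan setT A).
Proof.
split=> [|c u v Au Av]; first exact: LSpan0.
by apply: lspanD => //; apply: (lspanZ subringT).
Qed.

Lemma subspaceD (A : set V) u v : subspace A -> A u -> A v -> A (u + v).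
Proof. by move=> [_ AS] Au Av; rewrite -[u]scale1r; apply: AS. Qed.

Lemma subspaceZ (A : set V) c u : subspace A -> A u -> A (c *: u).
Proof. by move=> [A0 AS] Au; rewrite -[_ *: _]addr0; apply: AS. Qed.

Lemma subspaceB (A : set V) u v : subspace A -> A u -> A v -> A (u - v).
Proof. by move=> sA Au Av; rewrite -scaleN1r; apply: subspaceD => //; apply: subspaceZ. Qed.

Lemma subspace_sum (A : set V) (I : Type) (r : seq I) (P : pred I) (F : I -> V) :
  subspace A -> (forall i, P i -> A (F i)) -> A (\sum_(i <- r | P i) F i).
Proof.
move=> sA AF; apply: big_ind => [|u v|] //; first by case: sA.
exact: subspaceD.
Qed.

Lemma free_lspan_card_le (I J : finType) (v : I -> V) (w : J -> V) (A : set V) :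
  freefam v -> (forall u, A u -> exists j, u = w j) ->
  (forall i, lspan setT A (v i)) -> (#|I| <= #|J|)%N.
Proof.
move=> fv Aw Av; apply: (free_card_le (w := w)) fv _ => i.
have [c _ vE] := lspan_fin subringT Aw (Av i).
by exists c.
Qed.

Lemma quot_dim_free (A : set V) r : quot_dim A [set 0] r ->
  exists b : 'I_r -> V, [/\ forall i, A (b i), freefam b &
    forall v, A v -> exists c : 'I_r -> K, v = \sum_i c i *: b i].
Proof.
move=> [b [Ab bP]]; exists b; split=> // [c cb|v /bP [c [/= /subr0_eq -> _]]];
  last by exists c.
have [i0|] := pselect (exists i : 'I_r, True); last first.
  by move=> nr i; case: nr; exists i.
have [i Ai] : exists i : 'I_r, A (b i) by case: i0 => i _; exists i; apply: Ab.
(* Adding the relation [c] to the coordinates [d] of a vector gives coordinates of the same vector;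
   uniqueness forces [c] to vanish. *)
have [d [/= dE dU]] := bP _ Ai.
have /dU e1 : [set 0] (b i - \sum_j (d j + c j) *: b j).
  rewrite /=; under eq_bigr => j _ do rewrite scalerDl.
  by rewrite big_split /= cb addr0.
by move=> j; apply: (addrI (d j)); rewrite addr0; exact: e1.
Qed.

Lemma max_free (J : finType) (w : J -> V) :
  exists S : {set J}, freefam (fun j : {j | j \in S} => w (val j)) /\
    forall j, exists c : {j | j \in S} -> K, w j = \sum_i c i *: w (val i).
Proof.
pose fr (S : {set J}) := `[< freefam (fun j : {j | j \in S} => w (val j)) >].
have fr0 : fr finset.set0.
  by apply/asboolP => c _ i; have := valP i; rewrite finset.in_set0.
case: (@finset.maxset_exists _ fr finset.set0 fr0) => S /finset.maxsetP [/asboolP fS mS] _.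
exists S; split=> // j.
case: (boolP (j \in S)) => [jS|jS].
  exists (fun i => (i == exist _ j jS)%:R).
  rewrite (bigD1 (exist _ j jS)) //= eqxx scale1r big1 ?addr0 // => i /negPf ->.
  by rewrite scale0r.
have : ~ freefam (fun i : {i | i \in (j |: S)%SET} => w (val i)).
  move=> /asboolP /mS e; move: jS; rewrite -[in j \in _]e ?finset.setU11 //.
  exact: finset.subsetU1.
move=> /existsNP [c /not_implyP [c0 /existsNP [i0 ci0]]].
pose c' (i : J) := if insub i is Some i' then c i' else 0.
have cE (i : {j0 | j0 \in (j |: S)%SET}) : c i = c' (val i) by rewrite /c' valK.
have c0' : \sum_(i in (j |: S)%SET) c' i *: w i = 0.
  by rewrite -[RHS]c0 big_sub /=; apply: eq_bigr => i _; rewrite cE.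
rewrite finset.big_setU1 //= in c0'.
have cSE : \sum_(i in S) c' i *: w i = \sum_(i : {j | j \in S}) c' (val i) *: w (val i).
  by rewrite big_sub.
rewrite cSE in c0'.
have cj : c' j != 0.
  apply/eqP => cj0; move: c0'; rewrite cj0 scale0r add0r => /fS cS.
  apply: ci0; rewrite cE; case: (finset.setU1P (valP i0)) => [-> //|iS].
  exact: (cS (exist _ (val i0) iS)).
exists (fun i => - (c' j)^-1 * c' (val i)).
under eq_bigr => i _ do rewrite -scalerA.
rewrite -scaler_sumr; move/eqP: c0'; rewrite addrC addr_eq0 => /eqP ->.
by rewrite scalerN scaleNr opprK scalerA mulVf // scale1r.
Qed.

End LinearAlgebra.

(** * Monomials and filtrations in the Weyl algebra *)

Section PowerOperators.
Variables (K : fieldType) (n : nat) (N : weyl_module K n) (f : 'I_n -> N -> N).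
Hypothesis fC : forall i j u, f i (f j u) = f j (f i u).

Lemma iter_comm (T : Type) (g h : T -> T) m u :
  (forall u, g (h u) = h (g u)) -> g (iter m h u) = iter m h (g u).
Proof. by move=> gh; elim: m => //= m IH; rewrite gh IH. Qed.

Lemma powop_comm (g : N -> N) a u :
  (forall i u, g (f i u) = f i (g u)) -> g (powop f a u) = powop f a (g u).
Proof.
move=> gf; rewrite /powop; elim: (enum _) => //= i s IH.
by rewrite iter_comm ?IH.
Qed.

Lemma powop0 a u : (forall i, a i = 0%N) -> powop f a u = u.
Proof. by move=> a0; rewrite /powop; elim: (enum _) => //= i s ->; rewrite a0. Qed.

Lemma eq_powop a b u : a =1 b -> powop f a u = powop f b u.
Proof. by move=> ab; rewrite /powop; elim: (enum _) => //= i s ->; rewrite ab. Qed.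

Lemma powop_add a b u :
  powop f (fun i => a i + b i)%N u = powop f a (powop f b u).
Proof.
rewrite /powop; elim: (enum _) => //= i s ->; rewrite iterD; congr iter.
move: (foldr _ u s) => v; elim: s => //= j s IH.
by rewrite iter_comm ?IH // => w; rewrite -iter_comm.
Qed.

Lemma powop1 i a u : powop f (fun j => a j + (i == j))%N u = f i (powop f a u).
Proof.
rewrite (@powop_comm (f i)) => [|j v]; last exact: fC.
rewrite powop_add; congr powop; rewrite /powop.
have : i \in enum 'I_n by rewrite mem_enum.
elim: (enum _) (enum_uniq 'I_n) => //= j s IH /andP [js us].
rewrite inE; case: eqVneq => [ij _|ij /= /(IH us) -> //] /=; rewrite -{}ij in js *.
elim: s js {IH us} => //= k s IH; rewrite inE negb_or => /andP [/negPf -> /=].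
exact: IH.
Qed.

End PowerOperators.

Section PowerOperatorsLinear.
Variables (K : fieldType) (n : nat) (N : weyl_module K n).

Lemma powop_linear (f : 'I_n -> N -> N) a :
  (forall i, linear (f i)) -> linear (powop f a).
Proof.
move=> fL c u v; rewrite /powop; elim: (enum _) => //= i s ->.
by elim: (a i) => //= m ->; rewrite fL.
Qed.

Lemma powop_iter (f : 'I_n -> N -> N) c a u :
  powop f (fun i => c * a i)%N u = powop (fun i => iter c (f i)) a u.
Proof.
rewrite /powop; elim: (enum _) => //= i s ->.
by elim: (a i) => [|m IH]; rewrite ?muln0 // mulnS iterD IH.
Qed.

End PowerOperatorsLinear.

Section Monomials.
Variables (K : fieldType) (n : nat) (N : weyl_module K n).
Implicit Types (a b : 'X_{1..n + n}) (u v : N).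

Notation xv i := (lshift n i).
Notation dv i := (rshift n i).

Lemma monopE c a u : monop c a u =
  powop (fun i => iter c (wx N i)) (fun i => a (xv i))
    (powop (fun i => iter c (wd N i)) (fun i => a (dv i)) u).
Proof. by rewrite /monop !powop_iter. Qed.

Lemma monop_linear c a : linear (@monop K n N c a).
Proof.
by move=> k u v; rewrite /monop !powop_linear // => i k' u' v'; exact: linearP.
Qed.

HB.instance Definition _ c a := GRing.isLinear.Build K N N _ (@monop K n N c a)
  (@monop_linear c a).

Lemma wx_iterC c e i j u : iter c (wx N i) (iter e (wx N j) u) =
  iter e (wx N j) (iter c (wx N i) u).
Proof. by apply: iter_comm => v; rewrite -iter_comm // => w; exact: wxC. Qed.

Lemma monop0 c u : monop c 0%MM u = u.
Proof. by rewrite monopE !powop0 // => i; rewrite mnm0E. Qed.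

Lemma monop_x c i a u : monop c (a + U_(xv i))%MM u = iter c (wx N i) (monop c a u).
Proof.
rewrite !monopE; set w := powop _ _ u.
have -> : w = powop (fun j => iter c (wd N j)) (fun j => a (dv j)) u.
  by apply: eq_powop => j; rewrite mnmDE mnm1E eq_lrshift addn0.
rewrite -[RHS](@powop1 _ _ _ (fun j => iter c (wx N j))); last by move=> *; exact: wx_iterC.
by apply: eq_powop => j; rewrite mnmDE mnm1E (inj_eq (@lshift_inj _ _)).
Qed.

Lemma wd_iter_x i j m u : wd N i (iter m (wx N j) u) =
  iter m (wx N j) (wd N i u) + (m * (i == j))%:R *: iter m.-1 (wx N j) u.
Proof.
elim: m => [|m IH] /=; first by rewrite mul0n scale0r addr0.
have /eqP := wdx i j (iter m (wx N j) u); rewrite subr_eq => /eqP ->.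
rewrite IH linearD addrCA; congr (_ + _).
case: eqVneq => [<-|_]; last by rewrite !muln0 !scale0r linear0 add0r.
rewrite !muln1 -natr1 scalerDl addrC; congr (_ + _).
by case: m {IH} => [|m]; rewrite linearZ //= !scale0r.
Qed.

Lemma wd_powx i (a : 'I_n -> nat) u : wd N i (powop (wx N) a u) = powop (wx N) a (wd N i u) +
  (a i)%:R *: powop (wx N) (fun j => a j - (i == j))%N u.
Proof.
rewrite /powop; have : i \in enum 'I_n by rewrite mem_enum.
elim: (enum _) (enum_uniq 'I_n) => //= j s IH /andP [js us].
have E : i \notin s -> wd N i (foldr (fun k => iter (a k) (wx N k)) u s) =
    foldr (fun k => iter (a k) (wx N k)) (wd N i u) s.
  elim: s {IH js us} => //= k s IH; rewrite inE negb_or => /andP [/negPf ik /IH E].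
  by rewrite wd_iter_x ik muln0 scale0r addr0 E.
rewrite inE wd_iter_x; case: eqVneq => [ij _|ij /= /(IH us) ->].
  subst j; rewrite E // muln1 subn1; congr (_ + _ *: iter _ _ _).
  elim: s js {IH us E} => //= k s IH; rewrite inE negb_or => /andP [ik /IH ->].
  by rewrite (negPf ik) subn0.
rewrite muln0 scale0r addr0 subn0 -[a j]addn0.
elim: (a j + 0)%N => //= m ->; by rewrite linearD linearZ.
Qed.

Lemma mon_x i a u : wx N i (monop 1 a u) = monop 1 (a + U_(xv i))%MM u.
Proof. by rewrite monop_x. Qed.

Lemma mon_d i a u : wd N i (monop 1 a u) = monop 1 (a + U_(dv i))%MM u +
  (a (xv i))%:R *: monop 1 (a - U_(xv i))%MM u.
Proof.
rewrite /monop wd_powx mul1n; congr (_ + _).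
  rewrite -[X in powop _ _ X](@powop1 _ _ _ (fun j => wd N j)); last exact: wdC.
  rewrite [RHS](eq_powop _ (b := fun j => 1 * a (xv j))%N) => [|j]; last first.
    by rewrite !mul1n mnmDE mnm1E eq_rlshift addn0.
  congr powop; apply: eq_powop => j.
  by rewrite !mul1n mnmDE mnm1E (inj_eq (@rshift_inj _ _)).
congr (_ *: _).
rewrite [LHS](eq_powop _ (b := fun j => 1 * (a - U_(xv i))%MM (xv j))%N) => [|j].
  by congr powop; apply: eq_powop => j; rewrite !mul1n mnmBE mnm1E eq_lrshift subn0.
by rewrite !mul1n mnmBE mnm1E (inj_eq (@lshift_inj _ _)).
Qed.

Lemma order_weightD a b : order_weight (a + b) = (order_weight a + order_weight b)%N.
Proof.
by rewrite /order_weight -big_split; apply: eq_bigr => i _; rewrite mnmDE.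
Qed.

Lemma order_weight_x i : order_weight U_(xv i) = 0%N.
Proof. by rewrite /order_weight big1 // => j _; rewrite mnm1E eq_lrshift. Qed.

Lemma order_weight_d i : order_weight U_(dv i) = 1%N.
Proof.
rewrite /order_weight (bigD1 i) //= mnm1E eqxx big1 ?addn0 // => j /negPf ji.
by rewrite mnm1E (inj_eq (@rshift_inj _ _)) eq_sym ji.
Qed.

Lemma order_weight_le a : (order_weight a <= mdeg a)%N.
Proof.
by rewrite mdegE big_split_ord /= leq_addl.
Qed.

Lemma mnm_subK1 (m : nat) (a : 'X_{1..m}) i :
  (0 < a i)%N -> (a - U_(i) + U_(i))%MM = a.
Proof. by move=> ai; rewrite submK // lep1mP -lt0n. Qed.

Lemma lspan_x (O : set K) (A B : set N) i :
  (forall v, A v -> exists b w, v = monop 1 b w /\ B (monop 1 (b + U_(xv i))%MM w)) ->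
  forall v, lspan O A v -> lspan O B (wx N i v).
Proof.
move=> AB v; elim=> [|c {}v w Oc /AB [b [z [-> Bx]]] _ IH].
  by rewrite linear0; exact: LSpan0.
by rewrite linearP mon_x; apply: LSpanS.
Qed.

Lemma lspan_d (O : set K) (A B : set N) i : subring O ->
  (forall v, A v -> exists b w, [/\ v = monop 1 b w, B (monop 1 (b + U_(dv i))%MM w) &
     (0 < b (xv i))%N -> B (monop 1 (b - U_(xv i))%MM w)]) ->
  forall v, lspan O A v -> lspan O B (wd N i v).
Proof.
move=> sO AB v; elim=> [|c {}v w Oc /AB [b [z [-> Bd Bl]]] _ IH].
  by rewrite linear0; exact: LSpan0.
rewrite linearP mon_d scalerDr -addrA; apply: LSpanS => //.
case: (posnP (b (xv i))) => [->|bi]; first by rewrite scale0r scaler0 add0r.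
rewrite scalerA; apply: LSpanS => //; last exact: Bl.
by apply: subringM => //; apply: subring_nat.
Qed.

End Monomials.

Notation xvar n i := (lshift n (i : 'I_n)).
Notation dvar n i := (rshift n (i : 'I_n)).

Section Filtration.
Variables (K : fieldType) (n : nat) (N : weyl_module K n).

Inductive words (G : set N) : nat -> N -> Prop :=
| Word0 l u : G u -> words G l u
| WordX l i u : words G l u -> words G l.+1 (wx N i u)
| WordD l i u : words G l u -> words G l.+1 (wd N i u).

(* [gam setT G l] is the step [Gamma_l] of the Bernstein filtration generated by [G]. *)
Definition gam (O : set K) (G : set N) (l : nat) : set N := lspan O (words G l).

Definition mons (G : set N) (l : nat) : set N :=
  [set u | exists a g, [/\ (mdeg a <= l)%N, G g & u = monop 1 a g]].

Lemma words_le G l l' u : (l <= l')%N -> words G l u -> words G l' u.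
Proof.
move=> + Gu; elim: Gu l' => [m v Gv|m i v _ IH|m i v _ IH] [|l'] // ll.
- exact: Word0.
- exact: Word0.
- by apply/WordX/IH.
- by apply/WordD/IH.
Qed.

Lemma gam_le O G l l' : (l <= l')%N -> gam O G l `<=` gam O G l'.
Proof. by move=> ll; apply: lspan_mono => u; apply: words_le. Qed.

Lemma gam_x O G l i u : gam O G l u -> gam O G l.+1 (wx N i u).
Proof.
move=> Gu; apply: (lspan_map (B := gam O G l.+1)) Gu; first exact: LSpan0.
by move=> c v w Oc Gv Gw; apply: LSpanS => //; apply: WordX.
Qed.

Lemma gam_d O G l i u : gam O G l u -> gam O G l.+1 (wd N i u).
Proof.
move=> Gu; apply: (lspan_map (B := gam O G l.+1)) Gu; first exact: LSpan0.
by move=> c v w Oc Gv Gw; apply: LSpanS => //; apply: WordD.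
Qed.

Lemma mdegDU (m : nat) (a : 'X_{1..m}) i : mdeg (a + U_(i))%MM = (mdeg a).+1.
Proof. by rewrite mdegD mdeg1 addn1. Qed.

Lemma gam_mons O G l : subring O -> gam O G l `<=` lspan O (mons G l).
Proof.
move=> sO; apply: lspan_sub => // u.
elim=> {l u} [l u Gu|l i u _ IH|l i u _ IH].
- by apply: lspan1 => //; exists 0%MM, u; rewrite mdeg0 monop0.
- apply: lspan_x IH => v [a [g [la Gg ->]]]; exists a, g; split=> //.
  by exists (a + U_(lshift n i))%MM, g; rewrite mdegDU.
- apply: (lspan_d sO) IH => v [a [g [la Gg ->]]]; exists a, g; split=> //.
    by exists (a + U_(rshift n i))%MM, g; rewrite mdegDU.
  exists (a - U_(lshift n i))%MM, g; split=> //.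
  by apply: leq_trans (mdegB _ _) _; apply: leqW.
Qed.

Lemma iter_words (G : set N) (h : N -> N) m l u :
  (forall l u, words G l u -> words G l.+1 (h u)) ->
  words G l u -> words G (l + m)%N (iter m h u).
Proof.
by move=> hG Gu; elim: m => [|m IH]; rewrite ?addn0 // addnS; apply: hG.
Qed.

Lemma powop_words (G : set N) (h : 'I_n -> N -> N) a l u :
  (forall i l u, words G l u -> words G l.+1 (h i u)) ->
  words G l u -> words G (l + \sum_i a i)%N (powop h a u).
Proof.
move=> hG Gu; rewrite /powop -big_enum /=.
elim: (enum _) => [|i s IH] /=; first by rewrite big_nil addn0.
by rewrite big_cons addnCA addnC; apply: iter_words => //; apply: hG.
Qed.

Lemma monop_words G c a l u : words G l u -> words G (l + c * mdeg a)%N (monop c a u).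
Proof.
move=> Gu; rewrite mdegE big_split_ord /= mulnDr [in X in words _ X]addnC.
rewrite -addnA addnC !big_distrr /=.
apply: powop_words => [|]; first by move=> *; exact: WordX.
by rewrite addnC; apply: powop_words => // *; exact: WordD.
Qed.

Lemma monop_gam G c a l v : gam setT G l v -> gam setT G (l + c * mdeg a) (monop c a v).
Proof.
move=> vl; apply: (lspan_map (f := @monop K n N c a) (B := gam setT G _)) vl.
  exact: LSpan0.
by move=> d v1 v2 _ vw Gv; apply: LSpanS => //; exact: monop_words.
Qed.

Lemma mons_words G l : mons G l `<=` words G l.
Proof.
move=> u [a [g [la Gg ->]]]; apply: words_le la _.
by rewrite -[mdeg a]mul1n -[(_ * _)%N]add0n; apply/monop_words/Word0.
Qed.

End Filtration.

(** * Rewriting of monomials modulo smaller ones *)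

Section Reduction.
Variables (K : fieldType) (n : nat) (N : weyl_module K n) (r : nat).
Variables (O : set K) (g : 'I_r -> N).
Hypothesis sO : subring O.

Notation T := ('X_{1..n + n} * 'I_r)%type.
Definition mong (t : T) : N := monop 1 t.1 (g t.2).

Variable lt : T -> T -> Prop.
Hypothesis lt_wf : well_founded lt.
Hypothesis lt_trans : forall s t w, lt s t -> lt t w -> lt s w.
Hypothesis lt_add : forall a b j k i,
  lt (a, j) (b, k) -> lt ((a + U_(i))%MM, j) ((b + U_(i))%MM, k).
Hypothesis lt_low : forall (a : 'X_{1..n + n}) i j, (0 < a (lshift n i))%N ->
  lt ((a - U_(lshift n i))%MM, j) ((a + U_(rshift n i))%MM, j).

Definition below (t : T) : set N := [set u | exists2 s, lt s t & u = mong s].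

Definition reducible (t : T) : Prop := lspan O (below t) (mong t).

Lemma below_x (a : 'X_{1..n + n}) j u i : lspan O (below (a, j)) u ->
  lspan O (below ((a + U_(lshift n i))%MM, j)) (wx N i u).
Proof.
apply: lspan_x => v [[b k] ltb ->]; exists b, (g k); split=> //.
by exists ((b + U_(lshift n i))%MM, k) => //; apply: lt_add.
Qed.

Lemma below_d (a : 'X_{1..n + n}) j u i : lspan O (below (a, j)) u ->
  lspan O (below ((a + U_(rshift n i))%MM, j)) (wd N i u).
Proof.
apply: (lspan_d sO) => v [[b k] ltb ->]; exists b, (g k); split=> // [|bi].
  by exists ((b + U_(rshift n i))%MM, k) => //; apply: lt_add.
by exists ((b - U_(lshift n i))%MM, k) => //; apply: lt_trans (lt_low _ bi) (lt_add _ _).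
Qed.

(** Multiplication by x_i on the left only shifts exponents. Multiplication by d_i also produces the
    commutator term, with one x_i less, which [lt_low] places below the new monomial. No division
    occurs, so [O] may be a local ring. *)
Lemma reducible_mul (a : 'X_{1..n + n}) j i :
  reducible (a, j) -> reducible ((a + U_(i))%MM, j).
Proof.
rewrite /reducible /= => red; case: (split_ordP i) => k ->.
  by have := below_x k red; rewrite /mong mon_x.
have := below_d k red; rewrite /mong mon_d /= => red_d.
rewrite -[monop 1 _ _](addrK ((a (lshift n k))%:R *: monop 1 (a - U_(lshift n k))%MM (g j))).
apply: lspanB => //.
case: (posnP (a (lshift n k))) => [->|ai]; first by rewrite scale0r; exact: LSpan0.
apply: lspanZ => //; first exact: subring_nat.
by apply: lspan1 => //; exists ((a - U_(lshift n k))%MM, j) => //; apply: lt_low.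
Qed.

Lemma reducible_le (a b : 'X_{1..n + n}) j : (a <= b)%MM ->
  reducible (a, j) -> reducible (b, j).
Proof.
move=> /submK <-; move: (b - a)%MM => c; rewrite addmC.
have [m] := ubnP (mdeg c); elim: m c => // m IH c cm red.
case: (eqVneq c 0%MM) => [->|]; first by rewrite addm0.
rewrite -mdeg_eq0 mdegE sum_nat_eq0 negb_forall => /existsP [i ci].
have ci0 : (0 < c i)%N by rewrite lt0n.
rewrite -(mnm_subK1 ci0) addmA; apply: reducible_mul; apply: IH => //.
by rewrite -(mdegDU _ i) mnm_subK1.
Qed.

Lemma reduce (std : set T) : (forall t, ~ std t -> reducible t) ->
  forall t, lspan O [set u | exists s, [/\ std s, s = t \/ lt s t & u = mong s]] (mong t).
Proof.
move=> red; elim/(well_founded_ind lt_wf) => t IH.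
have [st|/red] := pselect (std t).
  by apply: lspan1 => //; exists t; split=> //; left.
apply: lspan_sub => // u [s ls ->].
apply: lspan_mono (IH _ ls) => v [w [sw ws ->]]; exists w; split=> //; right.
by case: ws => [-> //|lw]; apply: lt_trans lw ls.
Qed.

End Reduction.

(** * Counting monomials *)

Section Counting.

(** A multi-index is recorded by the set of its large positions, its small exponents and the list of
    its large exponents. Only the list depends on [L], and it has at most [d] entries; hence the
    growth L^d. *)
Lemma few_large_exponents (m d D L : nat) :
  exists (J : finType) (w : J -> 'X_{1..m}),
    #|J| = (2 ^ m * D.+1 ^ m * L.+1 ^ d)%N /\
    forall a : 'X_{1..m}, (#|[pred i | (D <= a i)%N]| <= d)%N ->
      (forall i, a i <= L)%N -> exists j, a = w j.
Proof.
pose J := ({ffun 'I_m -> bool} * {ffun 'I_m -> 'I_D.+1} * {ffun 'I_d -> 'I_L.+1})%type.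
pose w (t : J) : 'X_{1..m} := [multinom
  if t.1.1 i then
    if insub (index i (enum (t.1.1 : pred 'I_m))) is Some k then t.2 k : nat else 0%N
  else t.1.2 i : nat | i < m].
exists J, w; split.
  by rewrite !card_prod !card_ffun !card_ord card_bool.
move=> a da aL.
pose S := [ffun i => (D <= a i)%N].
(* Where [a i] exceeds [D], [inord] returns a default value, which [w] does not read. *)
pose b := [ffun i : 'I_m => inord (a i) : 'I_D.+1].
pose c := [ffun k : 'I_d => inord (nth 0%N [seq a i | i <- enum (S : pred 'I_m)] k) : 'I_L.+1].
exists (S, b, c); apply/mnmP => i; rewrite mnmE /=.
case: ifP => [iS|/negbT iS]; last first.
  rewrite ffunE inordK //; move: iS; rewrite ffunE -ltnNge => aD.
  exact: leq_trans aD (leqnSn _).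
have iS' : i \in enum (S : pred 'I_m) by rewrite mem_enum.
have idx : (index i (enum (S : pred 'I_m)) < size (enum (S : pred 'I_m)))%N.
  by rewrite index_mem.
have idd : (index i (enum (S : pred 'I_m)) < d)%N.
  apply: leq_trans idx _; rewrite -cardE (leq_trans _ da) // subset_leq_card //.
  by apply/fintype.subsetP => k; rewrite !inE /= /in_mem /= ffunE.
rewrite insubT ffunE /= (nth_map i) // nth_index //.
by rewrite inordK // ltnS.
Qed.

Definition mnm_cons (n c : nat) (a : 'X_{1..n}) : 'X_{1..n.+1} :=
  [multinom if unlift ord0 i is Some j then a j else c | i < n.+1].

Definition mnm_tail (n : nat) (a : 'X_{1..n.+1}) : 'X_{1..n} :=
  [multinom a (lift ord0 i) | i < n].

Lemma mnm_cons0 n c (a : 'X_{1..n}) : mnm_cons c a ord0 = c.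
Proof. by rewrite mnmE unlift_none. Qed.

Lemma mnm_consS n c (a : 'X_{1..n}) i : mnm_cons c a (lift ord0 i) = a i.
Proof. by rewrite mnmE liftK. Qed.

Lemma mnm_tailK n (a : 'X_{1..n.+1}) : mnm_cons (a ord0) (mnm_tail a) = a.
Proof.
apply/mnmP => i; case: (unliftP ord0 i) => [j|] ->; last exact: mnm_cons0.
by rewrite mnm_consS mnmE.
Qed.

Lemma mnm_consK n c (a : 'X_{1..n}) : mnm_tail (mnm_cons c a) = a.
Proof. by apply/mnmP => i; rewrite mnmE mnm_consS. Qed.

Lemma mdeg_cons n c (a : 'X_{1..n}) : mdeg (mnm_cons c a) = (c + mdeg a)%N.
Proof.
rewrite !mdegE big_ord_recl mnm_cons0; congr (_ + _)%N.
by apply: eq_bigr => i _; rewrite mnm_consS.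
Qed.

(** A slack exponent turns degree at most l in n variables into degree exactly l in n + 1
    variables. *)
Lemma card_bmnm n l : #|{: 'X_{1..n < l.+1}}| = 'C(l + n, n).
Proof.
rewrite -[RHS](@bin_sub _ n) ?leq_addl // addnK -size_basis cardE.
set s := map _ _; transitivity (size (map (@mnm_tail n) s)); last by rewrite size_map.
rewrite -(size_map val); apply/perm_size/uniq_perm.
- by rewrite map_inj_uniq ?enum_uniq //; exact: val_inj.
- rewrite map_inj_in_uniq ?uniq_basis // => a b.
  rewrite -!basis_cover => /eqP al /eqP bl tab.
  rewrite -[a]mnm_tailK -[b]mnm_tailK -tab; congr mnm_cons.
  move: al; rewrite -bl -[a]mnm_tailK -[b in RHS]mnm_tailK !mdeg_cons -tab.
  by move/addIn; rewrite !mnm_tailK.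
move=> a; apply/mapP/mapP => [[b _ ->]|[b]].
  exists (mnm_cons (l - mdeg b) b); last by rewrite mnm_consK.
  by rewrite -basis_cover mdeg_cons subnK // -ltnS bmdeg.
rewrite -basis_cover => /eqP bl ->.
have lt : (mdeg (mnm_tail b) < l.+1)%N.
  by rewrite -bl ltnS -[b in (_ <= mdeg b)%N]mnm_tailK mdeg_cons leq_addl.
by exists (BMultinom lt); rewrite ?mem_enum.
Qed.

End Counting.

(** * Growth of numerical polynomials *)

Section HilbertPolynomials.

(** The uniform bound [eps] carries the induction along Horner's scheme: if q >= eps eventually,
    then q l + c >= eps l + c, which exceeds eps for large l. *)
Lemma poly_eventually_pos (q : {poly rat}) : 0 < lead_coef q ->
  exists eps l0, 0 < eps /\ forall l : nat, (l0 <= l)%N -> eps <= q.[l%:R].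
Proof.
elim/poly_ind: q => [|q c IH]; first by rewrite lead_coef0 ltxx.
case: (eqVneq q 0) => [->|q0].
  rewrite mul0r add0r lead_coefC => c0; exists c, 0%N; split=> // l _.
  by rewrite hornerC.
rewrite lead_coefDl ?lead_coefMX; last first.
  by rewrite size_mulX // ltnS (leq_trans (size_polyC_leq1 c)) // size_poly_gt0.
move=> /IH [eps [l0 [e0 qe]]].
pose b := Num.bound `|(eps - c) / eps|; exists eps, (maxn l0 b); split=> // l.
rewrite geq_max => /andP [ll lb]; rewrite !hornerE.
have h : (eps - c) / eps <= l%:R.
  apply: le_trans (ler_norm _) (le_trans (ltW (archi_boundP (normr_ge0 _))) _).
  by rewrite ler_nat.
move: h; rewrite ler_pdivrMr // lerBlDr => /le_trans -> //.
by rewrite lerD2r mulrC ler_wpM2r // qe.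
Qed.

Lemma lead_coef_ge0 (q : {poly rat}) (l0 : nat) :
  (forall l : nat, (l0 <= l)%N -> 0 <= q.[l%:R]) -> 0 <= lead_coef q.
Proof.
move=> q0; rewrite leNgt -oppr_gt0 -lead_coefN; apply/negP.
move/poly_eventually_pos => [eps [l1 [e0 qe]]].
have := qe _ (leq_maxr l0 l1); rewrite hornerN; apply/negP; rewrite -ltNge.
by apply: le_lt_trans e0; rewrite oppr_le0 q0 // leq_maxl.
Qed.

(** Stated for the coefficient of index n and not for the leading one, as the degrees may be smaller
    than n. *)
Lemma coef_le (p q : {poly rat}) (n l0 : nat) :
  (size p <= n.+1)%N -> (size q <= n.+1)%N ->
  (forall l : nat, (l0 <= l)%N -> p.[l%:R] <= q.[l%:R]) -> p`_n <= q`_n.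
Proof.
move=> sp sq pq; rewrite -subr_ge0 -coefB.
have /lead_coef_ge0 : forall l : nat, (l0 <= l)%N -> 0 <= (q - p).[l%:R].
  by move=> l /pq; rewrite hornerD hornerN subr_ge0.
rewrite /lead_coef; have : (size (q - p)%R <= n.+1)%N.
  by rewrite (leq_trans (size_polyD _ _)) // size_polyN geq_max sq sp.
rewrite leq_eqVlt => /orP [/eqP -> //|].
by rewrite ltnS => /(nth_default 0) ->.
Qed.

Lemma size_poly_le_growth (p q : {poly rat}) (l0 : nat) :
  (forall l : nat, (l0 <= l)%N -> 0 <= p.[l%:R] <= q.[l%:R]) ->
  (size p <= size q)%N.
Proof.
move=> pq; rewrite leqNgt; apply/negP => ltqp.
have p0 : 0 < lead_coef p.
  rewrite lt_neqAle eq_sym lead_coef_eq0 -size_poly_gt0 (leq_ltn_trans _ ltqp) //=.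
  by apply: (lead_coef_ge0 (l0 := l0)) => l /pq /andP [].
have : 0 <= lead_coef (q - p).
  by apply: (lead_coef_ge0 (l0 := l0)) => l /pq /andP [_]; rewrite !hornerE subr_ge0.
rewrite addrC lead_coefDl ?size_polyN // lead_coefN oppr_ge0.
by rewrite leNgt p0.
Qed.

(** The polynomial l -> binom(l + c + n, n); for c = -b it counts the monomials of degree at most l
    in n variables, shifted by degree b. *)
Definition bin_poly (n : nat) (c : rat) : {poly rat} :=
  \prod_(i < n) ((i.+1%:R)^-1 *: ('X + (c + i.+1%:R)%:P)).

Lemma bin_polyE n (l c : nat) : (c <= l)%N ->
  (bin_poly n (- c%:R)).[l%:R] = 'C(l - c + n, n)%:R.
Proof.
move=> cl; rewrite horner_prod; elim: n => [|n IH].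
  by rewrite big_ord0 bin0.
rewrite big_ord_recr IH /= hornerZ hornerD hornerX hornerC addrA -natrB // -natrD.
have n0 : (n.+1%:R : rat) != 0 by rewrite pnatr_eq0.
apply: (mulfI n0); rewrite mulrCA mulVKf // -!natrM; congr _%:R.
by rewrite addnS -mul_bin_diag mulnC.
Qed.

Lemma size_bin_poly n c : size (bin_poly n c) = n.+1.
Proof.
rewrite /bin_poly size_prod => [|i _]; last first.
  by rewrite scaler_eq0 invr_eq0 pnatr_eq0 /= -size_poly_eq0 size_XaddC.
under eq_bigr => i _ do rewrite size_scale ?invr_eq0 ?pnatr_eq0 // size_XaddC.
by rewrite sum_nat_const card_ord muln2 -addnn subSn ?leq_addr // addnK.
Qed.

Lemma coef_bin_poly n c : (bin_poly n c)`_n = (n`!%:R)^-1.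
Proof.
have -> : (bin_poly n c)`_n = lead_coef (bin_poly n c).
  by rewrite /lead_coef size_bin_poly.
rewrite lead_coef_prod; elim: n => [|n IH]; first by rewrite big_ord0 invr1.
rewrite big_ord_recr IH /= lead_coefZ lead_coefDl ?size_polyX ?lead_coefX ?mulr1.
  by rewrite factS natrM invfM mulrC.
by rewrite ltnS size_polyC leq_b1.
Qed.

End HilbertPolynomials.

(** * Chains of primes in polynomial rings *)

Section PrimeIdeals.

Definition ideal (R : comPzRingType) (I : set R) : Prop :=
  (I 0 /\ (forall f g, I f -> I g -> I (f + g))) /\ (forall f g, I g -> I (f * g)).

Lemma ideal_sum (R : comPzRingType) (I : set R) (T : Type) (r : seq T)
    (P : pred T) (F : T -> R) :
  ideal I -> (forall i, P i -> I (F i)) -> I (\sum_(i <- r | P i) F i).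
Proof. by move=> [[I0 ID] _] IF; apply: big_ind. Qed.

Lemma idealB (R : comPzRingType) (I : set R) f g : ideal I -> I f -> I g -> I (f - g).
Proof. by move=> [[_ ID] IM] If Ig; rewrite -mulN1r; apply: ID => //; apply: IM. Qed.

Lemma ideal_prime (R : comPzRingType) (P : set R) : prime_ideal P -> ideal P.
Proof. by case. Qed.

Lemma prime_avoiding (R : comPzRingType) (I S : set R) : ideal I ->
  S 1 -> (forall f g, S f -> S g -> S (f * g)) -> (forall f, I f -> ~ S f) ->
  exists P, [/\ prime_ideal P, I `<=` P & forall f, P f -> ~ S f].
Proof.
move=> Ii S1 SM IS.
(* The property is stated for the union of [I] and [X] so that it holds for the empty union, where
   it says that [I] is an ideal avoiding [S]. *)
pose good (X : set R) := ideal (I `|` X) /\ forall f, (I `|` X) f -> ~ S f.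
have [F Fgood Ftot|A [[Ai AS] Amax]] := @Zorn_bigcup R good.
  have dir f g : (I `|` \bigcup_(X in F) X) f -> (I `|` \bigcup_(X in F) X) g ->
      (I f /\ I g) \/ exists X, [/\ F X, (I `|` X) f & (I `|` X) g].
    case=> [If|[X FX Xf]] [Ig|[Y FY Yg]]; first by left.
    - by right; exists Y; split=> //; [left|right].
    - by right; exists X; split=> //; [right|left].
    right; case: (Ftot _ _ FX FY) => XY.
      by exists Y; split=> //; right=> //; apply: XY.
    by exists X; split=> //; right=> //; apply: XY.
  have sub X : F X -> I `|` X `<=` I `|` \bigcup_(X in F) X.
    by move=> FX f [|Xf]; [left|right; exists X].
  case: (Ii) => [[I0 ID] IM]; split; first split; first split.
  - by left.
  - move=> f g f' /(dir _ _ f') [[If Ig]|[X [FX Xf Xg]]]; first by left; apply: ID.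
    by apply: (sub X) => //; case: (Fgood _ FX) => [[[_ XD] _] _]; apply: XD.
  - move=> f g [Ig|[X FX Xg]]; first by left; apply: IM.
    apply: (sub X) => //; case: (Fgood _ FX) => [[_ XM] _].
    by apply: XM; right.
  move=> f [/IS //|[X FX Xf]]; case: (Fgood _ FX) => _; apply; by right.
exists (I `|` A); case: (Ai) => [[A0 AD] AM].
split; [|by move=> f; left|exact: AS].
split; [by []|exact: AM|by move=> A1; apply: (AS _ A1)|].
pose ext f : set R := [set h | exists a b, (I `|` A) a /\ h = a + b * f].
have extS f : ~ (I `|` A) f -> exists2 h, ext f h & S h.
  move=> nf; apply: contrapT => noS.
  have fext : ext f f by exists 0, 1; rewrite add0r mul1r.
  have Aext : I `|` A `<=` ext f.
    by move=> a Aa; exists a, 0; rewrite mul0r addr0.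
  apply: (Amax (ext f)).
    split; last by move=> /(_ f fext) Af; apply: nf; right.
    by move=> a Aa; apply: Aext; right.
  rewrite /good; have -> : I `|` ext f = ext f.
    by apply/seteqP; split=> [a [Ia|//]|a]; [apply: Aext; left|right].
  split; last by move=> h eh Sh; apply: noS; exists h.
  split; first split; first exact: Aext.
    move=> _ _ [a [b [Aa ->]]] [a' [b' [Aa' ->]]]; exists (a + a'), (b + b').
    by rewrite mulrDl addrACA; split=> //; apply: AD.
  move=> h _ [a [b [Aa ->]]]; exists (h * a), (h * b).
  by rewrite mulrDr mulrA; split=> //; apply: AM.
move=> f g Afg; apply: contrapT => /not_orP [nf ng].
have [_ [a [b [Aa ->]]] Sf] := extS _ nf.
have [_ [a' [b' [Aa' ->]]] Sg] := extS _ ng.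
apply: (AS _ _ (SM _ _ Sf Sg)); rewrite mulrDl !mulrDr -!addrA.
apply: (AD); first exact: AM.
apply: (AD); first by rewrite mulrC; apply: AM.
apply: (AD); first exact: AM.
by rewrite mulrACA; apply: AM.
Qed.

End PrimeIdeals.

Section Chains.
Variables (K : fieldType) (m : nat).
Hypothesis char0 : forall j : nat, (j.+1)%:R != 0 :> K.
Notation A := {mpoly K[m]}.
Implicit Types (t : {set 'I_m}) (f g : A).

Lemma mpoly_rmorph_ext (S : comNzRingType) (f g : {rmorphism A -> S}) :
  (forall c, f c%:MP = g c%:MP) -> (forall i, f 'X_i = g 'X_i) -> f =1 g.
Proof.
move=> fgC fgX p; rewrite [p]mpolyE !rmorph_sum; apply: eq_bigr => a _.
rewrite -mul_mpolyC !rmorphM /= fgC mpolyXE_id !rmorph_prod; congr (_ * _).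
by apply: eq_bigr => i _; rewrite !rmorphXn /= fgX.
Qed.

Definition var_proj t : m.-tuple A := [tuple if i \in t then 'X_i else 0 | i < m].

(* [f] only involves the variables in [t]. *)
Definition poly_in t f : Prop := f \mPo var_proj t = f.

Definition set_var (s : 'I_m) (k : K) : m.-tuple A :=
  [tuple if i == s then k%:MP else 'X_i | i < m].

Lemma poly_inX t i : i \in t -> poly_in t 'X_i.
Proof. by move=> it; rewrite /poly_in comp_mpolyXU -tnth_nth tnth_mktuple it. Qed.

Lemma poly_inC t c : poly_in t c%:MP.
Proof. exact: comp_mpolyC. Qed.

Lemma poly_in0 t : poly_in t 0. Proof. exact: rmorph0. Qed.

Lemma poly_in1 t : poly_in t 1. Proof. exact: rmorph1. Qed.

Lemma poly_inM t f g : poly_in t f -> poly_in t g -> poly_in t (f * g).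
Proof. by rewrite /poly_in => tf tg; rewrite rmorphM /= tf tg. Qed.

Lemma poly_inD t f g : poly_in t f -> poly_in t g -> poly_in t (f + g).
Proof. by rewrite /poly_in => tf tg; rewrite rmorphD /= tf tg. Qed.

Lemma poly_inB t f g : poly_in t f -> poly_in t g -> poly_in t (f - g).
Proof. by rewrite /poly_in => tf tg; rewrite rmorphB /= tf tg. Qed.

Lemma poly_inXn t f j : poly_in t f -> poly_in t (f ^+ j).
Proof. by rewrite /poly_in => tf; rewrite rmorphXn /= tf. Qed.

Lemma poly_in_sum t (T : Type) (r : seq T) (P : pred T) (F : T -> A) :
  (forall i, P i -> poly_in t (F i)) -> poly_in t (\sum_(i <- r | P i) F i).
Proof. by move=> tF; rewrite /poly_in rmorph_sum; apply: eq_bigr => i /tF. Qed.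

Lemma poly_in_prod t (T : Type) (r : seq T) (P : pred T) (F : T -> A) :
  (forall i, P i -> poly_in t (F i)) -> poly_in t (\prod_(i <- r | P i) F i).
Proof. by move=> tF; rewrite /poly_in rmorph_prod; apply: eq_bigr => i /tF. Qed.

Lemma poly_in_det t (d : nat) (M : 'M[A]_d) :
  (forall i j, poly_in t (M i j)) -> poly_in t (\det M).
Proof.
move=> tM; rewrite /poly_in -det_map_mx; congr (\det _).
by apply/matrixP => i j; rewrite mxE; exact: tM.
Qed.

Lemma poly_in_monomial t (a : 'X_{1..m}) :
  (forall i, i \notin t -> a i = 0%N) -> poly_in t 'X_[a].
Proof.
move=> ta; rewrite mpolyXE_id; apply: poly_in_prod => i _.
case: (boolP (i \in t)) => [it|/ta ->]; last by rewrite expr0; exact: poly_in1.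
exact/poly_inXn/poly_inX.
Qed.

Lemma poly_inP t f : poly_in t f <->
  forall a, f@_a != 0 -> forall i, i \notin t -> a i = 0%N.
Proof.
split=> [tf a fa i it|tf]; last first.
  rewrite [f]mpolyE; rewrite big_seq; apply: poly_in_sum => a.
  rewrite mcoeff_msupp => /tf ta; rewrite -mul_mpolyC.
  by apply: poly_inM; [exact: poly_inC|exact: poly_in_monomial].
apply: contra_neq_eq fa => ai; rewrite -tf [f]mpolyE rmorph_sum raddf_sum /=.
rewrite big1_seq // => b _; rewrite comp_mpolyZ comp_mpolyX mcoeffZ.
suff -> : (\prod_(j < m) tnth (var_proj t) j ^+ b j)@_a = 0 by rewrite mulr0.
have [bt|] := pselect (forall j, j \notin t -> b j = 0%N).
  have := poly_in_monomial bt; rewrite /poly_in comp_mpolyX => ->.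
  by rewrite mcoeffX; case: eqVneq => // ba; move: ai; rewrite -ba bt ?eqxx.
move=> /existsNP [j /not_implyP [jt /eqP bj]].
rewrite (bigD1 j) //= tnth_mktuple (negPf jt) expr0n (negPf bj) mul0r.
exact: mcoeff0.
Qed.

Lemma poly_in_set_var t s k f : poly_in (t :\ s)%SET f -> f \mPo set_var s k = f.
Proof.
move=> tf; rewrite -[RHS]tf -{1}tf.
apply: (mpoly_rmorph_ext (f := comp_mpoly (set_var s k) \o comp_mpoly (var_proj (t :\ s)))
  (g := comp_mpoly (var_proj (t :\ s)))) => [c|i] /=.
  by rewrite !comp_mpolyC.
rewrite comp_mpolyXU -tnth_nth tnth_mktuple; case: ifP; last by rewrite rmorph0.
rewrite finset.in_setD1 => /andP [/negPf ist _].
by rewrite comp_mpolyXU -tnth_nth tnth_mktuple ist.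
Qed.

(** As a polynomial in the variable [s], [f] has finitely many roots, while characteristic 0
    provides infinitely many constants. *)
Lemma set_var_neq0 s f : f != 0 -> exists k, f \mPo set_var s k != 0.
Proof.
move=> f0.
pose F : {rmorphism A -> {poly A}} :=
  mmap (polyC \o @mpolyC m K) (fun i => if i == s then 'X else ('X_i)%:P).
have FX i : F 'X_i = if i == s then 'X else ('X_i)%:P.
  by rewrite /F /= mmapX mmap1U.
have FC c : F c%:MP = (c%:MP)%:P by rewrite /F /= mmapC.
have evE (k : K) : (F f).[k%:MP] = f \mPo set_var s k.
  apply: (mpoly_rmorph_ext (f := horner_eval (k%:MP) \o F)) => [c|i] /=.
    by rewrite FC comp_mpolyC /horner_eval hornerC.
  rewrite FX comp_mpolyXU -tnth_nth tnth_mktuple /horner_eval.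
  by case: ifP; rewrite ?hornerX ?hornerC.
have Ff0 : F f != 0.
  apply: contraNneq f0 => Ff0; rewrite -[f]comp_mpoly_id; apply/eqP.
  transitivity (F f).['X_s]; last by rewrite Ff0 horner0.
  apply: (mpoly_rmorph_ext (g := horner_eval 'X_s \o F)) => [c|i] /=.
    by rewrite FC comp_mpolyC /horner_eval hornerC.
  rewrite FX comp_mpolyXU -tnth_nth tnth_mktuple /horner_eval.
  by case: eqVneq => [->|_]; rewrite ?hornerX ?hornerC.
apply: contrapT => /forallNP nk.
pose rs := [seq ((j%:R : K)%:MP : A) | j <- iota 0 (size (F f))].
have := @max_poly_roots _ (F f) rs Ff0; rewrite size_map size_iota ltnn.
have -> : all (root (F f)) rs.
  apply/allP => _ /mapP [j _ ->]; rewrite rootE evE.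
  by apply: contrapT => /negP; exact: nk.
rewrite map_inj_uniq ?iota_uniq => [/(_ isT isT) //|i j /eqP].
rewrite mpolyC_eq.
wlog ij : i j / (i <= j)%N => [hw|].
  by case/orP: (leq_total i j) => ij; [|rewrite eq_sym => /(hw _ _ ij) ->//]; apply: hw.
rewrite eq_sym -subr_eq0 -natrB //; case E: (j - i)%N => [|d].
  by move=> _; apply/eqP; rewrite eqn_leq ij -subn_eq0 E.
by rewrite (negPf (char0 d)).
Qed.

(** Take a relation with a nonzero coefficient whose degree bound in X_i is minimal. Its leading
    coefficient is nonzero by minimality, and its degree is positive because [P] meets K[t] in 0. *)
Lemma algebraic_var (P : set A) t i : prime_ideal P -> i \notin t ->
  (forall f, P f -> poly_in t f -> f = 0) ->
  (exists f, [/\ P f, poly_in (i |: t)%SET f & f <> 0]) ->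
  exists c d (e : nat -> A), [/\ c != 0, poly_in t c, forall j, poly_in t (e j) &
    P (c * 'X_i ^+ d.+1 - \sum_(j < d.+1) e j * 'X_i ^+ j)].
Proof.
move=> Pp it Pt [f [Pf tf f0]].
pose C j := \sum_(a <- msupp f | a i == j) f@_a *: 'X_[a - U_(i) *+ j].
have tC j : poly_in t (C j).
  rewrite /C big_seq_cond; apply: poly_in_sum => a /andP [af /eqP aj].
  rewrite -mul_mpolyC; apply: poly_inM; first exact: poly_inC.
  apply: poly_in_monomial => k kt; rewrite mnmBE mulmnE mnm1E.
  case: eqVneq => [<-|ik]; first by rewrite aj mul1n subnn.
  move/poly_inP: tf => -> //; first by rewrite -mcoeff_msupp.
  by rewrite finset.in_setU1 negb_or eq_sym ik kt.
have fE d : (forall a, a \in msupp f -> (a i <= d)%N) ->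
    f = \sum_(j < d.+1) C j * 'X_i ^+ j.
  move=> fd; rewrite {1}[f]mpolyE.
  under [RHS]eq_bigr => j _ do rewrite mulr_suml.
  rewrite (exchange_big_dep xpredT) //= big_seq [RHS]big_seq; apply: eq_bigr => a /fd ad.
  have ltd : (a i < d.+1)%N by [].
  rewrite (big_pred1 (Ordinal ltd)) => [|j]; last by rewrite eq_sym.
  rewrite /= -scalerAl mpolyXn -mpolyXD submK //.
  apply/mnm_lepP => k; rewrite mulmnE mnm1E; case: eqVneq => [<-|_].
    by rewrite mul1n.
  by rewrite mul0n.
pose Q d := exists e : nat -> A, [/\ forall j, poly_in t (e j),
  P (\sum_(j < d.+1) e j * 'X_i ^+ j) & exists2 j, (j <= d)%N & e j <> 0].
have exQ : exists d, `[< Q d >].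
  exists (msize f); apply/asboolP; exists C; split=> //.
    by rewrite -fE // => a /msize_mdeg_lt /ltnW; apply: leq_trans; rewrite mdegE (bigD1 i) //= leq_addr.
  apply: contrapT => C0; apply: f0; rewrite (fE (msize f)) => [|a]; last first.
    by move/msize_mdeg_lt/ltnW; apply: leq_trans; rewrite mdegE (bigD1 i) //= leq_addr.
  apply: big1 => j _; suff -> : C j = 0 by rewrite mul0r.
  by apply: contrapT => Cj; apply: C0; exists j => //; rewrite -ltnS.
case: (ex_minnP exQ) => -[|d] /asboolP [e [te Pe [j jd ej]]] dmin.
  case: ej; move: jd Pe; rewrite leqn0 => /eqP ->.
  by rewrite big_ord1 expr0 mulr1 => /Pt; apply; exact: te.
exists (e d.+1), d, (fun j => - e j); split=> //; first last.
- move: Pe; rewrite big_ord_recr /= addrC -sumrN.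
  by under eq_bigr => k _ do rewrite -[X in X * _]opprK mulNr.
- by move=> k; rewrite -[- _]sub0r; apply: poly_inB => //; exact: poly_in0.
apply/eqP => ed; suff /dmin : `[< Q d >] by rewrite ltnn.
apply/asboolP; exists e; split=> //; first by move: Pe; rewrite big_ord_recr /= ed mul0r addr0.
by exists j => //; move: jd; rewrite leq_eqVlt ltnS => /orP [/eqP jd|//]; case: ej; rewrite jd.
Qed.

End Chains.

Section PrimeChain.
Variables (K : fieldType) (m : nat).
Hypothesis char0 : forall j : nat, (j.+1)%:R != 0 :> K.
Notation A := {mpoly K[m]}.

Lemma poly_in_sub (t t' : {set 'I_m}) (f : A) : t \subset t' -> poly_in t f -> poly_in t' f.
Proof.
move=> /fintype.subsetP tt /poly_inP tf; apply/poly_inP => a /tf ta i it.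
by apply: ta; apply: contra it; exact: tt.
Qed.

(* Each variable is algebraic over [K[t]] modulo [P]; [c] is the product of the
   leading coefficients of the equations, and the [x b] are the monomials whose
   exponents are below their degrees. *)
Lemma finite_over_vars (P : set A) (t : {set 'I_m}) : prime_ideal P ->
  (forall f, P f -> poly_in t f -> f = 0) ->
  (forall i, i \notin t -> exists f, [/\ P f, poly_in (i |: t)%SET f & f <> 0]) ->
  exists (c : A) (B : finType) (x : B -> A) (b0 : B),
    [/\ c != 0, poly_in t c, x b0 = 1 &
      forall b, exists N, forall j, exists l : B -> A, (forall k, poly_in t (l k)) /\
        P (c ^+ N * b * x j - \sum_k l k * x k)].
Proof.
move=> Pp Pt Palg; have Pi := ideal_prime Pp; have [[P0 PD] PM] := Pi.
have /choice [c_ /choice [d_ /choice [e_ rel]]] : forall i, exists c d (e : nat -> A),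
    [/\ c != 0, poly_in t c, forall j, poly_in t (e j) &
    P (c * 'X_i ^+ d.+1 - \sum_(j < d.+1) e j * 'X_i ^+ j)].
  move=> i; case: (boolP (i \in t)) => it; last exact: (algebraic_var Pp it Pt (Palg _ it)).
  exists 1, 0%N, (fun=> 'X_i); split; [exact: oner_neq0|exact: poly_in1| |].
    by move=> j; exact: poly_inX.
  by rewrite big_ord1 expr0 expr1 mulr1 mul1r subrr.
pose D := \max_i d_ i; pose B := {ffun 'I_m -> 'I_D.+1}.
pose xm (al : 'I_m -> nat) : A := \prod_i 'X_i ^+ al i.
pose x (al : B) : A := xm (fun i => al i).
pose L f := exists l : B -> A, (forall k, poly_in t (l k)) /\ P (f - \sum_k l k * x k).
have LP f : P f -> L f.
  move=> Pf; exists (fun=> 0); split=> [k|]; first exact: poly_in0.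
  by rewrite big1 ?subr0 // => k _; rewrite mul0r.
have LD f g : L f -> L g -> L (f + g).
  move=> [l [tl Pl]] [l' [tl' Pl']]; exists (fun k => l k + l' k).
  split=> [k|]; first exact: poly_inD.
  have -> : f + g - \sum_k (l k + l' k) * x k =
      (f - \sum_k l k * x k) + (g - \sum_k l' k * x k).
    by under eq_bigr => k _ do rewrite mulrDl; rewrite big_split opprD addrACA.
  exact: PD.
have LM a f : poly_in t a -> L f -> L (a * f).
  move=> ta [l [tl Pl]]; exists (fun k => a * l k); split=> [k|]; first exact: poly_inM.
  have -> : a * f - \sum_k a * l k * x k = a * (f - \sum_k l k * x k).
    by rewrite mulrBr mulr_sumr; under eq_bigr => k _ do rewrite -mulrA.
  exact: PM.
have Lsum (T : finType) (F : T -> A) : (forall k, L (F k)) -> L (\sum_k F k).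
  by move=> LF; apply: big_ind => //; exact: LP.
have LE f g : P (f - g) -> L g -> L f.
  by move=> Pfg Lg; rewrite -[f](subrK g); apply: (LD) => //; apply: (LP).
have Lx al : L (x al).
  exists (fun k => (k == al)%:R); split=> [k|]; first by rewrite -[_%:R]mpolyC_nat; exact: poly_inC.
  rewrite (bigD1 al) //= eqxx mul1r big1 ?addr0 ?subrr // => k /negPf ->.
  by rewrite mul0r.
have Lxm (al : 'I_m -> nat) : (forall i, al i <= D)%N -> L (xm al).
  move=> alD; have -> : xm al = x [ffun i => inord (al i)]; last exact: Lx.
  by apply: eq_bigr => i _; rewrite ffunE inordK // ltnS.
pose c := \prod_i c_ i.
have tc : poly_in t c by apply: poly_in_prod => i _; have [] := rel i.
have c0 : c != 0 by apply/prodf_neq0 => i _; have [] := rel i.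
have xmS (al : 'I_m -> nat) i (al' : 'I_m -> nat) e e' :
    (forall j, j != i -> al j = al' j) ->
    al i = (al' i + e)%N -> 'X_i ^+ e' * xm al = 'X_i ^+ (e' + e) * xm al'.
  move=> E Ei; rewrite /xm [in LHS](bigD1 i) // [in RHS](bigD1 i) //= Ei.
  rewrite [in LHS](eq_bigr (fun j => 'X_j ^+ al' j)) => [|j /E -> //].
  by rewrite !mulrA -!exprD -addnA [(e + _)%N]addnC.
(* If the exponent of X_i is already [D], the equation of X_i, multiplied by a power of X_i, lowers
   it; the factor [c] supplies its leading coefficient. *)
have LcX i al : L (c * 'X_i * x al).
  pose al0 j := if j == i then 0%N else al j : nat.
  have E e : xm (fun j => if j == i then e else al j : nat) = 'X_i ^+ e * xm al0.
    rewrite -[LHS]mul1r -['X_i ^+ e]/('X_i ^+ (0 + e)) -(expr0 'X_i); apply: xmS.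
      by move=> j ji; rewrite /al0 (negPf ji).
    by rewrite /al0 eqxx.
  have alE : x al = 'X_i ^+ al i * xm al0.
    rewrite -E; apply: eq_bigr => j _; case: eqVneq => [->|] //.
  have alD j : (al j <= D)%N by rewrite -ltnS ltn_ord.
  rewrite alE mulrA -[c * 'X_i * _]mulrA -exprS -mulrA.
  have [alDi|] := ltnP (al i) D.
    apply: (LM) => //; rewrite -E; apply: Lxm => j.
    by case: ifP => _; rewrite ?alDi ?alD.
  move=> Dal; have -> : al i = D :> nat by apply/eqP; rewrite eqn_leq alD Dal.
  have di : (d_ i <= D)%N by rewrite /D (bigD1 i) //= leq_maxl.
  have [_ _ te Pe] := rel i.
  rewrite /c (bigD1 i) //= -/c [c_ i * _]mulrC -mulrA.
  apply: (LM); first by apply: poly_in_prod => j _; have [] := rel j.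
  rewrite mulrA; pose S := \sum_(j < (d_ i).+1) e_ i j * 'X_i ^+ (j + (D - d_ i)).
  apply: (LE _ (S * xm al0)).
    have -> : c_ i * 'X_i ^+ D.+1 * xm al0 - S * xm al0 = ('X_i ^+ (D - d_ i) * xm al0) *
       (c_ i * 'X_i ^+ (d_ i).+1 - \sum_(j < (d_ i).+1) e_ i j * 'X_i ^+ j); last exact: PM.
    rewrite -mulrBl [RHS]mulrAC; congr (_ * _); rewrite mulrBr; congr (_ - _).
      by rewrite mulrCA -exprD addnS subnK.
    by rewrite mulr_sumr; apply: eq_bigr => j _; rewrite mulrCA -exprD addnC.
  rewrite mulr_suml; apply: (Lsum _ (fun j => _)) => j; rewrite -mulrA; apply: (LM) => //.
  rewrite -E; apply: Lxm => k; case: ifP => // _.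
  by rewrite -[X in (_ <= X)%N](subnKC di) leq_add2r -ltnS ltn_ord.
have LcXL i f : L f -> L (c * 'X_i * f).
  move=> [l [tl Pl]]; apply: (LE _ (c * 'X_i * \sum_k l k * x k)).
    by rewrite -mulrBr; apply: (PM).
  rewrite mulr_sumr; apply: (Lsum _ (fun j => _)) => j; rewrite mulrCA; exact: LM.
(* All large exponents are required, so that a sum of good elements is good. *)
pose good b := exists N, forall N', (N <= N')%N -> forall f, L f -> L (c ^+ N' * b * f).
have goodM b i : good b -> good (b * 'X_i).
  move=> [N gb]; exists N.+1 => -[|N'] // NN f /(LcXL i)/(gb N' NN).
  by rewrite exprSr; congr L; rewrite -!mulrA; congr (_ * _); rewrite mulrCA.
have good_mon (a : 'X_{1..m}) : good 'X_[a].
  have [k] := ubnP (mdeg a); elim: k a => // k IH a ak.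
  case: (eqVneq a 0%MM) => [->|].
    exists 0%N => N' _ f Lf; rewrite mpolyX0 mulr1; apply: (LM) => //; exact: poly_inXn.
  rewrite -mdeg_eq0 mdegE sum_nat_eq0 negb_forall => /existsP [i ai].
  have ai0 : (0 < a i)%N by rewrite lt0n.
  rewrite -(mnm_subK1 ai0) mpolyXD; apply: (goodM); apply: IH.
  by rewrite -ltnS -(mdegDU _ i) mnm_subK1.
have good_all b : good b.
  elim/mpolyind: b => [|k a b _ _ [N gb]].
    by exists 0%N => N' _ f _; rewrite mulr0 mul0r; exact: LP.
  have [N1 ga] := good_mon a; exists (maxn N N1) => N'; rewrite geq_max => /andP [NN NN1] f Lf.
  rewrite mulrDr mulrDl -mul_mpolyC mulrCA; apply: (LD); last exact: (gb _ NN _ Lf).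
  rewrite -mulrA.
  by apply: (LM); [exact: poly_inC|exact: (ga _ NN1 _ Lf)].
exists c, B, x, [ffun=> ord0]; split=> //.
  by rewrite /x /xm big1 // => i _; rewrite ffunE expr0.
by move=> b; have [N gb] := good_all b; exists N => j; apply: (gb N).
Qed.

(* If [s - k] divided an element [h] of [K[t \ s]] modulo [P], with quotient [b],
   then the characteristic polynomial of [c^N b] would give an element of
   [P] in [K[t]] that becomes a nonzero power of [c^N h] for [s = k]. *)
Lemma prime_step (P : set A) (t : {set 'I_m}) s : prime_ideal P -> s \in t ->
  (forall f, P f -> poly_in t f -> f = 0) ->
  exists Q, [/\ prime_ideal Q, P `<` Q &
    forall f, Q f -> poly_in (t :\ s)%SET f -> f = 0].
Proof.
move=> Pp st Pt; have Pi := ideal_prime Pp; have [[P0 PD] PM] := Pi.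
pose fr (u : {set 'I_m}) := `[< forall f, P f -> poly_in u f -> f = 0 >].
have [u /finset.maxsetP [/asboolP Pu umax] tu] : {u | maxset fr u & t \subset u}.
  by apply: finset.maxset_exists; apply/asboolP.
have su : s \in u by move/fintype.subsetP: tu; apply.
have ualg i : i \notin u -> exists f, [/\ P f, poly_in (i |: u)%SET f & f <> 0].
  move=> iu; apply: contrapT => /forallNP none.
  have /umax : fr (i |: u)%SET.
    apply/asboolP => f Pf uf; apply: contrapT => f0; exact: (none f).
  by move=> /(_ (finset.subsetU1 _ _)) e; move: iu; rewrite -e finset.setU11.
have [c [B [x [b0 [c0 uc x1 fin]]]]] := finite_over_vars Pp Pu ualg.
have [k ck] := set_var_neq0 char0 s c0.
pose y : A := 'X_s - k%:MP.
have uy : poly_in t y by apply: poly_inB; [exact: poly_inX|exact: poly_inC].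
have ky : y \mPo set_var s k = 0.
  by rewrite rmorphB /= comp_mpolyC comp_mpolyXU -tnth_nth tnth_mktuple eqxx subrr.
have y0 : y <> 0.
  move=> /(congr1 (mcoeff U_(s))) /eqP; rewrite mcoeffB mcoeffX eqxx mcoeffC.
  by rewrite mnm1_eq0 mulr0 subr0 mcoeff0 oner_eq0.
have key h b : P (h - y * b) -> poly_in (t :\ s)%SET h -> h = 0.
  move=> Ph th; have [N /choice [M MP]] := fin b.
  pose d := #|B|; pose M' := \matrix_(i < d, j < d)
     ((i == j)%:R * (c ^+ N * h) - y * M (enum_val i) (enum_val j)).
  have tuh : poly_in u h.
    by apply: poly_in_sub th; apply: fintype.subset_trans (finset.subD1set _ _) tu.
  have uM' : poly_in u (\det M').
    apply: poly_in_det => i j; rewrite mxE; apply: poly_inB; last first.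
      by apply: poly_inM; [exact: poly_in_sub uy|exact: (MP _).1].
    apply: poly_inM; first by rewrite -[_%:R]mpolyC_nat; exact: poly_inC.
    by apply: poly_inM => //; exact: poly_inXn.
  have PM' (i : 'I_d) : P (\sum_j M' i j * x (enum_val j)).
    have -> : \sum_j M' i j * x (enum_val j) = c ^+ N * x (enum_val i) * (h - y * b) +
        y * (c ^+ N * b * x (enum_val i) - \sum_k M (enum_val i) k * x k).
      under eq_bigr => j _ do rewrite mxE mulrBl.
      rewrite big_split sumrN /= (bigD1 i) //= eqxx mul1r big1 => [|j]; last first.
        by rewrite eq_sym => /negPf ->; rewrite !mul0r.
      rewrite addr0 [in RHS](reindex (@enum_val B B)) /=; last exact/onW_bij/enum_val_bij.
      under eq_bigr => j _ do rewrite -mulrA.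
      by rewrite -mulr_sumr; ring.
    by apply: (PD); apply: (PM) => //; exact: (MP _).2.
  (* Modulo [P], the matrix [M'] kills the vector of the x_j. Multiplying by the adjugate and
     reading the coordinate of [x b0 = 1] puts the determinant in [P]. *)
  have /Pu/(_ uM') det0 : P (\det M').
    rewrite -[\det M']mulr1 -x1 -(enum_rankK b0).
    have /matrixP/(_ (enum_rank b0) 0) := congr1
      (fun T => T *m \col_j x (enum_val j)) (mul_adj_mx M').
    rewrite -mulmxA mul_scalar_mx [in RHS]mxE [in RHS]mxE => <-.
    rewrite mxE; apply: ideal_sum => // i _; rewrite [X in _ * X]mxE; apply: (PM).
    by under eq_bigr => j _ do rewrite [X in _ * X]mxE; exact: PM'.
  have : \det (map_mx (comp_mpoly (set_var s k)) M') = 0.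
    by rewrite det_map_mx det0 rmorph0.
  have -> : map_mx (comp_mpoly (set_var s k)) M' = (((c \mPo set_var s k) ^+ N * h)%:M).
    apply/matrixP => i j; rewrite !mxE rmorphB /= !rmorphM /= rmorphXn /= ky mul0r subr0.
    by rewrite (poly_in_set_var _ th) rmorph_nat mulr_natl.
  move/eqP; rewrite det_scalar expf_eq0 mulf_eq0 expf_eq0 (negPf ck) andbF /=.
  by case/andP => _ /eqP.
pose I : set A := [set f | exists a b, P a /\ f = a + y * b].
have Ii : ideal I.
  split; first split.
  - by exists 0, 0; rewrite mulr0 addr0.
  - move=> _ _ [a [b [Pa ->]]] [a' [b' [Pa' ->]]]; exists (a + a'), (b + b').
    by rewrite mulrDr addrACA; split=> //; apply: (PD).
  - move=> f _ [a [b [Pa ->]]]; exists (f * a), (f * b).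
    by rewrite mulrDr mulrCA; split=> //; apply: (PM).
pose S : set A := [set f | poly_in (t :\ s)%SET f /\ f <> 0].
have [||f [a [b [Pa ->]]] [tf f0]|Q [Qp IQ QS]] := @prime_avoiding _ I S Ii.
- by split; [exact: poly_in1|apply/eqP; exact: oner_neq0].
- move=> f g [tf /eqP f0] [tg /eqP g0]; split; first exact: poly_inM.
  by apply/eqP; rewrite mulf_neq0.
- by apply: f0; apply: (key _ b) tf; rewrite addrK.
exists Q; split=> //; last first.
  by move=> f Qf tf; apply: contrapT => f0; apply: (QS f).
split; first by move=> a Pa; apply: IQ; exists a, 0; rewrite mulr0 addr0.
move=> /(_ y) QP; apply: y0; apply: Pt => //; apply: QP; apply: IQ.
by exists 0, 1; rewrite add0r mulr1.
Qed.

(** Each [prime_step] enlarges the prime strictly at the price of one independent variable, so the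
    chain can be continued #|t| times. *)
Lemma prime_chain (I : set A) (t : {set 'I_m}) : ideal I ->
  (forall f, I f -> poly_in t f -> f = 0) ->
  exists P : nat -> set A, forall i, (i <= #|t|)%N ->
    [/\ prime_ideal (P i), I `<=` P i & forall j, (j < i)%N -> P j `<` P i].
Proof.
move=> Ii It.
have [||f If [tf f0]|P [Pp IP PS]] :=
    @prime_avoiding _ I [set f | poly_in t f /\ f <> 0] Ii.
- by split; [exact: poly_in1|apply/eqP; exact: oner_neq0].
- move=> f g [tf /eqP f0] [tg /eqP g0]; split; first exact: poly_inM.
  by apply/eqP; rewrite mulf_neq0.
- by apply: f0; apply: It.
have Pt f : P f -> poly_in t f -> f = 0.
  by move=> Pf tf; apply: contrapT => f0; apply: (PS f).
suff [F [F0 [Fp FS]]] : exists F : nat -> set A, F 0%N = P /\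
    (forall i, (i <= #|t|)%N -> prime_ideal (F i)) /\
    forall i, (i < #|t|)%N -> F i `<` F i.+1.
  have Flt i j : (i < j <= #|t|)%N -> F i `<` F j.
    elim: j => // j IHj /andP [ij jt]; move: ij; rewrite ltnS leq_eqVlt.
    case/orP => [/eqP -> |ij]; first exact: FS.
    have [Fij _] := IHj (introT andP (conj ij (ltnW jt))).
    have [FjS nFjS] := FS _ jt; split=> [f /Fij /FjS //|FSi].
    by apply: nFjS => f /FSi; exact: Fij.
  exists F => i it; split=> [|f If|j ji]; first exact: Fp.
    case: i it => [_|i it]; first by rewrite F0; exact: IP.
    by have [+ _] := Flt 0%N i.+1 it; apply; rewrite F0; exact: IP.
  by apply: Flt; rewrite ji.
elim: {t}#|t| {-2}t (erefl #|t|) P Pp Pt {IP It PS} => [|d IH] t td P Pp Pt.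
  by exists (fun=> P); rewrite td; split.
have [s st] : exists s, s \in t by apply/finset.set0Pn; rewrite -finset.card_gt0 td.
have [Q [Qp PQ Qt]] := prime_step Pp st Pt.
have td' : #|(t :\ s)%SET| = d by apply/eqP; rewrite -eqSS -td (finset.cardsD1 s t) st.
have [F [F0 [Fp FS]]] := IH _ td' _ Qp Qt; rewrite td' in Fp FS; rewrite td.
exists (fun i => if i is i'.+1 then F i' else P); split=> //.
by split=> -[|i] //; [exact: Fp|rewrite F0|exact: FS].
Qed.

End PrimeChain.

(** * Growth of holonomic modules *)

Lemma mcoeff_lincomb (R : nzRingType) (m : nat) (I : finType) (a : I -> 'X_{1..m})
    (c : I -> R) i : injective a -> (\sum_i c i *: 'X_[a i])@_(a i) = c i.
Proof.
move=> a_inj; rewrite raddf_sum (bigD1 i) //= mcoeffZ mcoeffX eqxx mulr1 big1 ?addr0 // => i' i'i.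
by rewrite mcoeffZ mcoeffX (inj_eq a_inj) (negPf i'i) mulr0.
Qed.

(** * Polynomials acting on a vector space *)

Section LinearExtension.
Variables (K : fieldType) (V : lmodType K) (m : nat).
Implicit Types (phi : 'X_{1..m} -> V) (f g : {mpoly K[m]}).

(** [polyop], and with it [center_act], unfolds to [lext] of monomial operators, so that the facts
    below apply to the definitions of the statement. *)
Definition lext phi f : V := \sum_(a <- msupp f) f@_a *: phi a.

Lemma lextE phi f k : (msize f <= k)%N ->
  lext phi f = \sum_(a : 'X_{1..m < k}) f@_a *: phi a.
Proof.
move=> fk; pose I : subFinType _ := 'X_{1..m < k}.
rewrite /lext (big_mksub I) ?msupp_uniq //=; first last.
  by move=> a /msize_mdeg_lt /leq_trans; apply.
by rewrite big_rmcond //= => a /memN_msupp_eq0 ->; rewrite scale0r.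
Qed.

Lemma lext_linear phi : linear (lext phi).
Proof.
move=> c f g; pose k := maxn (msize (c *: f + g)) (maxn (msize f) (msize g)).
rewrite !(@lextE _ _ k) ?leq_max ?leqnn ?orbT // scaler_sumr -big_split.
by apply: eq_bigr => a _; rewrite linearP /= scalerDl scalerA.
Qed.

HB.instance Definition _ phi :=
  GRing.isLinear.Build K {mpoly K[m]} V _ (lext phi) (lext_linear phi).

Lemma lextX phi a : lext phi 'X_[a] = phi a.
Proof. by rewrite /lext msuppX big_seq1 mcoeffX eqxx scale1r. Qed.

Lemma lext_mulX phi b f : lext phi ('X_[b] * f) = lext (fun a => phi (b + a)%MM) f.
Proof.
rewrite {1}[f]mpolyE mulr_sumr linear_sum; apply: eq_bigr => a _.
by rewrite -scalerAr linearZ /= -mpolyXD lextX.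
Qed.

Lemma eq_lext phi psi f : {in msupp f, phi =1 psi} -> lext phi f = lext psi f.
Proof. by move=> E; rewrite /lext !big_seq; apply: eq_bigr => a /E ->. Qed.

Lemma lext_lspan phi f (B : set V) :
  {in msupp f, forall a, B (phi a)} -> lspan setT B (lext phi f).
Proof.
move=> Bphi; rewrite /lext big_seq; apply: lspan_sum => // a /Bphi Ba.
by apply: lspanZ => //; exact: lspan1.
Qed.

Lemma lext_subspace phi f (B : set V) : subspace B ->
  {in msupp f, forall a, B (phi a)} -> B (lext phi f).
Proof.
move=> sB Bphi; rewrite /lext big_seq; apply: subspace_sum => // a /Bphi Ba.
exact: subspaceZ.
Qed.

End LinearExtension.

Section PolynomialAction.
Variables (K : fieldType) (V : lmodType K) (m : nat) (phi : 'X_{1..m} -> V -> V).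
Hypothesis phi_lin : forall a, linear (phi a).
Hypothesis phi0 : forall u, phi 0%MM u = u.
Hypothesis phiD : forall a b u, phi (a + b)%MM u = phi a (phi b u).

Definition pact (f : {mpoly K[m]}) (u : V) : V := lext (fun a => phi a u) f.

Lemma pact_linear f : linear (pact f).
Proof.
move=> c u v; rewrite /pact /lext scaler_sumr -big_split; apply: eq_bigr => a _.
by rewrite phi_lin scalerDr !scalerA mulrC.
Qed.

Lemma pactDl f g u : pact (f + g) u = pact f u + pact g u.
Proof. exact: linearD. Qed.

Lemma pactBl f g u : pact (f - g) u = pact f u - pact g u.
Proof. exact: linearB. Qed.

Lemma pactZl c f u : pact (c *: f) u = c *: pact f u.
Proof. exact: linearZ. Qed.

Lemma pact_suml (I : Type) (r : seq I) (P : pred I) (F : I -> {mpoly K[m]}) u :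
  pact (\sum_(i <- r | P i) F i) u = \sum_(i <- r | P i) pact (F i) u.
Proof. exact: linear_sum. Qed.

Lemma pact0l u : pact 0 u = 0.
Proof. exact: linear0. Qed.

Lemma pactX a u : pact 'X_[a] u = phi a u.
Proof. exact: lextX. Qed.

Lemma pact1 u : pact 1 u = u.
Proof. by rewrite -mpolyX0 pactX phi0. Qed.

Lemma pactC c u : pact c%:MP u = c *: u.
Proof. by rewrite -[c%:MP]mulr1 mul_mpolyC pactZl pact1. Qed.

HB.instance Definition _ f := GRing.isLinear.Build K V V _ (pact f) (pact_linear f).

Lemma pactM f g u : pact (f * g) u = pact f (pact g u).
Proof.
pose ha a := GRing.isLinear.Build K V V _ (phi a) (phi_lin a).
pose la a : {linear V -> V} := HB.pack (phi a) (ha a).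
rewrite {1}[f]mpolyE mulr_suml pact_suml [RHS]/pact /lext; apply: eq_bigr => a _.
rewrite -scalerAl pactZl /pact lext_mulX; congr (_ *: _).
rewrite /lext -[RHS]/(la a _) linear_sum; apply: eq_bigr => b _.
by rewrite linearZ /= phiD.
Qed.

Lemma pactAC f g u : pact f (pact g u) = pact g (pact f u).
Proof. by rewrite -!pactM mulrC. Qed.

Lemma pact0r f : pact f 0 = 0.
Proof. exact: linear0. Qed.

Lemma pactDr f u v : pact f (u + v) = pact f u + pact f v.
Proof. exact: linearD. Qed.

Lemma pact_comm f (h : {linear V -> V}) u :
  (forall a v, h (phi a v) = phi a (h v)) -> h (pact f u) = pact f (h u).
Proof.
move=> hphi; rewrite /pact /lext linear_sum; apply: eq_bigr => a _.
by rewrite linearZ /= hphi.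
Qed.

End PolynomialAction.

Section OrderSymbols.
Variables (K : fieldType) (n : nat) (N : weyl_module K n) (F : int -> set N).
Hypothesis Fsub : forall i, subspace (F i).
Hypothesis Fmono : forall i, F i `<=` F (i + 1).
Hypothesis Fmon : forall a i u, F i u -> F (i + (order_weight a)%:Z) (monop 1 a u).

Definition opart (d : nat) (u : N) (a : 'X_{1..n + n}) : N :=
  if order_weight a == d then monop 1 a u else 0.

Lemma gr_killsE i u f : gr_kills F i u f <->
  forall d : nat, F (i + d%:Z - 1) (lext (opart d u) f).
Proof.
have E d : \sum_(a <- msupp f | order_weight a == d) f@_a *: monop 1 a u =
    lext (opart d u) f.
  rewrite big_mkcond; apply: eq_bigr => a _.
  by rewrite /opart; case: ifP => _ //; rewrite scaler0.
by split=> H d; have := H d; rewrite E.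
Qed.

Lemma Fmono_le (i j : int) : i <= j -> F i `<=` F j.
Proof.
move=> ij; rewrite -(subrK i j); have : 0 <= j - i by rewrite subr_ge0.
case: (j - i) => // d _; rewrite addrC; elim: d => [|d IH] u Fu; first by rewrite addr0.
by rewrite -addn1 PoszD addrA; apply/Fmono/IH.
Qed.

(** The point is stability under the symbol of d_k. The part of order d + 1 of its product with [f]
    acts as d_k after the part of order d of [f], up to commutator terms; these have order at most
    d, hence lie in F (i + d) already. *)
Lemma ideal_gr_kills i u : F i u -> ideal (gr_kills F i u).
Proof.
move=> Fu; split; first split.
- by apply/gr_killsE => d; rewrite linear0; case: (Fsub (i + d%:Z - 1)).
- move=> f g /gr_killsE Kf /gr_killsE Kg; apply/gr_killsE => d.
  by rewrite linearD; apply: subspaceD.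
pose I := gr_kills F i u.
have ID f g : I f -> I g -> I (f + g).
  move=> /gr_killsE Kf /gr_killsE Kg; apply/gr_killsE => d.
  by rewrite linearD; apply: subspaceD.
have IZ c f : I f -> I (c *: f).
  by move=> /gr_killsE Kf; apply/gr_killsE => d; rewrite linearZ; apply: subspaceZ.
have IX j f : I f -> I ('X_j * f).
  move=> /gr_killsE Kf; apply/gr_killsE => d; rewrite lext_mulX.
  case: (split_ordP j) => k ->.
    rewrite (@eq_lext _ _ _ _ (fun a => wx N k (opart d u a))) => [|a _]; last first.
      rewrite /opart order_weightD order_weight_x add0n addmC.
      by case: ifP; rewrite ?linear0 ?mon_x.
    have -> : lext (fun a => wx N k (opart d u a)) f = wx N k (lext (opart d u) f).
      by rewrite /lext linear_sum; apply: eq_bigr => a _; rewrite linearZ.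
    have := Fmon U_(lshift n k)%MM (Kf d).
    by rewrite order_weight_x addr0 -[U_(_)%MM]add0m -mon_x monop0.
  case: d => [|d].
    rewrite (@eq_lext _ _ _ _ (fun=> 0)) => [|a _]; last first.
      by rewrite /opart order_weightD order_weight_d.
    by rewrite /lext big1 => [|a _]; rewrite ?scaler0; case: (Fsub (i + 0 - 1)).
  pose low a := if order_weight a == d then
    (a (lshift n k))%:R *: monop 1 (a - U_(lshift n k))%MM u else 0.
  have -> : lext (fun a => opart d.+1 u (U_(rshift n k) + a)) f =
      wd N k (lext (opart d u) f) - lext low f.
    rewrite /lext linear_sum -sumrB; apply: eq_bigr => a _; rewrite linearZ -scalerBr /=.
    congr (_ *: _); rewrite /opart /low order_weightD order_weight_d add1n eqSS addmC.
    by case: ifP => _; [rewrite mon_d addrK|rewrite linear0 subr0].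
  apply: subspaceB => //.
    have := Fmon U_(rshift n k)%MM (Kf d); rewrite order_weight_d -[U_(_)%MM]add0m.
    have -> : (i + d.+1 - 1 = i + d - 1 + 1)%R by lia.
    have := mon_d k 0%MM (lext (opart d u) f).
    by rewrite monop0 mnm0E scale0r addr0 => ->.
  apply: lext_subspace => // a _; rewrite /low; case: ifP => [/eqP ad|_]; last first.
    by case: (Fsub (i + d.+1 - 1)).
  apply: subspaceZ => //; have := Fmon (a - U_(lshift n k))%MM Fu.
  apply: Fmono_le; suff : (order_weight (a - U_(lshift n k)) <= d)%N by lia.
  by rewrite -ad; apply: leq_sum => l _; rewrite mnmBE leq_subr.
have IXa a f : I f -> I ('X_[a] * f).
  have [k] := ubnP (mdeg a); elim: k a f => // k IH a f ak If.
  case: (eqVneq a 0%MM) => [->|]; first by rewrite mpolyX0 mul1r.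
  rewrite -mdeg_eq0 mdegE sum_nat_eq0 negb_forall => /existsP [j aj].
  have aj0 : (0 < a j)%N by rewrite lt0n.
  rewrite -(mnm_subK1 aj0) mpolyXD -mulrA; apply: IH; last exact: IX.
  by rewrite -ltnS -(mdegDU _ j) mnm_subK1.
move=> f g Ig; rewrite [f]mpolyE mulr_suml; apply: big_ind => //.
- by apply/gr_killsE => d; rewrite linear0; case: (Fsub (i + d%:Z - 1)).
- by move=> a _; rewrite -scalerAl; apply/IZ/IXa.
Qed.

End OrderSymbols.

Section HolonomicGrowth.
Variables (K : fieldType) (n : nat) (N : weyl_module K n).
Hypothesis char0 : forall j : nat, (j.+1)%:R != 0 :> K.

Lemma lspan_bound (V : lmodType K) (T : Type) (Q : T -> Prop) (v : T -> V)
    (wt : T -> nat) O x : lspan O [set u | exists2 t, Q t & u = v t] x ->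
  exists W, lspan O [set u | exists2 t, Q t /\ (wt t <= W)%N & u = v t] x.
Proof.
elim=> [|c u y Oc [t Qt ->] _ [W IH]]; first by exists 0%N; exact: LSpan0.
exists (maxn W (wt t)); apply: LSpanS => //.
  by exists t => //; split=> //; exact: leq_maxr.
by apply: lspan_mono IH => z [s [Qs ws] ->]; exists s => //; split=> //; rewrite leq_max ws.
Qed.

(** Generators of the graded module are lifted degree by degree; this ends because the filtration is
    bounded below. *)
Lemma filtration_span (w : 'X_{1..n + n} -> nat) (F : int -> set N) r
    (g : 'I_r -> N) (d : 'I_r -> int) (i0 : int) :
  (forall i, i <= i0 -> F i = [set 0]) ->
  (forall i u, F i u -> exists c : 'I_r -> {mpoly K[n + n]},
     (forall j a, a \in msupp (c j) -> d j + (w a)%:Z = i) /\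
     F (i - 1) (u - \sum_j polyop 1 (c j) (g j))) ->
  forall i u, F i u ->
    lspan setT [set x | exists2 t, d t.2 + (w t.1)%:Z <= i & x = mong g t] u.
Proof.
move=> F0 Fg i u Fu.
have [k] : exists k : nat, i <= i0 + k%:Z.
  by exists `|i - i0|%N; rewrite -lerBlDl; exact: lez_abs.
elim: k i u Fu => [|k IH] i u Fu ik.
  by move: Fu; rewrite F0; [move=> ->; exact: LSpan0|lia].
have [c [cw Fc]] := Fg _ _ Fu.
rewrite -[u](subrK (\sum_j polyop 1 (c j) (g j))); apply: lspanD.
  have /IH : i - 1 <= i0 + k%:Z by lia.
  move=> /(_ _ Fc); apply: lspan_mono => x [t tw ->]; exists t => //; lia.
apply: lspan_sum => j _; apply: lext_lspan => a /cw aw.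
by exists (a, j) => //=; rewrite aw.
Qed.

Lemma few_large_of_std (m k D : nat) (a : 'X_{1..m}) :
  (forall s : {set 'I_m}, #|s| = k.+1 -> exists2 i, i \in s & (a i < D)%N) ->
  (#|[pred i | (D <= a i)%N]| <= k)%N.
Proof.
move=> std; rewrite leqNgt; apply/negP => big.
pose s := [set x in take k.+1 (enum [pred i | (D <= a i)%N])]%SET.
have sz : size (take k.+1 (enum [pred i | (D <= a i)%N])) = k.+1.
  by rewrite size_takel // -cardE.
have [|i] := std s.
  by rewrite finset.cardsE -[RHS]sz; apply/card_uniqP/take_uniq/enum_uniq.
by rewrite finset.inE => /mem_take; rewrite mem_enum inE leqNgt => /negP.
Qed.

(* Each set of [n + 1] variables carries a relation, by the bound on the Krull
   dimension; its leading monomial makes the monomials with large exponents in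
   these variables reducible.  Giving [d_i] a large weight, the reduction does
   not increase the weight. *)
Lemma holonomic_growth : holonomic N -> exists r (g : 'I_r -> N) C,
  (forall u, exists l, lspan setT (mons (range g) l) u) /\
  forall l (I : finType) (v : I -> N), freefam v ->
    (forall i, lspan setT (mons (range g) l) (v i)) -> (#|I| <= C * l.+1 ^ n)%N.
Proof.
move=> [F [[Fsub [Fmono Fex] [i0 F0] Fmon [r [g [d [Fg grF]]]]] dimF]].
case: dimF => [N0|[_ nochain]].
  exists 0%N, (fun=> 0), 0%N; split=> [u|l I v fv _].
    by exists 0%N; rewrite (N0 u); exact: LSpan0.
  rewrite leqn0; apply/eqP/eq_card0 => i; have := fv (fun=> 1) _ i.
  by rewrite big1 => [/(_ erefl) /eqP|j _]; rewrite ?oner_eq0 // (N0 (v j)) scaler0.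
have spanF := filtration_span F0 grF.
have Fle := Fmono_le Fmono.
have rel j (s : {set 'I_(n + n)}) : #|s| = n.+1 ->
    exists f d0, [/\ f <> 0, poly_in s f, forall a, a \in msupp f -> order_weight a = d0 &
      F (d j + d0%:Z - 1) (lext (fun a => monop 1 a (g j)) f)].
  move=> sn; have Ii := ideal_gr_kills Fsub Fmono Fmon (Fg j).
  (* Otherwise these n + 1 variables are independent modulo the annihilator of the symbol of [g j],
     and [prime_chain] yields n + 2 nested primes in the singular support. *)
  have [f [If sf f0]] : exists f, [/\ gr_kills F (d j) (g j) f, poly_in s f & f <> 0].
    apply: contrapT => /forallNP none; apply: nochain.
    have [|P PP] := prime_chain char0 (t := s) Ii.
      by move=> f If sf; apply: contrapT => f0; apply: (none f).
    exists (fun i : 'I_n.+2 => P i); split=> [i|i j' ij].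
      have [] := PP i; first by rewrite sn -ltnS.
      move=> Pp PI _; split=> //; exists (d j), (g j); split=> //; exact: Fg.
    by have [] := PP j' _; [rewrite sn -ltnS|move=> _ _; exact].
  have mf : mlead f \in msupp f by apply: mlead_supp; exact/eqP.
  pose d0 := order_weight (mlead f).
  (* [gr_kills] tests each order separately, so the component that contains the leading monomial is
     again a relation. *)
  pose f' := \sum_(a <- msupp f | order_weight a == d0) f@_a *: 'X_[a].
  have cf a : f'@_a = if order_weight a == d0 then f@_a else 0.
    rewrite /f' raddf_sum /= -big_filter.
    case: (boolP (a \in [seq b <- msupp f | order_weight b == d0])) => af.
      rewrite (bigD1_seq a) ?filter_uniq //= mcoeffZ mcoeffX eqxx mulr1.
      rewrite big1 ?addr0 => [|b /negPf ba]; last by rewrite mcoeffZ mcoeffX ba mulr0.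
      by move: af; rewrite mem_filter => /andP [->].
    rewrite big_seq big1 => [|b bf]; last first.
      rewrite mcoeffZ mcoeffX; case: eqVneq => [ba|]; last by rewrite mulr0.
      by move: af; rewrite -ba bf.
    by move: af; rewrite mem_filter mcoeff_msupp negb_and negbK; case: ifP => //= _ /eqP.
  exists f', d0; split.
  - move=> /(congr1 (mcoeff (mlead f))) /eqP; rewrite cf eqxx mcoeff0.
    by rewrite mcoeff_eq0 mf.
  - apply/poly_inP => a; rewrite cf; case: ifP; rewrite ?eqxx // => _.
    by move/poly_inP: sf; apply.
  - by move=> a; rewrite mcoeff_msupp cf; case: ifP => [/eqP ->|]; rewrite ?eqxx.
  move/gr_killsE: If => /(_ d0); congr (F _).
  rewrite /f' linear_sum /lext [RHS]big_mkcond; apply: eq_bigr => a _.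
  by rewrite linearZ /= lextX /opart; case: ifP => _; rewrite ?scaler0.
(* A shift makes the degrees of the generators natural numbers. *)
pose B := (\sum_j `|d j|)%N; pose dd j := `|(d j + B%:Z)%R|%N.
have ddE j : d j = (dd j)%:Z - B%:Z.
  have : (`|d j| <= B)%N by rewrite /B (bigD1 j) //= leq_addr.
  rewrite /dd; lia.
pose ord (t : 'X_{1..n + n} * 'I_r) := (order_weight t.1 + dd t.2)%N.
pose lt0 (t t' : 'X_{1..n + n} * 'I_r) := (ord t < ord t')%N \/
  [/\ t.2 = t'.2, order_weight t.1 = order_weight t'.1 & (t.1 < t'.1)%O].
have red0 (js : 'I_r * {set 'I_(n + n)}) : exists aW : 'X_{1..n + n} * nat,
    #|js.2| = n.+1 -> (forall i, i \notin js.2 -> aW.1 i = 0%N) /\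
    lspan setT [set u | exists2 t, lt0 t (aW.1, js.1) /\ (mdeg t.1 <= aW.2)%N & u = mong g t]
      (mong g (aW.1, js.1)).
  have [js2|] := eqVneq #|js.2| n.+1; last by move=> js2; exists (0%MM, 0%N) => e; case/eqP: js2.
  case: js js2 => j s /= /(rel j) [f [d0 [f0 sf fd Ff]]].
  have mf : mlead f \in msupp f by apply: mlead_supp; exact/eqP.
  have fm : f@_(mlead f) != 0 by rewrite -mcoeff_msupp.
  suff H : lspan setT [set u | exists2 t, lt0 t (mlead f, j) & u = mong g t]
     (mong g (mlead f, j)).
    have [W HW] := lspan_bound (fun t => mdeg t.1) H.
    by exists (mlead f, W) => _; split=> //; move/poly_inP: sf; apply.
  have -> : mong g (mlead f, j) = (f@_(mlead f))^-1 *: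
      (lext (fun a => monop 1 a (g j)) f - lext (fun a => monop 1 a (g j))
        (f - f@_(mlead f) *: 'X_[mlead f])).
    by rewrite [lext _ (f - _)]linearB /= [lext _ (_ *: _)]linearZ /= lextX opprB addrC subrK scalerA mulVf // scale1r.
  apply: lspanZ => //; apply: lspanB => //.
    apply: lspan_mono (spanF _ _ Ff) => u [[a k] /= ak ->]; exists (a, k) => //; left.
    rewrite /ord /= (fd _ mf); move: ak; rewrite !ddE; lia.
  apply: lext_lspan => a; rewrite (perm_mem (msupp_rem _ _)) mem_rem_uniq ?msupp_uniq //.
  rewrite inE => /andP [am af]; exists (a, j) => //; right; split=> //=.
    by rewrite (fd _ af) (fd _ mf).
  by rewrite lt_neqAle am msupp_le_mlead.
have /choice [aW aWP] := red0.
pose D := (\max_js \max_i (aW js).1 i).+1; pose W := \max_js (aW js).2.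
(* A term of a relation with smaller [ord] has degree at most [W], which the drop of [W * ord]
   compensates; the other terms have the same [ord] and no larger degree. Hence rewriting does not
   increase [wt]. *)
pose wt (t : 'X_{1..n + n} * 'I_r) := (mdeg t.1 + W * ord t)%N.
pose lt t t' := lt0 t t' /\ (wt t <= wt t')%N.
have lt0_wf : well_founded lt0.
  suff H k a j : (order_weight a + dd j < k)%N -> Acc lt0 (a, j).
    by case=> a j; exact: H (ltnSn _).
  elim: k a j => [//|k IH] a j; elim: (ltom_wf a) => {}a _ IHa ak.
  constructor=> -[b i] [blt|[/= -> e ba]].
    by apply: IH; exact: leq_trans blt ak.
  by apply: IHa => //; rewrite e.
have lt_wf : well_founded lt.
  by move=> t; elim/(well_founded_ind lt0_wf): t => t IH; constructor=> s [/IH].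
have lt_trans s t u : lt s t -> lt t u -> lt s u.
  move=> [st wst] [tu wtu]; split; last exact: leq_trans wst wtu.
  case: st => [st|[st2 st1 sta]]; case: tu => [tu|[tu2 tu1 tua]].
  - by left; apply: ltn_trans st tu.
  - by left; move: st; rewrite /ord -tu2 -tu1.
  - by left; move: tu; rewrite /ord -st2 -st1.
  - by right; split; [rewrite st2|rewrite st1|exact: Order.POrderTheory.lt_trans sta tua].
have lt_add a b j k i : lt (a, j) (b, k) -> lt ((a + U_(i))%MM, j) ((b + U_(i))%MM, k).
  rewrite /lt /lt0 /wt /ord /= !mdegD !order_weightD ltmc_add2l => -[lt0ab wab]; split.
    by case: lt0ab => [h|[-> -> ->]]; [left; lia|right].
  nia.
have lt_low (a : 'X_{1..n + n}) i j : (0 < a (lshift n i))%N ->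
    lt ((a - U_(lshift n i))%MM, j) ((a + U_(rshift n i))%MM, j).
  move=> ai; rewrite /lt /lt0 /wt /ord /= -[in order_weight (a + _)%MM](mnm_subK1 ai).
  rewrite -[in mdeg (a + _)%MM](mnm_subK1 ai) !mdegDU !order_weightD order_weight_x order_weight_d.
  by split; [left; lia|nia].
pose red := reducible setT g lt.
pose std (t : 'X_{1..n + n} * 'I_r) := forall s : {set 'I_(n + n)}, #|s| = n.+1 -> exists2 i, i \in s & (t.1 i < D)%N.
have stdred t : ~ std t -> red t.
  case: t => a j /existsNP [s /not_implyP [sn large]].
  have [s0 redb] := aWP (j, s) sn; set b := (aW (j, s)).1 in s0 redb *.
  have ba : (b <= a)%MM.
    apply/mnm_lepP => i; case: (boolP (i \in s)) => [i_s|/s0 -> //].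
    have : ~ (a i < D)%N by move=> h; apply: large; exists i.
    move/negP; rewrite -leqNgt; apply: leq_trans; apply/ltnW; rewrite ltnS.
    apply: leq_trans (leq_bigmax (j, s)); exact: (leq_bigmax i).
  refine (reducible_le (subringT K) lt_trans lt_add lt_low ba _).
  apply: lspan_mono redb => u [[c k] [ltc mc] ->]; exists (c, k) => //; split=> //.
  case: ltc => [ltc|[/= kj co cb]].
    have : (mdeg c <= W)%N by apply: leq_trans mc _; exact: (leq_bigmax (j, s)).
    rewrite /wt /=; move: ltc; move: (ord _) (ord _) => x y xy; nia.
  by rewrite /wt /ord /= co kj leq_add2r lemc_mdeg // ltW.
pose E := (\max_j dd j)%N.
have spanstd l u : lspan setT (mons (range g) l) u -> lspan setT
    [set u | exists2 t, std t /\ (mdeg t.1 <= l + W * (l + E))%N & u = mong g t] u.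
  apply: lspan_sub => // x [a [_ [al [j _ <-] ->]]].
  apply: lspan_mono (reduce (subringT K) lt_wf lt_trans stdred (a, j)) => y [[b k] [sb ltb ->]].
  exists (b, k) => //; split=> //=.
  have : (wt (b, k) <= wt (a, j))%N by case: ltb => [-> //|[]].
  have : (dd j <= E)%N := leq_bigmax j.
  have := order_weight_le a; rewrite /wt /ord /=; nia.
exists r, g, (2 ^ (n + n) * D.+1 ^ (n + n) * (1 + W + W * E) ^ n * r)%N; split.
  move=> u; have [i Fu] := Fex u.
  have [L HL] := lspan_bound (fun t => mdeg t.1) (spanF _ _ Fu); exists L.
  by apply: lspan_mono HL => x [[a j] [_ al] ->]; exists a, (g j); split=> //; exists j.
move=> l I v fv vl; set L := (l + W * (l + E))%N.
have [J [w [cJ wP]]] := few_large_exponents (n + n) n D L.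
have := free_lspan_card_le (w := fun t : J * 'I_r => mong g (w t.1, t.2)) fv _
  (fun i => spanstd _ _ (vl i)).
rewrite card_prod card_ord cJ => H; apply: leq_trans (H _) _.
  move=> u [[a j] [sa aL] ->].
  have [k ->] : exists k, a = w k; last by exists (k, j).
  apply: wP; first exact: few_large_of_std.
  by move=> i; apply: leq_trans aL; rewrite mdegE (bigD1 i) //= leq_addr.
have HL : (L.+1 ^ n <= (1 + W + W * E) ^ n * l.+1 ^ n)%N.
  rewrite -expnMn; case: (posnP n) => [-> //|n0]; rewrite leq_exp2r // /L; nia.
by rewrite [X in (_ <= X)%N]mulnAC -[X in (_ <= X * _)%N]mulnA !leq_mul.
Qed.

End HolonomicGrowth.

(** * A change of coordinates making the module finite over the coordinate ring *)

Section Grid.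

Lemma digits_inj (q n : nat) (d e : nat -> nat) :
  (forall m, (m < n)%N -> (d m < q)%N) -> (forall m, (m < n)%N -> (e m < q)%N) ->
  (\sum_(m < n) d m * q ^ m = \sum_(m < n) e m * q ^ m)%N ->
  forall m, (m < n)%N -> d m = e m.
Proof.
elim: n d e => // n IH d e dq eq_; have q0 : (0 < q)%N by apply: leq_ltn_trans (dq 0%N _).
rewrite !big_ord_recl !expn0 !muln1.
have E (f : nat -> nat) : (\sum_(m < n) f (bump 0 m) * q ^ bump 0 m =
    (\sum_(m < n) f m.+1 * q ^ m) * q)%N.
  by rewrite big_distrl /=; apply: eq_bigr => m _; rewrite /bump add1n expnSr mulnA.
rewrite /= (E d) (E e) addnC [in RHS]addnC => de; have d0 : d 0%N = e 0%N.
  by move/(congr1 (modn^~ q)): (de); rewrite !modnMDl !modn_small ?dq ?eq_.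
move: de; rewrite d0 => /addIn/eqP; rewrite eqn_pmul2r // => /eqP de.
case=> // m mn; apply: (IH (fun k => d k.+1) (fun k => e k.+1)) => // k kn.
  exact: dq.
exact: eq_.
Qed.

(* Double counting: a subset of the grid meeting each line in direction [i] in
   at most [B] points has density at most [B / T]. *)
Lemma grid_avoid (n T B : nat) (S : 'I_n -> {ffun 'I_n -> 'I_T} -> Prop) :
  (n * B < T)%N ->
  (forall i (t : {ffun 'I_n -> 'I_T}), exists F : {set 'I_T}, (#|F| <= B)%N /\
     forall x, S i [ffun j => if j == i then x else t j] -> x \in F) ->
  exists t, forall i, ~ S i t.
Proof.
move=> BT SB; apply: contrapT => /forallNP all_bad.
have T0 : (0 < T)%N by apply: leq_ltn_trans BT.
pose X := {ffun 'I_n -> 'I_T}.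
pose upd i (t : X) (x : 'I_T) : X := [ffun j => if j == i then x else t j].
pose bad i : {set X} := [set t | `[< S i t >]]%SET.
have badB i : (#|bad i| * T <= B * T ^ n)%N.
  pose h (tx : X * 'I_T) := (upd i tx.1 tx.2, tx.1 i).
  have hK : involutive h.
    move=> [t x]; rewrite /h /= ffunE eqxx; congr (_, _).
    by apply/ffunP => j; rewrite !ffunE; case: eqVneq => [->|].
  have -> : (#|bad i| * T = \sum_(tx : X * 'I_T) (tx.1 \in bad i))%N.
    rewrite -(pair_bigA _ (fun (t : X) (x : 'I_T) => (t \in bad i : nat))) /=.
    under [RHS]eq_bigr => t _ do rewrite sum_nat_const card_ord.
    rewrite -big_distrr /= mulnC; congr (_ * _)%N; rewrite -sum1_card big_mkcond.
    by apply: eq_bigr => t _ /=; case: (t \in _).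
  rewrite (reindex_inj (inv_inj hK)) /=.
  rewrite -(pair_bigA _ (fun (t : X) (x : 'I_T) => (upd i t x \in bad i : nat))) /=.
  apply: (@leq_trans (\sum_(t : X) B)).
    apply: leq_sum => t _; have [F [FB SF]] := SB i t; apply: leq_trans FB.
    rewrite -sum1_card [X in (_ <= X)%N]big_mkcond; apply: leq_sum => x _.
    rewrite finset.inE; case: asboolP => //= /SF -> //.
  by rewrite sum_nat_const card_ffun !card_ord mulnC.
have cover : (T ^ n <= \sum_i #|bad i|)%N.
  have -> : (T ^ n = #|[set: X]%SET|)%N by rewrite finset.cardsT card_ffun !card_ord.
  apply: leq_trans (_ : #|\bigcup_i bad i|%SET <= _)%N.
    apply: subset_leq_card; apply/fintype.subsetP => t _.
    have /existsNP [i /contrapT Sit] := all_bad t.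
    by apply/finset.bigcupP; exists i => //; rewrite finset.inE; apply/asboolP.
  elim/big_rec2: _ => [|i k A _ IH]; first by rewrite finset.cards0.
  by rewrite (leq_trans (finset.leq_card_setU _ _)) // leq_add2l.
have : (T ^ n * T <= n * B * T ^ n)%N.
  apply: (@leq_trans ((\sum_i #|bad i|) * T)); first by rewrite leq_mul2r cover orbT.
  rewrite big_distrl /=; apply: leq_trans (leq_sum _ (fun i _ => badB i)) _.
  by rewrite sum_nat_const card_ord mulnA.
by rewrite mulnC leq_pmul2r ?expn_gt0 ?T0 // leqNgt BT.
Qed.

End Grid.

(** * Linear symplectic changes of coordinates *)

Section Twist.
Variables (K : fieldType) (n : nat) (N : weyl_module K n) (s : 'I_n -> 'I_n -> nat).

Definition shift_d (m : 'I_n) (u : N) : N := \sum_j (s m j)%:R *: wd N j u.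

Lemma shift_d_linear m : linear (shift_d m).
Proof.
move=> c u v; rewrite /shift_d scaler_sumr -big_split; apply: eq_bigr => j _.
by rewrite linearP scalerDr !scalerA mulrC.
Qed.

HB.instance Definition _ m := GRing.isLinear.Build K N N _ (shift_d m)
  (shift_d_linear m).

Lemma wd_shift_d i j u : wd N i (shift_d j u) = shift_d j (wd N i u).
Proof.
rewrite /shift_d linear_sum; apply: eq_bigr => k _; by rewrite linearZ /= wdC.
Qed.

Lemma shift_dC i j u : shift_d i (shift_d j u) = shift_d j (shift_d i u).
Proof.
have E v : shift_d i v = \sum_k (s i k)%:R *: wd N k v by [].
rewrite !E linear_sum; apply: eq_bigr => k _; by rewrite linearZ /= wd_shift_d.
Qed.

Lemma shift_d_x i j u : shift_d j (wx N i u) = wx N i (shift_d j u) + (s j i)%:R *: u.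
Proof.
rewrite /shift_d; under eq_bigr => k _.
  have /eqP := wdx k i u; rewrite subr_eq => /eqP ->.
  rewrite scalerDr scalerA; over.
rewrite big_split /= addrC; congr (_ + _).
  by rewrite linear_sum; apply: eq_bigr => k _; rewrite linearZ.
rewrite (bigD1 i) //= eqxx mulr1 big1 ?addr0 // => k /negPf ->.
by rewrite mulr0 scale0r.
Qed.

Definition twist_x (m : 'I_n) : N -> N := wx N m \- shift_d m.

HB.instance Definition _ m := GRing.Linear.on (twist_x m).

Hypothesis ssym : forall i j, s i j = s j i.

(** The commutator of x'_i and x'_j is s_ji - s_ij. *)
Lemma twist_xC i j u : twist_x i (twist_x j u) = twist_x j (twist_x i u).
Proof.
rewrite /twist_x /= !linearB /= !shift_d_x wxC (shift_dC i j) (ssym i j).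
set a := wx N j _; set b := wx N i _; set c := wx N j _; set d := shift_d j _.
set e := _ *: u; suff E (x y : N) : a - x + (- (y + e) - - d) = a - x - y - (e - d).
  by rewrite !E [a - b - c]addrAC.
by rewrite !opprD !addrA !opprK.
Qed.

Lemma wd_twist_x i j u :
  wd N i (twist_x j u) - twist_x j (wd N i u) = (i == j)%:R *: u.
Proof. by rewrite /twist_x /= linearB /= wd_shift_d opprB addrA subrK wdx. Qed.

Definition twist : weyl_module K n := @WeylModule K n N (fun m => twist_x m) (wd N)
  twist_xC (@wdC K n N) wd_twist_x.

End Twist.

(** * Symbols modulo the twisted coordinates *)

Section Symbols.
Variables (K : fieldType) (n : nat) (N : weyl_module K n) (r : nat) (g : 'I_r -> N).
Variables (s : 'I_n -> 'I_n -> nat) (ssym : forall i j, s i j = s j i).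

Notation N' := (twist N ssym).

(** In the top degree only the generator [j] is allowed, so that the symbol of degree [l] is a form
    times [g j]. *)
Definition deg_le (l : nat) (j : 'I_r) : set N := lspan setT
  [set u : N | exists a t, ((mdeg a < l)%N \/ (mdeg a = l /\ t = j)) /\
     u = monop (N := N') 1 a (g t)].

(* The elements whose symbol of degree [l] vanishes modulo the twisted coordinates. *)
Definition symbol0 (l : nat) (j : 'I_r) : set N := lspan setT
  [set u : N | exists a t,
     ((mdeg a < l)%N \/ [/\ mdeg a = l, t = j & (order_weight a < l)%N]) /\
     u = monop (N := N') 1 a (g t)].

Lemma symbol0_deg_le l j : symbol0 l j `<=` deg_le l j.
Proof.
apply: lspan_mono => u [a [t [H ->]]]; exists a, t; split=> //.
by case: H => [|[]]; [left|right].
Qed.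

Lemma deg_le_x l j i u : deg_le l j u -> symbol0 l.+1 j (twist_x s i u).
Proof.
apply: (lspan_x (N := N')) => v [a [t [H ->]]]; exists a, (g t); split=> //.
exists (a + U_(lshift n i))%MM, t; split=> //; rewrite mdegDU ltnS.
case: H => [|[al ->]]; first by left.
by right; split=> //; rewrite ?al // order_weightD order_weight_x addn0 ltnS -al order_weight_le.
Qed.

Lemma deg_le_d l j i u : deg_le l j u -> deg_le l.+1 j (wd N i u).
Proof.
apply: (lspan_d (N := N') (subringT K)) => v [a [t [H ->]]]; exists a, (g t); split=> // [|_].
  exists (a + U_(rshift n i))%MM, t; split=> //; rewrite mdegDU ltnS.
  by case: H => [|[-> ->]]; [left|right].
exists (a - U_(lshift n i))%MM, t; split=> //; left; rewrite ltnS.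
by apply: leq_trans (mdegB _ _) _; case: H => [/ltnW|[->]].
Qed.

Lemma symbol0_d l j i u : symbol0 l j u -> symbol0 l.+1 j (wd N i u).
Proof.
apply: (lspan_d (N := N') (subringT K)) => v [a [t [H ->]]]; exists a, (g t); split=> // [|_].
  exists (a + U_(rshift n i))%MM, t; split=> //; rewrite mdegDU ltnS.
  case: H => [|[-> -> al]]; [by left|right; split=> //].
  by rewrite order_weightD order_weight_d addn1.
exists (a - U_(lshift n i))%MM, t; split=> //; left; rewrite ltnS.
by apply: leq_trans (mdegB _ _) _; case: H => [/ltnW|[->]].
Qed.

Lemma deg_le_iter_d l j i : deg_le l j (iter l (wd N i) (g j)).
Proof.
elim: l => [|l IH]; last exact: deg_le_d.
apply: lspan1; first exact: subringT.
by exists 0%MM, j; rewrite mdeg0; split; [right|rewrite monop0].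
Qed.

Lemma wx_twist m u : wx N m u = twist_x s m u + shift_d s m u.
Proof. by rewrite /twist_x /= subrK. Qed.

Lemma words_twist G l u : words (N := N) G l u -> gam (N := N') setT G l u.
Proof.
elim=> {l u} [l u Gu|l i u _ IH|l i u _ IH].
- by apply: lspan1; [exact: subringT|exact: Word0].
- rewrite wx_twist; apply: lspanD; first exact: (gam_x (N := N')).
  apply: lspan_sum => j _; apply: lspanZ => //; exact: (gam_d (N := N')).
- exact: (gam_d (N := N')).
Qed.

Lemma gam_twist G l : gam (N := N) setT G l `<=` gam (N := N') setT G l.
Proof. by apply: (lspan_sub (subringT K)) => u; exact: words_twist. Qed.

Lemma twist_gam G l : gam (N := N') setT G l `<=` gam (N := N) setT G l.
Proof.
apply: (lspan_sub (subringT K)) => u.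
elim=> {l u} [l u Gu|l i u _ IH|l i u _ IH].
- by apply: lspan1; [exact: subringT|exact: Word0].
- rewrite [wx N' i u]/(wx N i u - shift_d s i u).
  apply: (lspanB (subringT K)); first exact: (gam_x (N := N)).
  apply: lspan_sum => j _; apply: lspanZ => //; exact: (gam_d (N := N)).
- exact: (gam_d (N := N)).
Qed.

Lemma gam_symbol0 l j : gam (N := N) setT (range g) l `<=` symbol0 l.+1 j.
Proof.
move=> u /gam_twist/(gam_mons (subringT K)); apply: lspan_mono => v [a [_ [al [t _ <-] ->]]].
by exists a, t; split=> //; left.
Qed.

Variable i : 'I_n.

(* Modulo the twisted coordinates, [row_op m] multiplies symbols by [s m i d_i]
   ([s i i d_i^2] if [m = i]), although its definition does not involve the
   [i]-th row and column of [s]. *)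
Definition off_x (m : 'I_n) (u : N) : N :=
  wx N m u - \sum_(k | k != i) (s m k)%:R *: wd N k u.

Definition row_op (m : 'I_n) (u : N) : N :=
  if m == i then wx N i (wd N i u) - \sum_(k | k != i) off_x k (wd N k u)
  else off_x m u.

Definition row_deg (m : 'I_n) : nat := (m == i).+1.

Lemma off_xE m u : off_x m u = twist_x s m u + (s m i)%:R *: wd N i u.
Proof.
rewrite /off_x wx_twist -addrA; congr (_ + _).
by rewrite /shift_d (bigD1 i) //= addrK.
Qed.

Definition leads (c : K) (l : nat) (j : 'I_r) (u : N) : Prop :=
  symbol0 l j (u - c *: iter l (wd N i) (g j)).

Lemma leads_deg_le c l j u : leads c l j u -> deg_le l j u.
Proof.
move/symbol0_deg_le => Yu; rewrite -(subrK (c *: iter l (wd N i) (g j)) u).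
by apply: lspanD => //; apply: lspanZ => //; exact: deg_le_iter_d.
Qed.

(** Substitute x_m = x'_m + sum_k s_mk d_k: the terms with x' on the left fall into [symbol0]. For m
    = i, the sum over k != i in [row_op] cancels the terms s_ik d_k d_i, by symmetry, and leaves
    s_ii d_i^2. *)
Lemma leads_row_op c l j m u : leads c l j u ->
  leads (c * (s m i)%:R) (l + row_deg m) j (row_op m u).
Proof.
move=> cu; have Yu := leads_deg_le cu; rewrite /leads /row_deg /row_op.
case: (eqVneq m i) => [->|mi]; last first.
  rewrite addn1 off_xE -addrA; apply: lspanD; first exact: deg_le_x.
  rewrite mulrC -scalerA -scalerBr; apply: lspanZ => //.
  by rewrite /= -linearZ -linearB /=; apply: symbol0_d.
rewrite addn2.
have -> : wx N i (wd N i u) - \sum_(k | k != i) off_x k (wd N k u) =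
    (s i i)%:R *: wd N i (wd N i u) + (twist_x s i (wd N i u) -
       \sum_(k | k != i) twist_x s k (wd N k u)).
  under eq_bigr => k _ do rewrite off_xE.
  rewrite big_split /= wx_twist {1}/shift_d (bigD1 i) //= opprD addrACA addrC.
  congr (_ + _); rewrite -addrA [X in _ + X](_ : _ = 0) ?addr0 //; apply/eqP.
  by rewrite subr_eq0; apply/eqP; apply: eq_bigr => k _; rewrite ssym wdC.
rewrite addrAC; apply: lspanD.
  rewrite mulrC -scalerA -scalerBr; apply: lspanZ => //.
  by rewrite /= -!linearZ -!linearB /=; do 2!apply: symbol0_d.
apply: (lspanB (subringT K)); first by apply: deg_le_x; exact: deg_le_d.
by apply: lspan_sum => k _; apply: deg_le_x; exact: deg_le_d.
Qed.

Lemma leads_powop al c l j u : leads c l j u ->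
  leads (c * \prod_m (s m i)%:R ^+ al m) (l + \sum_m row_deg m * al m) j (powop row_op al u).
Proof.
move=> cu; rewrite /powop -!big_enum /=.
elim: (enum _) => [|m e IH] /=; first by rewrite !big_nil mulr1 addn0.
rewrite !big_cons mulrCA addnCA.
elim: (al m) => [|k IHk]; first by rewrite expr0 mul1r muln0.
have := leads_row_op m IHk.
by rewrite mulrAC -exprSr addnAC -mulnSr.
Qed.

Lemma row_op_gam l m u : gam (N := N) setT (range g) l u ->
  gam (N := N) setT (range g) (l + row_deg m) (row_op m u).
Proof.
have off k l' v : gam (N := N) setT (range g) l' v ->
    gam (N := N) setT (range g) l'.+1 (off_x k v).
  move=> Gv; apply: (lspanB (subringT K)); first exact: (gam_x (N := N)).
  by apply: lspan_sum => j _; apply: lspanZ => //; exact: (gam_d (N := N)).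
move=> Gu; rewrite /row_op /row_deg; case: eqVneq => _; last by rewrite addn1; exact: off.
rewrite addn2; apply: (lspanB (subringT K)); first by apply/gam_x/gam_d.
by apply: lspan_sum => k _; apply/off/gam_d.
Qed.

Lemma powop_gam l al u : gam (N := N) setT (range g) l u ->
  gam (N := N) setT (range g) (l + \sum_m row_deg m * al m)%N (powop row_op al u).
Proof.
move=> Gu; rewrite /powop -big_enum /=.
elim: (enum _) => [|m e IH] /=; first by rewrite big_nil addn0.
rewrite big_cons addnCA addnC; elim: (al m) => [|k IHk]; first by rewrite muln0 addn0.
by rewrite mulnSr addnA; exact: row_op_gam.
Qed.

Lemma iter_d_gam e j : gam (N := N) setT (range g) e (iter e (wd N i) (g j)).
Proof.
apply: lspan1; first exact: subringT.
rewrite -[X in words _ X]add0n; apply: iter_words; first by move=> *; exact: WordD.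
by apply: Word0; exists j.
Qed.

End Symbols.

Lemma eq_row_op (K : fieldType) (n : nat) (N : weyl_module K n)
    (s s' : 'I_n -> 'I_n -> nat) (i : 'I_n) :
  (forall m k, m != i -> k != i -> s m k = s' m k) ->
  row_op (N := N) s i = row_op s' i.
Proof.
move=> E; have off m u : m != i -> off_x s i m u = off_x (N := N) s' i m u.
  by move=> mi; congr (_ - _); apply: eq_bigr => k ki; rewrite E.
apply/funext => m; apply/funext => u; rewrite /row_op; case: eqVneq => [_|/off //].
by congr (_ - _); apply: eq_bigr => k /off ->.
Qed.

Section Normalization.
Variables (K : fieldType) (n : nat) (N : weyl_module K n) (r : nat) (g : 'I_r -> N).
Hypothesis char0 : forall j : nat, (j.+1)%:R != 0 :> K.

Lemma natr_inj0 (i j : nat) : (i%:R == j%:R :> K) = (i == j).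
Proof.
wlog ij : i j / (i <= j)%N => [hw|].
  by case/orP: (leq_total i j) => ij; [|rewrite eq_sym [RHS]eq_sym]; apply: hw.
rewrite [LHS]eq_sym -subr_eq0 -natrB // [RHS]eqn_leq ij -subn_eq0.
by case: (j - i)%N => [|d]; rewrite ?eqxx // (negPf (char0 d)).
Qed.

(** A maximal free subfamily of the monomials on the generators still spans, and the growth bound
    limits its size. *)
Lemma gam_basis (L D : nat) :
  (forall (I : finType) (v : I -> N), freefam v ->
    (forall i, gam setT (range g) L (v i)) -> (#|I| <= D)%N) ->
  exists (J : finType) (w : J -> N), (#|J| <= D)%N /\
    forall u, gam setT (range g) L u -> exists c : J -> K, u = \sum_j c j *: w j.
Proof.
move=> growth.
pose w (t : 'X_{1..(n + n) < L.+1} * 'I_r) : N := monop 1 (bmnm t.1) (g t.2).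
have [S [fS wS]] := max_free w.
exists {j | j \in S}, (fun j => w (val j)); split.
  apply: growth fS _ => j; apply: (lspan1 (subringT K)).
  apply: mons_words; exists (bmnm (val j).1), (g (val j).2).
  by split=> //; rewrite -ltnS bmdeg.
move=> u /(gam_mons (subringT K)) Gu.
have [|c _ ->] := @lspan_fin _ _ setT (subringT K) _ w _ u _ Gu.
  move=> v [a [_ [al [t _ <-] ->]]]; rewrite -ltnS in al.
  by exists (BMultinom al, t).
have [C wE] := choice wS.
exists (fun k => \sum_j c j * C j k).
under [RHS]eq_bigr => k _ do rewrite scaler_suml.
rewrite exchange_big /=; apply: eq_bigr => j _.
by rewrite {1}wE scaler_sumr; apply: eq_bigr => k _; rewrite scalerA.
Qed.

(* By the growth bound, the products of the [row_op m] applied to the powers of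
   [d_i] satisfy a linear relation, which does not depend on the [i]-th row of
   [s]; modulo the twisted coordinates it reads [p(s_i) d_i^L g_j = 0] for a
   polynomial [p <> 0] in that row.  The entries [s m j] are chosen as products of
   powers of parameters [t_m], with exponents such that, in the parameter [t_i]
   alone, distinct monomials in the [i]-th row become distinct powers. *)
Lemma exists_twist (C : nat) :
  (forall l (I : finType) (v : I -> N), freefam v ->
    (forall i, gam setT (range g) l (v i)) -> (#|I| <= C * l.+1 ^ n)%N) ->
  exists (s : 'I_n -> 'I_n -> nat) (ssym : forall i j, s i j = s j i) (k : nat),
    forall i j, symbol0 g ssym k j (iter k (wd N i) (g j)).
Proof.
move=> growth.
(* There will be M^(n + 1) unknowns and at most r C (L + 1)^n equations, where L + 1 <= (n + 3)
   M. *)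
have [M M0 HM] : exists2 M, (0 < M)%N & (r * C * n.+3 ^ n < M)%N by exists (r * C * n.+3 ^ n).+1.
pose L := (n.+2 * M)%N; pose Q := (2 * M)%N.
pose B := (n * (2 * M * Q ^ n))%N; pose T := (n * B).+1.
pose X := {ffun 'I_n -> 'I_T}.
(* In the parameter t_i, the entry s_mi has degree Q^m for m != i and 2 Q^i for m = i, that is
   [row_deg i m * Q ^ m]. A monomial in the i-th row thus has an exponent with base [Q] digits
   [row_deg i m * al m], which are below [Q = 2 * M]. *)
pose s (t : X) (m j : 'I_n) := ((t m).+1 ^ (Q ^ j) * (t j).+1 ^ (Q ^ m))%N.
have ssym t i j : s t i j = s t j i by rewrite /s mulnC.
have Q0 : (0 < Q)%N by rewrite muln_gt0.
have [|t tP] := @grid_avoid n T B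
    (fun i t => ~ forall j, symbol0 g (ssym t) L j (iter L (wd N i) (g j))) (ltnSn _); last first.
  by exists (s t), (ssym t), L => i; apply: contrapT; exact: tP.
move=> i t.
pose I := ({ffun 'I_n -> 'I_M} * 'I_M)%type.
(* The degree of a product of the [row_op m] is at most (n + 1) M, and a power of d_i fills it up to
   [Lb b]. The M values of [b] supply the last factor in the number of unknowns. *)
pose Lb (b : 'I_M) := (n.+1 * M + b)%N.
pose wdeg (al : {ffun 'I_n -> 'I_M}) := (\sum_m row_deg i m * al m)%N.
have wdegL al b : (wdeg al <= Lb b)%N.
  apply: leq_trans (leq_addr _ _); rewrite /wdeg.
  apply: (@leq_trans (\sum_m (M + (m == i) * M))).
    by apply: leq_sum => m _; rewrite /row_deg mulSn leq_add // ?leq_mul2l ltnW ?orbT.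
  rewrite big_split /= sum_nat_const card_ord mulSn addnC leq_add2r.
  rewrite (bigD1 i) //= eqxx mul1n big1 ?addn0 // => m /negPf ->.
  by rewrite mul0n.
pose v (q : I) j : N := powop (row_op (s t) i) (fun m => q.1 m)
  (iter (Lb q.2 - wdeg q.1) (wd N i) (g j)).
have vG q j : gam setT (range g) (Lb q.2) (v q j).
  by rewrite -[Lb q.2](subnK (wdegL q.1 q.2)); apply/powop_gam/iter_d_gam.
have LbL b : (Lb b <= L)%N by rewrite /Lb /L [in X in (_ <= X)%N]mulSn addnC leq_add2r ltnW.
have [J [w [JD wG]]] := gam_basis (growth L).
have /choice [D vD] : forall qj : I * 'I_r, exists c : J -> K,
    v qj.1 qj.2 = \sum_k c k *: w k.
  by move=> [q j]; apply: wG; apply: gam_le (LbL _) _ (vG q j).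
(* One relation serves all generators at once, whence the factor [r]; the polynomial [p] below is
   then independent of [j]. *)
have [|c [q0 cq0] cD] := @linear_relation K I ('I_r * J)%type (fun q jk => D (q, jk.1) jk.2).
  rewrite !card_prod card_ffun !card_ord -expnSr.
  apply: (@leq_ltn_trans (r * (C * L.+1 ^ n))%N); first by rewrite leq_mul2l JD orbT.
  rewrite mulnA; apply: (@leq_ltn_trans (r * C * (n.+3 * M) ^ n)).
    rewrite leq_mul2l; apply/orP; right; case: (posnP n) => [-> //|n0].
    by rewrite leq_exp2r // /L (mulSn n.+2) -add1n leq_add2r.
  by rewrite expnMn mulnA expnS ltn_mul2r expn_gt0 M0.
have cv j : \sum_q c q *: v q j = 0.
  under eq_bigr => q _ do rewrite (vD (q, j)) scaler_sumr.
  rewrite exchange_big big1 //= => k _.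
  under eq_bigr => q _ do rewrite scalerA.
  by rewrite -scaler_suml (cD (j, k)) scale0r.
(* In the top degree [Lb b0] that occurs, the terms with smaller [b] have no symbol. *)
have [b0 [al0 cb0] bmax] : exists2 b0, exists al, c (al, b0) != 0 &
    forall (b : 'I_M) al, (b0 < b)%N -> c (al, b) = 0.
  pose Pb (b : 'I_M) := [exists al, c (al, b) != 0].
  have Pq : Pb q0.2 by apply/existsP; exists q0.1; rewrite -surjective_pairing.
  case: (arg_maxnP (fun b : 'I_M => b : nat) Pq) => b0 /existsP [al cal] bmax.
  exists b0; first by exists al.
  move=> b al' b0b; apply/eqP; apply: contraTT b0b => cb; rewrite -leqNgt.
  by apply: bmax; apply/existsP; exists al'.
pose E (al : {ffun 'I_n -> 'I_M}) := (\sum_m row_deg i m * al m * Q ^ m)%N.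
pose lam (al : {ffun 'I_n -> 'I_M}) : K :=
  \prod_(m | m != i) (((t m).+1 ^ (Q ^ i))%:R ^+ al m).
pose p : {poly K} := \sum_al (c (al, b0) * lam al) *: 'X^(E al).
have Einj : injective E.
  move=> al be; pose ext (f : {ffun 'I_n -> 'I_M}) m :=
    if insub m is Some m' then (row_deg i m' * f m')%N else 0%N.
  have extE f (m : 'I_n) : ext f m = (row_deg i m * f m)%N by rewrite /ext valK.
  have extQ f m : (m < n)%N -> (ext f m < Q)%N.
    move=> mn; rewrite (extE f (Ordinal mn)) /Q /row_deg.
    have := ltn_ord (f (Ordinal mn)); move: (nat_of_ord (f _)) => x xM.
    by case: (_ == _) => /=; lia.
  move=> Eab; apply/ffunP => m; apply: val_inj => /=.
  have /eqP : ext al m = ext be m.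
    apply: (@digits_inj Q n) => [k|k||//]; try exact: extQ.
    have EE f : E f = (\sum_(k < n) ext f k * Q ^ k)%N.
      by apply: eq_bigr => k _; rewrite extE.
    by rewrite -!EE.
  by rewrite !extE eqn_pmul2l // => /eqP.
have lam0 al : lam al != 0.
  apply/prodf_neq0 => m _; rewrite expf_neq0 // -[0]/(0%:R) natr_inj0.
  by rewrite -lt0n expn_gt0.
have p0 : p != 0.
  apply/eqP => /(congr1 (coefp (E al0))) /eqP; rewrite /coefp coef_sum coef0.
  rewrite (bigD1 al0) //= coefZ coefXn eqxx mulr1 big1 ?addr0.
    by rewrite mulf_eq0 (negPf cb0) (negPf (lam0 _)).
  move=> al /negPf al0'; rewrite coefZ coefXn (inj_eq Einj) eq_sym al0'.
  by rewrite mulr0.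
have sp : (size p <= B.+1)%N.
  apply: (leq_trans (size_sum _ _ _)); apply/bigmax_leqP => al _.
  apply: leq_trans (size_scale_leq _ _) _; rewrite size_polyXn ltnS.
  apply: (@leq_trans (\sum_(m < n) 2 * M * Q ^ n)%N); last by rewrite sum_nat_const card_ord.
  apply: leq_sum => m _; apply: leq_mul; last by rewrite leq_pexp2l // ltnW.
  apply: leq_mul; last exact: ltnW.
  by rewrite /row_deg ltnS leq_b1.
pose pt (x : 'I_T) : K := (x.+1)%:R.
exists [set x | root p (pt x)]%SET; split.
  rewrite -ltnS; apply: leq_trans sp.
  have := @max_poly_roots _ p [seq pt x | x <- enum [set x | root p (pt x)]%SET] p0.
  rewrite size_map -cardE; apply.
    by apply/allP => _ /mapP [x + ->]; rewrite mem_enum finset.inE.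
  rewrite map_inj_uniq ?enum_uniq // => x y /eqP; rewrite natr_inj0 eqSS => /eqP.
  exact: val_inj.
move=> x; rewrite finset.inE; set t' := [ffun j => _] => nS.
apply: contraPT nS => px nS; apply: nS => j.
have row_t : row_op (N := N) (s t) i = row_op (s t') i.
  by apply: eq_row_op => m k mi ki; rewrite /s !ffunE (negPf mi) (negPf ki).
have prodE (al : {ffun 'I_n -> 'I_M}) :
    \prod_m (s t' m i)%:R ^+ al m = lam al * pt x ^+ E al.
  rewrite /E (big_morph _ (exprD (pt x)) (expr0 _)) (bigD1 i) //= [in RHS](bigD1 i) //=.
  rewrite mulrCA /lam -big_split /=; congr (_ * _).
    rewrite /s !ffunE eqxx -expnD addnn -mul2n natrX -exprM /row_deg eqxx.
    by rewrite mulnAC.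
  apply: eq_bigr => m mi; rewrite /s !ffunE (negPf mi) eqxx natrM exprMn.
  by rewrite [X in _ * X ^+ _]natrX -exprM /row_deg (negPf mi) mul1n mulnC.
have lead_v al : leads g (ssym t') i (lam al * pt x ^+ E al) (Lb b0) j (v (al, b0) j).
  have /(leads_powop (fun m => al m)) : leads g (ssym t') i 1 (Lb b0 - wdeg al) j
      (iter (Lb b0 - wdeg al) (wd N i) (g j)).
    by rewrite /leads scale1r subrr; exact: LSpan0.
  by rewrite mul1r prodE subnK // -row_t.
have sym_sum : symbol0 g (ssym t') (Lb b0) j (p.[pt x] *: iter (Lb b0) (wd N i) (g j)).
  have -> : p.[pt x] *: iter (Lb b0) (wd N i) (g j) =
      \sum_(q | q.2 != b0) c q *: - v q j - \sum_al c (al, b0) *: (v (al, b0) j -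
        (lam al * pt x ^+ E al) *: iter (Lb b0) (wd N i) (g j)).
    have := cv j; rewrite (bigID (fun q => q.2 == b0)) /= => /eqP.
    rewrite addrC addr_eq0 => /eqP cv'.
    under eq_bigr => q _ do rewrite scalerN.
    rewrite sumrN cv' opprK; under [X in _ - X]eq_bigr => al _ do rewrite scalerBr.
    rewrite sumrB opprB addrA addrAC.
    have -> : \sum_(q | q.2 == b0) c q *: v q j = \sum_al c (al, b0) *: v (al, b0) j.
      rewrite (reindex_onto (fun al => (al, b0)) (fun q => q.1)) /=.
        by apply: eq_bigl => al; rewrite !eqxx.
      by move=> [al b] /= /eqP ->.
    rewrite subrr add0r /p horner_sum scaler_suml; apply: eq_bigr => al _.
    by rewrite hornerZ hornerXn scalerA mulrA.
  apply: (lspanB (subringT K)); last first.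
    by apply: lspan_sum => al _; apply: lspanZ => //; exact: lead_v.
  apply: lspan_sum => -[al b] /= bb0; case: (ltngtP b b0) => [lt|gt|/val_inj e].
  - rewrite scalerN; apply: lspanN => //; apply: lspanZ => //.
    have lb : (Lb b <= (Lb b0).-1)%N by rewrite /Lb; lia.
    have := gam_symbol0 (ssym t') j (gam_le lb (vG (al, b) j)).
    by rewrite prednK // /Lb; lia.
  - by rewrite (bmax _ _ gt) scale0r; exact: LSpan0.
  - by rewrite e eqxx in bb0.
have sym_b0 : symbol0 g (ssym t') (Lb b0) j (iter (Lb b0) (wd N i) (g j)).
  have := lspanZ (subringT K) (c := p.[pt x]^-1) Logic.I sym_sum.
  by rewrite scalerA mulVf ?scale1r.
rewrite -(subnK (LbL b0)) iterD addnC.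
elim: (L - Lb b0)%N => [|d IHd]; first by rewrite addn0.
by rewrite addnS; exact: symbol0_d.
Qed.

End Normalization.

(** * Base change to residue fields *)

Section QuotientModule.
Local Open Scope quotient_scope.
Variables (K : fieldType) (V : lmodType K) (B : set V).
Hypothesis sB : subspace B.

Definition in_sub : {pred V} := [pred v | `[< B v >]].

Lemma in_subP v : reflect (B v) (v \in in_sub).
Proof. exact: asboolP. Qed.

Lemma in_sub_zmod_closed : zmod_closed in_sub.
Proof.
split; first by apply/in_subP; case: sB.
by move=> u v /in_subP Bu /in_subP Bv; apply/in_subP; exact: subspaceB.
Qed.

HB.instance Definition _ := GRing.isZmodClosed.Build V in_sub in_sub_zmod_closed.

Definition quotm : Type := Quotient.quot in_sub.

HB.instance Definition _ := GRing.Zmodule.on quotm.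

Definition quotm_pi (v : V) : quotm := \pi_(Quotient.quot in_sub) v.

Lemma quotm_piE u v : quotm_pi u = quotm_pi v <-> B (u - v).
Proof.
split=> [/eqP|Buv]; last first.
  by apply/eqP; rewrite -Quotient.idealrBE; apply/in_subP.
by rewrite -Quotient.idealrBE => /in_subP.
Qed.

Lemma quotm_piK (q : quotm) : quotm_pi (repr q) = q.
Proof. exact: reprK. Qed.

Lemma quotm_piD u v : quotm_pi (u + v) = quotm_pi u + quotm_pi v.
Proof. exact: (raddfD (\pi_(Quotient.quot in_sub))). Qed.

Definition quotm_scale (c : K) (q : quotm) : quotm := quotm_pi (c *: repr q).

Lemma quotm_scaleE c v : quotm_scale c (quotm_pi v) = quotm_pi (c *: v).
Proof.
apply/quotm_piE; rewrite -scalerBr; apply: subspaceZ => //.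
by apply/quotm_piE; exact: quotm_piK.
Qed.

Lemma quotm_scaleA a b v : quotm_scale a (quotm_scale b v) = quotm_scale (a * b) v.
Proof. by rewrite -[v]quotm_piK !quotm_scaleE scalerA. Qed.

Lemma quotm_scale1 : left_id 1 quotm_scale.
Proof. by move=> v; rewrite -[v]quotm_piK quotm_scaleE scale1r. Qed.

Lemma quotm_scaleDr : right_distributive quotm_scale +%R.
Proof.
move=> c u v; rewrite -[u]quotm_piK -[v]quotm_piK -quotm_piD !quotm_scaleE.
by rewrite scalerDr quotm_piD.
Qed.

Lemma quotm_scaleDl v : {morph quotm_scale^~ v : a b / a + b}.
Proof.
by move=> a b; rewrite -[v]quotm_piK !quotm_scaleE scalerDl quotm_piD.
Qed.

HB.instance Definition _ := GRing.Zmodule_isLmodule.Build K quotm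
  quotm_scaleA quotm_scale1 quotm_scaleDr quotm_scaleDl.

Lemma quotm_pi_linear : linear quotm_pi.
Proof. by move=> c u v; rewrite quotm_piD -quotm_scaleE. Qed.

HB.instance Definition _ := GRing.isLinear.Build K V quotm _ quotm_pi quotm_pi_linear.

End QuotientModule.

Lemma quotient_lmod (K : fieldType) (V : lmodType K) (B : set V) : subspace B ->
  exists (Q : lmodType K) (pi : {linear V -> Q}), forall v, pi v = 0 <-> B v.
Proof.
move=> sB; exists (quotm sB), (quotm_pi sB) => v; rewrite -(linear0 (quotm_pi sB)).
by split=> [/quotm_piE|Bv]; [rewrite subr0|apply/quotm_piE; rewrite subr0].
Qed.

Section BaseChange.
Variables (R : comPzRingType) (M : zmodType) (act : R -> M -> M).
Hypothesis actDr : forall a u v, act a (u + v) = act a u + act a v.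
Hypothesis actDl : forall a b u, act (a + b) u = act a u + act b u.
Hypothesis actM : forall a b u, act (a * b) u = act a (act b u).
Hypothesis act1 : forall u, act 1 u = u.

Variables (P : set R) (k : fieldType) (psi : {rmorphism R -> k}).
Hypothesis psiP : residue_field_at P psi.

Lemma act0l u : act 0 u = 0.
Proof. by apply: (addIr (act 0 u)); rewrite -actDl !add0r. Qed.

Lemma actNl a u : act (- a) u = - act a u.
Proof. by apply/eqP; rewrite -addr_eq0 -actDl addNr act0l. Qed.

Lemma act0r a : act a 0 = 0.
Proof. by apply: (addIr (act a 0)); rewrite -actDr !add0r. Qed.

Lemma act_sumr a (I : Type) (r : seq I) (Q : pred I) (F : I -> M) :
  act a (\sum_(i <- r | Q i) F i) = \sum_(i <- r | Q i) act a (F i).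
Proof. exact: (big_morph _ (actDr a) (act0r a)). Qed.

Lemma act_suml u (I : Type) (r : seq I) (Q : pred I) (F : I -> R) :
  act (\sum_(i <- r | Q i) F i) u = \sum_(i <- r | Q i) act (F i) u.
Proof. exact: (big_morph (act^~ u) (fun a b => actDl a b u) (act0l u)). Qed.

(* The submodule [P M]. *)
Inductive ker_sub : M -> Prop :=
| KerSub0 : ker_sub 0
| KerSubS p u v : psi p = 0 -> ker_sub v -> ker_sub (act p u + v).

Lemma ker_subD u v : ker_sub u -> ker_sub v -> ker_sub (u + v).
Proof.
move=> + Kv; elim=> [|p {}u w p0 _ IH]; first by rewrite add0r.
by rewrite -addrA; apply: KerSubS.
Qed.

Lemma ker_sub1 p u : psi p = 0 -> ker_sub (act p u).
Proof. by move=> p0; rewrite -[act p u]addr0; apply: KerSubS => //; exact: KerSub0. Qed.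

Lemma ker_subZ a u : ker_sub u -> ker_sub (act a u).
Proof.
elim=> [|p {}u w p0 _ IH]; first by rewrite act0r; exact: KerSub0.
by rewrite actDr -actM mulrC actM; apply: KerSubS.
Qed.

(* [K (x)_R M] as a quotient of functions [M -> K]: a formal sum of pairs [(a, m)]
   stands for the function sending [u] to the sum of the [psi a] with [m = u]. *)
Definition null_sum (z : M -> k) : Prop := exists f (s : seq (R * M)),
  [/\ psi f != 0, forall u, psi f * z u = \sum_(p <- s | p.2 == u) psi p.1 &
      ker_sub (\sum_(p <- s) act p.1 p.2)].

Lemma subspace_null_sum : subspace (V := (M -> k^o)%type : lmodType k) null_sum.
Proof.
split.
  exists 1, [::]; rewrite rmorph1 oner_neq0; split=> // [u|]; last by rewrite big_nil; exact: KerSub0.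
  by rewrite big_nil mulr0.
move=> c z z' [f [s [f0 fz sK]]] [f' [s' [f'0 fz' sK']]].
have [p [q [q0 ->]]] := psiP.2 c.
exists (f * f' * q), ([seq (f' * p * t.1, t.2) | t <- s] ++ [seq (f * q * t.1, t.2) | t <- s']).
split; first by rewrite !rmorphM !mulf_neq0.
  move=> u; rewrite big_cat !big_map /=.
  have E b (l : seq (R * M)) : \sum_(t <- l | t.2 == u) psi (b * t.1) =
      psi b * \sum_(t <- l | t.2 == u) psi t.1.
    by rewrite mulr_sumr; apply: eq_bigr => t _; rewrite rmorphM.
  rewrite !E -fz -fz' !rmorphM /= [(_ *: z + z') u]/(psi p / psi q * z u + z' u).
  have F (a b x y : k) : psi f * psi f' * psi q * (a / psi q * x + y) =
      psi f' * a * (psi f * x) + psi f * psi q * (psi f' * y) by field.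
  exact: F.
rewrite big_cat !big_map; apply: ker_subD.
  have -> : \sum_(t <- s) act (f' * p * t.1) t.2 = act (f' * p) (\sum_(t <- s) act t.1 t.2).
    by rewrite act_sumr; apply: eq_bigr => t _; rewrite actM.
  exact: ker_subZ.
have -> : \sum_(t <- s') act (f * q * t.1) t.2 = act (f * q) (\sum_(t <- s') act t.1 t.2).
  by rewrite act_sumr; apply: eq_bigr => t _; rewrite actM.
exact: ker_subZ.
Qed.

Definition point_fun (m : M) : M -> k := fun u => (u == m)%:R.

(** Collect the formal sum by vectors: the coefficient of [m] agrees with [f] under [psi], and every
    other coefficient is killed by [psi]. *)
Lemma null_point m : null_sum (point_fun m) -> exists2 f, psi f != 0 & ker_sub (act f m).
Proof.
move=> [f [s [f0 fz sK]]]; exists f => //.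
have E : \sum_(p <- s) act p.1 p.2 =
    \sum_(u <- undup [seq p.2 | p <- s]) act (\sum_(p <- s | p.2 == u) p.1) u.
  under [RHS]eq_bigr => u _ do rewrite act_suml.
  rewrite (exchange_big_dep xpredT) //= big_seq [RHS]big_seq; apply: eq_bigr => p ps.
  rewrite -big_filter (eq_filter (a2 := pred1 p.2)); last by move=> u /=; rewrite eq_sym.
  by rewrite filter_pred1_uniq ?undup_uniq ?mem_undup ?map_f // big_seq1.
have ms : m \in undup [seq p.2 | p <- s].
  rewrite mem_undup; apply: contraNT f0 => ms.
  have := fz m; rewrite /point_fun eqxx mulr1 => ->; rewrite big_seq_cond big1 // => p.
  by move=> /andP [ps /eqP pm]; move: ms; rewrite -pm map_f.
move: sK; rewrite E (bigD1_seq m) ?undup_uniq //= => sK.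
have psiE u : psi (\sum_(p <- s | p.2 == u) p.1) = psi f * (u == m)%:R.
  by rewrite rmorph_sum fz.
set A := act _ m in sK; set D := \sum_(i <- _ | _) _ in sK.
have -> : act f m = (act f m - A) + ((A + D) + - D) by rewrite addrK subrK.
apply: ker_subD; last apply: ker_subD => //.
  by rewrite -actNl -actDl; apply: ker_sub1; rewrite rmorphB psiE eqxx mulr1 subrr.
rewrite -sumrN; elim/big_rec: _ => [|u v um Kv]; first exact: KerSub0.
rewrite -actNl; apply: KerSubS => //.
by rewrite rmorphN psiE (negPf um) mulr0 oppr0.
Qed.

Variables (W : lmodType k) (j : M -> W).
Hypothesis jW : base_change act psi j.

(** The universal property gives no direct access to the kernel of [j]. It maps [W] to an explicit
    model, the functions on [M] modulo the null sums, in which the kernel can be read off. *)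
Lemma base_change_kernel m : j m = 0 -> exists2 f, psi f != 0 & ker_sub (act f m).
Proof.
move=> jm0; apply: null_point.
have [Q [pi piE]] := quotient_lmod subspace_null_sum.
have psiN : psi (- 1) = - 1 by rewrite rmorphN rmorph1.
pose cons_if (b : bool) (x y : k) := if b then x + y else y.
have sg : Defs.semilinear act psi (fun u : M => pi (point_fun u)).
  split=> [u v|a u]; apply/subr0_eq.
    rewrite -linearD -linearB; apply/piE.
    exists 1, [:: (1, u + v); (-1, u); (-1, v)]; rewrite rmorph1 oner_neq0; split=> //.
      move=> w; rewrite /= !big_cons big_nil /= mul1r ![_ == w]eq_sym psiN rmorph1.
      have F (x y z : bool) : x%:R - (y%:R + z%:R) =
        cons_if x 1 (cons_if y (-1) (cons_if z (-1) 0)) by case: x y z => [] [] [] /=; ring.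
      exact: F.
    rewrite !big_cons big_nil /= !actNl !act1 addr0 -opprD subrr; exact: KerSub0.
  rewrite -linearZ -linearB; apply/piE.
  exists 1, [:: (1, act a u); (-a, u)]; rewrite rmorph1 oner_neq0; split=> //.
    move=> w; rewrite /= !big_cons big_nil /= mul1r ![_ == w]eq_sym rmorphN rmorph1.
    have F (x y : bool) : x%:R - psi a * y%:R =
      cons_if x 1 (cons_if y (- psi a) 0) by case: x y => [] [] /=; ring.
    exact: F.
  rewrite !big_cons big_nil /= !actNl !act1 addr0 subrr; exact: KerSub0.
have [h [hj _]] := jW.2 _ _ sg.
by apply/piE; rewrite -hj jm0 linear0.
Qed.

(** The projection of [W] modulo the span of the image and the zero map both extend zero, so they
    agree by uniqueness. *)
Lemma base_change_span w : lspan setT (range j) w.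
Proof.
have [Q [pi piE]] := quotient_lmod (subspace_lspan (range j)).
have s0 : Defs.semilinear act psi (fun _ : M => 0 : Q) by split=> *; rewrite ?addr0 ?scaler0.
have [h [_ hU]] := jW.2 _ _ s0.
have pih : pi =1 h.
  apply: hU => u; apply/piE; apply: lspan1; first exact: subringT.
  by exists u.
pose z : {linear W -> Q} := \0.
have zh : z =1 h by apply: hU.
by apply/piE; rewrite pih -zh.
Qed.

End BaseChange.

Lemma common_denominator (R : comPzRingType) (P : set R) (k : fieldType)
    (psi : {rmorphism R -> k}) (I : finType) (c : I -> k) : residue_field_at P psi ->
  exists f a, psi f != 0 /\ forall i, psi (a i) = psi f * c i.
Proof.
move=> psiP; have /choice [x /choice [y xy]] i : exists a b, psi b != 0 /\ c i = psi a / psi b.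
  exact: psiP.2.
exists (\prod_i y i), (fun i => x i * \prod_(i' | i' != i) y i'); split=> [|i].
  by rewrite rmorph_prod; apply/prodf_neq0 => i _; have [] := xy i.
have [yi ->] := xy i; rewrite rmorphM !rmorph_prod [in RHS](bigD1 i) //=.
by field.
Qed.

(** * Modules that are finite over the coordinate ring *)

Section CoordinateAction.
Variables (K : fieldType) (n : nat) (N : weyl_module K n).
Implicit Types (f h : {mpoly K[n]}) (a b : 'X_{1..n}) (u v : N).

Definition xpow a u : N := powop (wx N) a u.

Lemma xpow_linear a : linear (xpow a).
Proof. by apply: powop_linear => i c u v; exact: linearP. Qed.

HB.instance Definition _ a := GRing.isLinear.Build K N N _ (xpow a) (xpow_linear a).

Lemma xpow0 u : xpow 0%MM u = u.
Proof. by apply: powop0 => i; rewrite mnm0E. Qed.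

Lemma xpowD a b u : xpow (a + b)%MM u = xpow a (xpow b u).
Proof.
rewrite /xpow -powop_add; last exact: wxC.
by apply: eq_powop => i; rewrite mnmDE.
Qed.

Definition xpact f u : N := pact xpow f u.

HB.instance Definition _ f := GRing.isLinear.Build K N N _ (xpact f)
  (pact_linear xpow_linear f).

Lemma xpact_mul f h u : xpact (f * h) u = xpact f (xpact h u).
Proof. exact: (pactM xpow_linear xpowD). Qed.

Lemma xpactAC f h u : xpact f (xpact h u) = xpact h (xpact f u).
Proof. by rewrite -!xpact_mul mulrC. Qed.

Lemma wd_xpow i a u : wd N i (xpow a u) =
  xpow a (wd N i u) + (a i)%:R *: xpow (a - U_(i))%MM u.
Proof.
rewrite /xpow wd_powx; congr (_ + _ *: _); apply: eq_powop => j.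
by rewrite mnmBE mnm1E.
Qed.

Lemma wd_xpact i f u : wd N i (xpact f u) = xpact f (wd N i u) + xpact f^`M(i) u.
Proof.
have E : xpact f^`M(i) u = \sum_(a <- msupp f) f@_a *: ((a i)%:R *: xpow (a - U_(i))%MM u).
  rewrite {1}[f]mpolyE raddf_sum /xpact pact_suml; apply: eq_bigr => a _ /=.
  by rewrite mderivZ mderivX !pactZl pactX.
rewrite E [LHS](linear_sum (wd N i)) /xpact /pact /lext -big_split; apply: eq_bigr => a _ /=.
by rewrite linearZ /= wd_xpow scalerDr.
Qed.

Lemma lspan_xpact (O : set K) (T : finType) (w : T -> N) (l : nat) u : subring O ->
  lspan O [set v | exists a t, (mdeg a <= l)%N /\ v = xpow a (w t)] u ->
  exists h : T -> {mpoly K[n]}, [/\ forall t a, O (h t)@_a,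
    forall t, (msize (h t) <= l.+1)%N & u = \sum_t xpact (h t) (w t)].
Proof.
move=> sO; elim=> [|c {}u v Oc [a [t [al ->]]] _ [h [Oh hl ->]]].
  exists (fun=> 0); split=> [t a|t|]; rewrite ?mcoeff0 ?msize0 //; first exact: subring0.
  by rewrite big1 // => t _; rewrite /xpact /pact linear0.
pose d s := (if s == t then c *: 'X_[a] else 0) : {mpoly K[n]}.
exists (fun s => d s + h s); split=> [s b|s|].
- rewrite mcoeffD; apply: (subringD sO) => //; rewrite /d; case: ifP => _.
    by rewrite mcoeffZ mcoeffX; apply: (subringM sO) => //; exact: (subring_nat sO).
  by rewrite mcoeff0; exact: subring0.
- apply: leq_trans (msizeD_le _ _) _; rewrite geq_max hl andbT /d; case: ifP => _.
    by apply: leq_trans (msizeZ_le _ _) _; rewrite msizeX.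
  by rewrite msize0.
under [RHS]eq_bigr => s _ do rewrite /xpact /pact linearD /=.
rewrite big_split /=; congr (_ + _); rewrite (bigD1 t) //= /d eqxx linearZ /= lextX.
by rewrite big1 ?addr0 // => s /negPf ->; rewrite linear0.
Qed.

Definition mnm_x (a : 'X_{1..n + n}) : 'X_{1..n} := [multinom a (lshift n i) | i < n].

Lemma monop1E (a : 'X_{1..n + n}) u : monop 1 a u =
  xpow (mnm_x a) (powop (wd N) (fun i => a (rshift n i)) u).
Proof.
rewrite /monop /xpow; set v := powop (wd N) _ u; set v' := powop (wd N) _ u.
have -> : v = v' by apply: eq_powop => i; rewrite mul1n.
by apply: eq_powop => i; rewrite mul1n mnmE.
Qed.

Lemma mdeg_mnm_x (a : 'X_{1..n + n}) : (mdeg (mnm_x a) <= mdeg a)%N.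
Proof.
rewrite !mdegE big_split_ord /=; apply: leq_trans (leq_addr _ _).
by apply: leq_sum => i _; rewrite mnmE.
Qed.

Section Finite.
Variables (r k : nat) (g : 'I_r -> N) (O : set K).
Hypothesis sO : subring O.

Notation T := ({ffun 'I_n -> 'I_k} * 'I_r)%type.
Definition gen_d (t : T) : N := powop (wd N) (fun i => t.1 i) (g t.2).

Definition rel_set (k : nat) (j : 'I_r) : set N := [set u | exists (a : 'X_{1..n + n}) t,
  ((mdeg a < k)%N \/ [/\ mdeg a = k, t = j & (order_weight a < k)%N]) /\
  u = monop 1 a (g t)].

Hypothesis rel : forall i j, lspan O (rel_set k j) (iter k (wd N i) (g j)).

Lemma iter_d_monop i u m : iter m (wd N i) u = monop 1 (U_(rshift n i) *+ m)%MM u.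
Proof.
elim: m => [|m IH]; first by rewrite mulm0n monop0.
rewrite mulmSr /= IH mon_d mulmnE mnm1E eq_rlshift mul0n scale0r addr0.
by [].
Qed.

(** The relations rewrite d_i^k through monomials of smaller degree, or of the same degree and
    smaller order. The irreducible monomials have all exponents of the d_i below [k], and the
    coefficients stay in [O]. *)
Lemma fin_gam l : gam O (range g) l `<=`
  lspan O [set v | exists a t, (mdeg a <= l)%N /\ v = xpow a (gen_d t)].
Proof.
pose lt (t t' : 'X_{1..n + n} * 'I_r) := (mdeg t.1 < mdeg t'.1)%N \/
  (mdeg t.1 = mdeg t'.1 /\ (order_weight t.1 < order_weight t'.1)%N).
have lt_wf : well_founded lt.
  (* As the order is at most the degree, deg^2 + order increases along the lexicographic
     comparison. *)
  pose mu (t : 'X_{1..n + n} * 'I_r) := (mdeg t.1 ^ 2 + order_weight t.1)%N.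
  apply: (Wf_nat.well_founded_lt_compat _ mu) => -[a i] [b j] H; apply/ssrnat.ltP; rewrite /mu /=.
  by move: H (order_weight_le a); rewrite /lt /= -!mulnn => -[?|[-> ?]]; nia.
have lt_trans s t t' : lt s t -> lt t t' -> lt s t'.
  rewrite /lt => -[?|[? ?]] [?|[? ?]]; [left|left|left|right]; lia.
have lt_add (a b : 'X_{1..n + n}) (j j' : 'I_r) i : lt (a, j) (b, j') -> lt ((a + U_(i))%MM, j) ((b + U_(i))%MM, j').
  by rewrite /lt /= !mdegDU !order_weightD => -[?|[? ?]]; [left|right]; lia.
have lt_low (a : 'X_{1..n + n}) i (j : 'I_r) : (0 < a (lshift n i))%N ->
    lt ((a - U_(lshift n i))%MM, j) ((a + U_(rshift n i))%MM, j).
  by move=> ai; left=> /=; rewrite mdegDU ltnS mdegB.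
pose std (t : 'X_{1..n + n} * 'I_r) := forall i, (t.1 (rshift n i) < k)%N.
have stdred (t : 'X_{1..n + n} * 'I_r) : ~ std t -> reducible O g lt t.
  case: t => a j /existsNP [i /negP]; rewrite -leqNgt => ki.
  have ba : (U_(rshift n i) *+ k <= a)%MM.
    apply/mnm_lepP => m; rewrite mulmnE mnm1E; case: eqVneq => [<-|_]; last by rewrite mul0n.
    by rewrite mul1n.
  refine (reducible_le sO lt_trans lt_add lt_low ba _).
  rewrite /reducible /mong -iter_d_monop; apply: lspan_mono (rel i j).
  move=> u [b [t [H ->]]]; exists (b, t) => //.
  have ok : order_weight (U_(rshift n i) *+ k)%MM = k.
    rewrite /order_weight (bigD1 i) //= mulmnE mnm1E eqxx mul1n big1 ?addn0 // => m /negPf mi.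
    by rewrite mulmnE mnm1E (inj_eq (@rshift_inj _ _)) eq_sym mi.
  by case: H => [bk|[bk _ ob]]; [left|right]; rewrite /= ?ok mdegMn mdeg1 mul1n.
move=> u /(gam_mons sO); apply: (lspan_sub sO) => {}u [a [_ [al [j _ <-] ->]]].
apply: lspan_mono (reduce sO lt_wf lt_trans stdred (a, j)) => v [[b t] [sb ltb ->]].
have bk i : (b (rshift n i) < k)%N := sb i.
exists (mnm_x b), ([ffun i => Ordinal (bk i)], t); split.
  apply: leq_trans (mdeg_mnm_x _) (leq_trans _ al).
  by case: ltb => [[-> _ //]|[/ltnW|[-> _]]].
rewrite /mong monop1E /gen_d; congr (xpow _ _).
by apply: eq_powop => i; rewrite ffunE.
Qed.

Lemma gen_d_gam t : gam setT (range g) (n * k) (gen_d t).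
Proof.
apply: lspan1; first exact: subringT.
apply: (@words_le _ _ _ _ (0 + \sum_i t.1 i)%N).
  rewrite add0n; apply: (@leq_trans (\sum_(i < n) k)); first by apply: leq_sum => i _; exact: ltnW.
  by rewrite sum_nat_const card_ord.
by apply: powop_words => [*|]; [exact: WordD|apply: Word0; exists t.2].
Qed.

Lemma xpow_gam l a u : gam setT (range g) l u -> gam setT (range g) (l + mdeg a) (xpow a u).
Proof.
move=> Gu; apply: (lspan_map (f := xpow a) (B := gam setT (range g) (l + mdeg a))) Gu.
  exact: LSpan0.
move=> c v w _ Gv Gw; apply: LSpanS => //.
by rewrite mdegE; apply: powop_words => // *; exact: WordX.
Qed.

End Finite.

Section TorsionFree.
Variables (T : finType) (w : T -> N) (S : {set T}) (F : {mpoly K[n]})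
  (A : T -> T -> {mpoly K[n]}).
Hypothesis gen_w : forall u, exists h : T -> {mpoly K[n]}, u = \sum_t xpact (h t) (w t).
Hypothesis F_w : forall t, xpact F (w t) = \sum_(s in S) xpact (A t s) (w s).
Hypothesis S_free : forall h : T -> {mpoly K[n]},
  \sum_(s in S) xpact (h s) (w s) = 0 -> forall s, s \in S -> h s = 0.
Hypothesis F_fact : forall i, (0 < i <= msize F)%N -> (i%:R : K) != 0.
Hypothesis F0 : F != 0.

Lemma xpact_F u : exists h : T -> {mpoly K[n]}, xpact F u = \sum_(s in S) xpact (h s) (w s).
Proof.
have [h ->] := gen_w u; exists (fun s => \sum_t h t * A t s).
rewrite linear_sum /=; under [RHS]eq_bigr => s _ do rewrite /xpact pact_suml.
rewrite [RHS]exchange_big /=; apply: eq_bigr => t _.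
rewrite xpactAC F_w [LHS](linear_sum (xpact (h t))); apply: eq_bigr => s _.
by rewrite -[RHS]/(xpact _ _) xpact_mul.
Qed.

(* [F] kills the torsion, which is stable under the derivations; hence so do
   the derivatives of [F], among which there is a nonzero constant. *)
Lemma torsion_free h u : h != 0 -> xpact h u = 0 -> u = 0.
Proof.
pose tor v := exists2 f, f != 0 & xpact f v = 0.
have tor_d i v : tor v -> tor (wd N i v).
  move=> [f f0 fv]; exists (f * f); first by rewrite mulf_neq0.
  (* From f v = 0 follows f (d_i v) = - f' v, and a second factor [f] kills the right-hand side. *)
  have := wd_xpact i f v; rewrite fv linear0 => /esym/eqP.
  rewrite addr_eq0 => /eqP e; rewrite xpact_mul e linearN /= xpactAC fv.
  by rewrite linear0 oppr0.
have F_tor v : tor v -> xpact F v = 0.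
  move=> [f f0 fv]; have [q Fq] := xpact_F v.
  have : \sum_(s in S) xpact (f * q s) (w s) = 0.
    under eq_bigr => s _ do rewrite xpact_mul.
    by rewrite -linear_sum -Fq /= xpactAC fv linear0.
  move/S_free => q0; rewrite Fq big1 // => s /q0 /eqP.
  by rewrite mulf_eq0 (negPf f0) /= => /eqP ->; rewrite /xpact /pact linear0.
have D_tor f : (forall v, tor v -> xpact f v = 0) ->
    forall m v, tor v -> xpact f^`M[m] v = 0.
  move=> fT m; have [d] := ubnP (mdeg m); elim: d m => // d IH m md.
  case: (eqVneq m 0%MM) => [->|]; first by rewrite mderivm0m.
  rewrite -mdeg_eq0 mdegE sum_nat_eq0 negb_forall => /existsP [i mi].
  have mi0 : (0 < m i)%N by rewrite lt0n.
  have {}IH : forall v, tor v -> xpact f^`M[(m - U_(i))%MM] v = 0.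
    by apply: IH; rewrite -ltnS -(mdegDU _ i) mnm_subK1.
  move=> v Tv; rewrite -(mnm_subK1 mi0) mderivmDm mderivmU1m.
  have := wd_xpact i f^`M[(m - U_(i))%MM] v.
  by rewrite (IH _ Tv) (IH _ (tor_d i _ Tv)) linear0 add0r => <-.
move=> h0 hu; have {h h0 hu} Tu : tor u by exists h.
(* Differentiating by the exponents of the leading monomial kills all other terms and leaves its
   coefficient times factorials, which [F_fact] keeps nonzero. *)
pose m := mlead F; pose c : K := F@_m *+ \prod_i ((m i)`!).
have FmE : F^`M[m] = c%:MP.
  apply/mpolyP => a; rewrite mcoeff_mderivm mcoeffC.
  case: (eqVneq a 0%MM) => [->|a0].
    by rewrite addm0 mulr1; congr (_ *+ _); apply: eq_bigr => i _; rewrite ffactnn.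
  rewrite mulr0 mcoeff_gt_mlead ?mul0rn // lt_neqAle lemc_addr andbT.
  by rewrite -[X in X != _]addm0 eqm_add2l eq_sym.
have c0 : c != 0.
  rewrite /c -mulr_natr mulf_neq0 ?mleadc_eq0 // natr_prod; apply/prodf_neq0 => i _.
  have : (m i <= msize F)%N.
    by rewrite -mlead_deg // ltnW // ltnS mdegE (bigD1 i) //= leq_addr.
  elim: (m i) => [|d IHd] dF; first by rewrite fact0 oner_neq0.
  by rewrite factS natrM mulf_neq0 // ?IHd ?(ltnW dF) // F_fact // dF.
have := D_tor F F_tor m u Tu; rewrite FmE /xpact (pactC xpow0) => /eqP.
by rewrite scaler_eq0 (negPf c0) /= => /eqP.
Qed.

Lemma xpact_xpow f a u : xpact f (xpow a u) = xpow a (xpact f u).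
Proof. by rewrite -!(pactX xpow a) -!/(xpact _ _) xpactAC. Qed.

Lemma xpact_lspan f c u : (msize f <= c.+1)%N ->
  lspan setT [set v | exists2 b, (mdeg b <= c)%N & v = xpow b u] (xpact f u).
Proof.
move=> fc; apply: lext_lspan => b bf; exists b => //.
by rewrite -ltnS; exact: leq_trans (msize_mdeg_lt bf) fc.
Qed.

(** Multiplication by [F] is injective, the module being torsion free, and sends the l-th step into
    polynomials of degree at most l + c on the independent generators. *)
Lemma free_upper_bound c l (I : finType) (v : I -> N) :
  (forall t s, (msize (A t s) <= c.+1)%N) -> freefam v ->
  (forall i, lspan setT [set u | exists a t, (mdeg a <= l)%N /\ u = xpow a (w t)] (v i)) ->
  (#|I| <= #|S| * 'C(l + c + n, n))%N.
Proof.
move=> Ac fv sv; pose J := ({s | s \in S} * 'X_{1..n < (l + c).+1})%type.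
have -> : (#|S| * 'C(l + c + n, n) = #|{: J}|)%N by rewrite card_prod card_bmnm card_sig.
pose y (j : J) := xpow (val j.2) (w (val j.1)).
have fFv : freefam (fun i => xpact F (v i)).
  move=> d; under eq_bigr => i _ do rewrite -linearZ /=.
  by rewrite -linear_sum /= => /(torsion_free F0)/fv.
apply: (free_lspan_card_le (w := y) (A := range y)) fFv _ _ => [u [j _ <-]|i]; first by exists j.
apply: (lspan_map (f := xpact F) (B := lspan setT (range y))) (sv i); first exact: LSpan0.
move=> d _ u _ [a [t [al ->]]] By.
apply: lspanD => //; apply: lspanZ => //; rewrite /= xpact_xpow F_w linear_sum /=.
apply: lspan_sum => s sS.
apply: (lspan_map (f := xpow a) (B := lspan setT (range y))) (xpact_lspan (w s) (Ac t s)).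
  exact: LSpan0.
move=> d' _ u' _ [b bc ->] Bu'; apply: LSpanS => //.
have bl : (mdeg (a + b)%MM < (l + c).+1)%N by rewrite mdegD ltnS leq_add.
by exists (Sub s sS, BMultinom bl) => //; rewrite /y /= xpowD.
Qed.

End TorsionFree.
End CoordinateAction.

(** * Spreading out *)

(* A module [M] over the Weyl algebra of [R], through the operators that the
   variables induce; the commutation relations are those of its fibers. *)
Record weyl_lattice (n : nat) (R : comPzRingType) := WeylLattice {
  lat :> zmodType;
  lact : R -> lat -> lat;
  lx : 'I_n -> lat -> lat;
  ld : 'I_n -> lat -> lat;
  lactDr : forall a u v, lact a (u + v) = lact a u + lact a v;
  lactDl : forall a b u, lact (a + b) u = lact a u + lact b u;
  lactM : forall a b u, lact (a * b) u = lact a (lact b u);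
  lact1 : forall u, lact 1 u = u }.

Section Lattice.
Variables (n : nat) (R : comPzRingType) (L : weyl_lattice n R).

Definition lat_generated (r : nat) (g : 'I_r -> L) : Prop :=
  forall B : set L, (forall i, B (g i)) -> B 0 ->
    (forall u v, B u -> B v -> B (u + v)) -> (forall a u, B u -> B (lact a u)) ->
    (forall i u, B u -> B (lx i u)) -> (forall i u, B u -> B (ld i u)) ->
  forall u, B u.

Record lat_fiber (P : set R) (k : fieldType) (psi : {rmorphism R -> k})
    (W : weyl_module k n) (j : L -> W) : Prop := LatFiber {
  lf_psi : residue_field_at P psi;
  lf_base : base_change (@lact n R L) psi j;
  lf_x : forall i u, j (lx i u) = wx W i (j u);
  lf_d : forall i u, j (ld i u) = wd W i (j u) }.

Inductive lat_span (B : set L) : L -> Prop :=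
| LatSpan0 : lat_span B 0
| LatSpanS a u v : B u -> lat_span B v -> lat_span B (lact a u + v).

Lemma lat_spanZ B a u : lat_span B u -> lat_span B (lact a u).
Proof.
elim=> [|b {}u w Bu _ IH]; first by rewrite (act0r (@lactDr _ _ L)); exact: LatSpan0.
by rewrite lactDr -lactM; apply: LatSpanS.
Qed.

Definition lat_pow (f : 'I_n -> L -> L) (a : 'I_n -> nat) (u : L) : L :=
  foldr (fun i => iter (a i) (f i)) u (enum 'I_n).

Definition lat_monop (a : 'X_{1..n + n}) (u : L) : L :=
  lat_pow (@lx n R L) (fun i => 1 * a (lshift n i))%N
    (lat_pow (@ld n R L) (fun i => 1 * a (rshift n i))%N u).

Section Fiber.
Variables (P : set R) (k : fieldType) (psi : {rmorphism R -> k}).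
Variables (W : weyl_module k n) (j : L -> W).
Hypothesis F : lat_fiber P psi j.

Lemma lfD u v : j (u + v) = j u + j v. Proof. exact: (lf_base F).1.1. Qed.
Lemma lfZ a u : j (lact a u) = psi a *: j u. Proof. exact: (lf_base F).1.2. Qed.
Lemma lf0 : j 0 = 0. Proof. by apply: (addIr (j 0)); rewrite -lfD !add0r. Qed.
Lemma lfN u : j (- u) = - j u.
Proof. by apply/eqP; rewrite -addr_eq0 -lfD addNr lf0. Qed.
Lemma lf_sum (I : Type) (r : seq I) (Q : pred I) (f : I -> L) :
  j (\sum_(i <- r | Q i) f i) = \sum_(i <- r | Q i) j (f i).
Proof. exact: (big_morph j lfD lf0). Qed.

Lemma lf_powx a u : j (lat_pow (@lx n R L) a u) = powop (wx W) a (j u).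
Proof.
rewrite /lat_pow /powop; elim: (enum _) => //= i s IH; rewrite -IH.
by elim: (a i) => //= m <-; rewrite (lf_x F).
Qed.

Lemma lf_powd a u : j (lat_pow (@ld n R L) a u) = powop (wd W) a (j u).
Proof.
rewrite /lat_pow /powop; elim: (enum _) => //= i s IH; rewrite -IH.
by elim: (a i) => //= m <-; rewrite (lf_d F).
Qed.

Lemma lf_monop a u : j (lat_monop a u) = monop 1 a (j u).
Proof. by rewrite /lat_monop lf_powx lf_powd. Qed.

Lemma lf_iter_d m i u : j (iter m (@ld n R L i) u) = iter m (wd W i) (j u).
Proof. by elim: m => //= m <-; rewrite (lf_d F). Qed.

Lemma lf_kernel m : j m = 0 -> exists2 f, psi f != 0 & ker_sub (@lact n R L) psi (lact f m).
Proof.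
exact: (base_change_kernel (@lactDr _ _ L) (@lactDl _ _ L) (@lactM _ _ L) (@lact1 _ _ L)
  (lf_psi F) (lf_base F)).
Qed.

Lemma lf_gam (O : set k) (r : nat) (g : 'I_r -> L) : subring O -> (forall a, O (psi a)) ->
  lat_generated g -> forall u, exists l, gam O (range (j \o g)) l (j u).
Proof.
move=> sO Opsi gen; apply: gen => [i||u v [l Gu] [l' Gv]|a u [l Gu]|i u [l Gu]|i u [l Gu]].
- by exists 0%N; apply: lspan1 => //; apply: Word0; exists i.
- by exists 0%N; rewrite lf0; exact: LSpan0.
- exists (maxn l l'); rewrite lfD; apply: lspanD.
    by apply: gam_le Gu; rewrite leq_maxl.
  by apply: gam_le Gv; rewrite leq_maxr.
- by exists l; rewrite lfZ; exact: lspanZ.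
- by exists l.+1; rewrite (lf_x F); exact: gam_x.
- by exists l.+1; rewrite (lf_d F); exact: gam_d.
Qed.

Lemma lf_gen (r : nat) (g : 'I_r -> L) : lat_generated g ->
  forall u, exists l, gam setT (range (j \o g)) l u.
Proof.
move=> gen u; have sT : subring (@setT k) := @subringT k.
elim: (base_change_span (lf_base F) u) => [|c _ v _ [w _ <-] _ [l Gv]].
  by exists 0%N; exact: LSpan0.
have [l' Gw] := lf_gam sT (fun=> Logic.I) gen w.
exists (maxn l' l); apply: lspanD.
  by apply: lspanZ => //; apply: gam_le Gw; rewrite leq_maxl.
by apply: gam_le Gv; rewrite leq_maxr.
Qed.

End Fiber.

Section Generic.
Variables (K : fieldType) (phi : {rmorphism R -> K}) (N : weyl_module K n) (j : L -> N).
Hypothesis gF : lat_fiber [set 0] phi j.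

Lemma phi_eq0 a : (phi a == 0) = (a == 0).
Proof. by apply/eqP/eqP => [/(lf_psi gF).1|->]; rewrite ?rmorph0. Qed.

Lemma generic_kernel m : j m = 0 -> exists2 f, phi f != 0 & lact f m = 0.
Proof.
move=> /(lf_kernel gF) [f f0 km]; exists f => //.
elim: km => // a u v /eqP; rewrite phi_eq0 => /eqP -> _ ->.
by rewrite (act0l (@lactDl _ _ L)) addr0.
Qed.

(** Denominators are cleared in [N]; the two lifts then differ by an element of the kernel of [j],
    which a nonzero scalar kills. *)
Lemma spread_span (B : set L) m : lspan setT (j @` B) (j m) ->
  exists2 f, phi f != 0 & lat_span B (lact f m).
Proof.
move=> Bm; suff [f [m' [f0 Bm' E]]] : exists f m', [/\ phi f != 0, lat_span B m' & phi f *: j m = j m'].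
  have /generic_kernel [h h0 hm] : j (lact f m - m') = 0.
    by rewrite (lfD gF) (lfN gF) (lfZ gF) E subrr.
  exists (h * f); first by rewrite rmorphM mulf_neq0.
  rewrite lactM; have -> : lact f m = (lact f m - m') + m' by rewrite subrK.
  by rewrite lactDr hm add0r; exact: lat_spanZ.
elim: Bm => [|c _ v _ [b Bb <-] _ [f [m' [f0 Bm' E]]]].
  by exists 1, 0; rewrite rmorph1 oner_neq0 scaler0 (lf0 gF); split=> //; exact: LatSpan0.
have [x [y [y0 ->]]] := (lf_psi gF).2 c.
exists (y * f), (lact (f * x) b + lact y m'); split.
- by rewrite rmorphM mulf_neq0.
- by apply: LatSpanS => //; exact: lat_spanZ.
rewrite (lfD gF) !(lfZ gF) -E !rmorphM scalerDr !scalerA; congr (_ *: _ + _).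
by field.
Qed.

Section Specialization.
Variables (P : set R) (k : fieldType) (psi : {rmorphism R -> k}).
Variables (W : weyl_module k n) (jW : L -> W).
Hypothesis F : lat_fiber P psi jW.

(* The graph of the residue map of the localization of [R] at the kernel of [psi]. *)
Definition spec (c : K) (c' : k) : Prop :=
  exists a b, [/\ psi b != 0, c = phi a / phi b & c' = psi a / psi b].

Lemma psi_neq0 b : psi b != 0 -> phi b != 0.
Proof. by apply: contraNN; rewrite phi_eq0 => /eqP ->; rewrite rmorph0. Qed.

Lemma spec_fun c c1 c2 : spec c c1 -> spec c c2 -> c1 = c2.
Proof.
move=> [a [b [b0 -> ->]]] [a' [b' [b'0 E ->]]].
have b1 := psi_neq0 b0; have b2 := psi_neq0 b'0.
have /eqP : phi (a * b') = phi (a' * b).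
  by rewrite !rmorphM -(divfK b2 (phi a')) -E; field.
rewrite -subr_eq0 -rmorphB phi_eq0 subr_eq0 => /eqP ab.
apply: (mulIf b0); apply: (mulIf b'0).
by rewrite divfK // mulrAC divfK // -!rmorphM ab.
Qed.

Lemma spec_R a : spec (phi a) (psi a).
Proof. by exists a, 1; rewrite !rmorph1 !divr1 oner_neq0. Qed.

Lemma spec_inv a : psi a != 0 -> spec (phi a)^-1 (psi a)^-1.
Proof. by move=> a0; exists 1, a; rewrite !rmorph1 !mul1r. Qed.

Lemma specD c c' d d' : spec c c' -> spec d d' -> spec (c + d) (c' + d').
Proof.
move=> [a [b [b0 -> ->]]] [x [y [y0 -> ->]]].
have b1 := psi_neq0 b0; have y1 := psi_neq0 y0.
exists (a * y + x * b), (b * y); rewrite !rmorphD !rmorphM /=; split.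
- by rewrite mulf_neq0.
- by field; rewrite b1 y1.
- by field; rewrite b0 y0.
Qed.

Lemma specM c c' d d' : spec c c' -> spec d d' -> spec (c * d) (c' * d').
Proof.
move=> [a [b [b0 -> ->]]] [x [y [y0 -> ->]]].
have b1 := psi_neq0 b0; have y1 := psi_neq0 y0.
exists (a * x), (b * y); rewrite !rmorphM /=; split.
- by rewrite mulf_neq0.
- by field; rewrite b1 y1.
- by field; rewrite b0 y0.
Qed.

Lemma spec0 : spec 0 0. Proof. by have := spec_R 0; rewrite !rmorph0. Qed.

Lemma specN c c' : spec c c' -> spec (- c) (- c').
Proof.
by move=> cc; rewrite -mulN1r -[- c']mulN1r; apply: specM => //;
  have := spec_R (-1); rewrite !rmorphN !rmorph1.
Qed.

Definition local_ring : set K := [set c | exists c', spec c c'].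

Lemma subring_local : subring local_ring.
Proof.
split=> [|a b [a' sa] [b' sb]|a b [a' sa] [b' sb]].
- by exists 1; have := spec_R 1; rewrite !rmorph1.
- by exists (a' - b'); apply/specD/specN.
- by exists (a' * b'); apply: specM.
Qed.

Lemma local_R a : local_ring (phi a). Proof. by exists (psi a); exact: spec_R. Qed.

(** [f] becomes a unit of the local ring. A single relation in the lattice thus holds over this ring
    in [N] and, by the next lemma, in the fiber. *)
Lemma lat_span_generic (B : set L) f m : psi f != 0 -> lat_span B (lact f m) ->
  lspan local_ring (j @` B) (j m).
Proof.
move=> f0 Bm; have f1 := psi_neq0 f0.
have -> : j m = (phi f)^-1 *: j (lact f m) by rewrite (lfZ gF) scalerA mulVf ?scale1r.
apply: (lspanZ subring_local); first by exists (psi f)^-1; exact: spec_inv.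
elim: Bm => [|a u v Bu _ IH]; first by rewrite (lf0 gF); exact: LSpan0.
by rewrite (lfD gF) (lfZ gF); apply: LSpanS => //; exact: local_R.
Qed.

Lemma lat_span_fiber (B : set L) f m : psi f != 0 -> lat_span B (lact f m) ->
  lspan setT (jW @` B) (jW m).
Proof.
move=> f0 Bm; have -> : jW m = (psi f)^-1 *: jW (lact f m) by rewrite (lfZ F) scalerA mulVf ?scale1r.
apply: lspanZ => //; elim: Bm => [|a u v Bu _ IH]; first by rewrite (lf0 F); exact: LSpan0.
by rewrite (lfD F) (lfZ F); apply: LSpanS => //; exists u.
Qed.

Definition specp (m : nat) (f : {mpoly K[m]}) (f' : {mpoly k[m]}) : Prop :=
  forall a, spec f@_a f'@_a.

Lemma specp_fun m (f : {mpoly K[m]}) f1 f2 : specp f f1 -> specp f f2 -> f1 = f2.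
Proof. by move=> s1 s2; apply/mpolyP => a; apply: spec_fun (s1 a) (s2 a). Qed.

Lemma specp0 m : specp (0 : {mpoly K[m]}) 0.
Proof. by move=> a; rewrite !mcoeff0; exact: spec0. Qed.

Lemma specpD m (f h : {mpoly K[m]}) f' h' :
  specp f f' -> specp h h' -> specp (f + h) (f' + h').
Proof. by move=> sf sh a; rewrite !mcoeffD; exact: specD. Qed.

Lemma specp_sum m (I : Type) (r : seq I) (Q : pred I) (f : I -> {mpoly K[m]}) f' :
  (forall i, Q i -> specp (f i) (f' i)) ->
  specp (\sum_(i <- r | Q i) f i) (\sum_(i <- r | Q i) f' i).
Proof. by move=> sf; apply: big_ind2 => //; [exact: specp0|move=> *; exact: specpD]. Qed.

Lemma specpM m (f h : {mpoly K[m]}) f' h' :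
  specp f f' -> specp h h' -> specp (f * h) (f' * h').
Proof.
move=> sf sh a; rewrite !mcoeffM; apply: big_ind2 => // [|*|*]; first exact: spec0.
  exact: specD.
exact: specM.
Qed.

Lemma specpZ m c c' (f : {mpoly K[m]}) f' : spec c c' -> specp f f' ->
  specp (c *: f) (c' *: f').
Proof. by move=> sc sf a; rewrite !mcoeffZ; exact: specM. Qed.

Lemma specpX m a : specp ('X_[a] : {mpoly K[m]}) 'X_[a].
Proof.
by move=> b; rewrite !mcoeffX; have := spec_R (a == b)%:R; rewrite !rmorph_nat.
Qed.

End Specialization.
End Generic.
End Lattice.

(** Used with P = 0 for the rank over the coordinate ring, and with the prime of a point for the
    rank over the center. *)
Lemma max_independent (K : fieldType) (V : lmodType K) (m : nat)
    (phi : 'X_{1..m} -> V -> V) (P : set {mpoly K[m]}) (T : finType) (w : T -> V) :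
  (forall a, linear (phi a)) -> (forall a b u, phi (a + b)%MM u = phi a (phi b u)) ->
  prime_ideal P -> (forall f t, P f -> pact phi f (w t) = 0) ->
  exists (S : {set T}) (F : {mpoly K[m]}) (A : T -> T -> {mpoly K[m]}),
  [/\ ~ P F, forall h : T -> {mpoly K[m]}, \sum_(s in S) pact phi (h s) (w s) = 0 ->
        forall s, s \in S -> P (h s) &
      forall t, pact phi F (w t) = \sum_(s in S) pact phi (A t s) (w s)].
Proof.
move=> phi_lin phiD [_ _ P1 PP] Pw.
pose free (S : {set T}) := `[< forall h : T -> {mpoly K[m]},
  \sum_(s in S) pact phi (h s) (w s) = 0 -> forall s, s \in S -> P (h s) >].
have free0 : free finset.set0 by apply/asboolP => h _ s; rewrite finset.inE.
have [S /maxsetP [/asboolP Sfree Smax] _] := maxset_exists free0.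
have /choice [f fP] t : exists f : {mpoly K[m]} * (T -> {mpoly K[m]}),
    ~ P f.1 /\ pact phi f.1 (w t) = \sum_(s in S) pact phi (f.2 s) (w s).
  have [tS|tS] := boolP (t \in S).
    exists (1, fun s => (s == t)%:R); split=> //=.
    rewrite (bigD1 t) //= eqxx big1 ?addr0 // => s /andP [_ /negPf ->].
    exact: pact0l.
  have nf : ~ free (t |: S)%SET.
    move=> /Smax /(_ (finset.subsetU1 _ _)) /finset.setP /(_ t).
    by rewrite finset.inE finset.set11 (negPf tS).
  have /existsNP [h /not_implyP [hE]] : ~ forall h : T -> {mpoly K[m]},
      \sum_(s in (t |: S)%SET) pact phi (h s) (w s) = 0 -> forall s, s \in (t |: S)%SET -> P (h s).
    by move=> fr; apply: nf; apply/asboolP.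
  move: hE; rewrite big_setU1 //= => /eqP; rewrite addr_eq0 => /eqP ht /existsNP [s] /not_implyP [sS hs].
  exists (h t, fun s => - h s) => /=; split; last first.
    by rewrite ht -sumrN; apply: eq_bigr => i _; rewrite /pact linearN.
  (* If [h t] were in [P], its term would vanish, and independence of [S] would put all the
     coefficients in [P]. *)
  move=> Pht; apply: (hs); move: sS; rewrite finset.in_setU1 => /orP [/eqP -> //|].
  by apply: Sfree; move/eqP: ht; rewrite Pw // eq_sym oppr_eq0 => /eqP.
exists S, (\prod_t (f t).1), (fun t s => (\prod_(t' | t' != t) (f t').1) * (f t).2 s).
split=> // [|t].
  by apply: (big_ind (fun x => ~ P x)) => [//|x y nx ny /PP [] //|t _]; have [] := fP t.
rewrite (bigD1 t) //= mulrC (pactM phi_lin phiD) (fP t).2 (linear_sum (pact phi _ : {linear V -> V})).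
by apply: eq_bigr => s _; rewrite (pactM phi_lin phiD).
Qed.

Lemma prime_ideal0 (R : idomainType) : prime_ideal [set (0 : R)].
Proof.
split=> [|f g ->|/eqP|f g /eqP]; first by split=> // f g -> ->; rewrite addr0.
- by rewrite /= mulr0.
- by rewrite oner_eq0.
- by rewrite mulf_eq0 => /orP [/eqP|/eqP]; [left|right].
Qed.

(* A relation in the fiber lifts to one over the local ring of [R], up to the
   maximal ideal; after multiplying by [f] one may compare coefficients in [K]. *)
Section Independence.
Variables (n : nat) (R : comPzRingType) (L : weyl_lattice n R).
Variables (K : fieldType) (phi : {rmorphism R -> K}) (N : weyl_module K n) (j : L -> N).
Hypothesis gF : lat_fiber [set 0] phi j.
Variables (P : set R) (k : fieldType) (psi : {rmorphism R -> k}).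
Variables (W : weyl_module k n) (jW : L -> W).
Hypothesis F : lat_fiber P psi jW.

Notation spec := (spec phi psi).
Notation specp := (specp phi psi).

Variables (T : finType) (w : T -> L) (S : {set T}).
Variables (f : {mpoly K[n]}) (A : T -> T -> {mpoly K[n]}).
Variables (fW : {mpoly k[n]}) (AW : T -> T -> {mpoly k[n]}).
Hypothesis S_free : forall h : T -> {mpoly K[n]},
  \sum_(s in S) xpact (h s) (j (w s)) = 0 -> forall s, s \in S -> h s = 0.
Hypothesis f_w : forall t, xpact f (j (w t)) = \sum_(s in S) xpact (A t s) (j (w s)).
Hypothesis f_spec : specp f fW.
Hypothesis A_spec : forall t s, specp (A t s) (AW t s).
Hypothesis fW0 : fW != 0.
Hypothesis local_span : forall m, lspan (local_ring phi psi)
  [set v | exists a t, v = xpow a (j (w t))] (j m).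

Lemma f_local v : lspan (local_ring phi psi) [set v | exists a t, v = xpow a (j (w t))] v ->
  exists q q', (forall s, specp (q s) (q' s)) /\
    xpact f v = \sum_(s in S) xpact (q s) (j (w s)).
Proof.
elim=> [|c _ {}v [c' cc] [a [t ->]] _ [q [q' [qq E]]]].
  exists (fun=> 0), (fun=> 0); split=> [s|]; first exact: specp0.
  by rewrite linear0 big1 // => s _; rewrite /xpact pact0l.
exists (fun s => c *: ('X_[a] * A t s) + q s), (fun s => c' *: ('X_[a] * AW t s) + q' s).
split=> [s|].
  by apply: (specpD gF) => //; apply: (specpZ gF) => //; apply: (specpM gF) => //; exact: specpX.
rewrite linearP /= E xpact_xpow f_w linear_sum /= scaler_sumr -big_split /=.
apply: eq_bigr => s _; rewrite -(pactX (xpow (N := N))) -/(xpact _ _) -xpact_mul.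
by rewrite /xpact pactDl pactZl.
Qed.

Lemma f_ker m : ker_sub (@lact n R L) psi m -> exists q, (forall s, specp (q s) 0) /\
  xpact f (j m) = \sum_(s in S) xpact (q s) (j (w s)).
Proof.
elim=> [|p u v p0 _ [q [q0 E]]].
  exists (fun=> 0); split=> [s|]; first exact: specp0.
  by rewrite (lf0 gF) linear0 big1 // => s _; rewrite /xpact pact0l.
have [h [h' [hh' Eu]]] := f_local (local_span u).
exists (fun s => phi p *: h s + q s); split=> [s|].
  have -> : 0 = psi p *: h' s + 0 :> {mpoly k[n]} by rewrite p0 scale0r addr0.
  by apply: (specpD gF) => //; apply: (specpZ gF) => //; exact: spec_R.
rewrite (lfD gF) (lfZ gF) linearP /= E Eu scaler_sumr -big_split /=.
by apply: eq_bigr => s _; rewrite /xpact pactDl pactZl.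
Qed.

Lemma fiber_independent (h : T -> {mpoly k[n]}) :
  \sum_(s in S) xpact (h s) (jW (w s)) = 0 -> forall s, s \in S -> h s = 0.
Proof.
move=> h0; pose l := \max_t msize (h t).
have hl t : (msize (h t) <= l)%N by rewrite /l (leq_bigmax t).
have [b [e [b0 eE]]] := common_denominator (fun i : T * 'X_{1..n < l} => (h i.1)@_i.2) (lf_psi F).
pose lxp (a : 'X_{1..n}) u := lat_pow (@lx n R L) a u.
pose m := \sum_(s in S) \sum_(a : 'X_{1..n < l}) lact (e (s, a)) (lxp a (w s)).
have : jW m = 0.
  have -> : 0 = psi b *: \sum_(s in S) xpact (h s) (jW (w s)) by rewrite h0 scaler0.
  rewrite (lf_sum F) scaler_sumr; apply: eq_bigr => s _.
  rewrite (lf_sum F) /xpact /pact (lextE _ (hl s)) scaler_sumr; apply: eq_bigr => a _.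
  by rewrite (lfZ F) (lf_powx F) eE scalerA.
move=> /(lf_kernel F) [c c0 /f_ker [q [q0]]].
pose es s := \sum_(a : 'X_{1..n < l}) phi (e (s, a)) *: 'X_[a] : {mpoly K[n]}.
have es_spec s : specp (es s) (psi b *: h s).
  have -> : psi b *: h s = \sum_(a : 'X_{1..n < l}) psi (e (s, a)) *: 'X_[a].
    rewrite [in LHS](mpolywE (hl s)) scaler_sumr; apply: eq_bigr => a _.
    by rewrite scalerA eE.
  apply: (specp_sum gF) => a _; apply: (specpZ gF); [exact: spec_R|exact: specpX].
have -> : j (lact c m) = phi c *: \sum_(s in S) xpact (es s) (j (w s)).
  rewrite (lfZ gF) (lf_sum gF); congr (_ *: _); apply: eq_bigr => s _.
  rewrite (lf_sum gF) /xpact /es pact_suml; apply: eq_bigr => a _.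
  by rewrite (lfZ gF) (lf_powx gF) pactZl pactX.
rewrite linearZ /= (linear_sum (xpact f)) /= scaler_sumr => E s sS.
have : \sum_(s in S) xpact (phi c *: (f * es s) - q s) (j (w s)) = 0.
  rewrite (eq_bigr (fun s => phi c *: xpact f (xpact (es s) (j (w s))) - xpact (q s) (j (w s)))).
    by rewrite sumrB E subrr.
  by move=> t _; rewrite /xpact pactBl pactZl -!/(xpact _ _) xpact_mul.
move=> /S_free /(_ s sS) /subr0_eq qE.
(* [q s] specializes to 0 and also to a multiple of [fW * h s] by nonzero scalars; specializations
   are unique. *)
have : specp (q s) (psi c *: (fW * (psi b *: h s))).
  by rewrite -qE; apply: (specpZ gF); [exact: spec_R|apply: (specpM gF)].
move=> /(specp_fun gF (q0 s)) /esym/eqP.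
by rewrite -scalerAr !scaler_eq0 (negPf c0) (negPf b0) mulf_eq0 (negPf fW0) /= => /eqP.
Qed.

End Independence.

Section PolynomialSpread.
Variables (n l : nat) (R : comPzRingType) (L : weyl_lattice n R).
Implicit Type c : 'X_{1..n < l} -> R.

Definition poly_of (k : fieldType) (psi : R -> k) c : {mpoly k[n]} :=
  \sum_(b : 'X_{1..n < l}) psi (c b) *: 'X_[b].

Definition lat_poly c (u : L) : L :=
  \sum_(b : 'X_{1..n < l}) lact (c b) (lat_pow (@lx n R L) (b : 'X_{1..n}) u).

Lemma msize_poly_of (k : fieldType) (psi : R -> k) c : (msize (poly_of psi c) <= l)%N.
Proof.
apply: leq_trans (msize_sum _ _ _) _; apply/bigmax_leqP => b _.
apply: leq_trans (msizeZ_le _ _) _; rewrite msizeX; exact: bmdeg.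
Qed.

Lemma poly_of_neq0 (k : fieldType) (psi : R -> k) c b : psi (c b) != 0 -> poly_of psi c != 0.
Proof.
apply: contraNneq => /(congr1 (mcoeff b)).
by rewrite mcoeff0 /poly_of mcoeff_lincomb // => [->|]; last exact: val_inj.
Qed.

Lemma lf_poly (P : set R) (k : fieldType) (psi : {rmorphism R -> k}) (W : weyl_module k n)
    (j : L -> W) c u : lat_fiber P psi j -> j (lat_poly c u) = xpact (poly_of psi c) (j u).
Proof.
move=> F; rewrite (lf_sum F) /xpact /poly_of pact_suml; apply: eq_bigr => b _.
by rewrite (lfZ F) (lf_powx F) pactZl pactX.
Qed.

End PolynomialSpread.

Section Core.
Variables (n : nat) (R : comPzRingType) (L : weyl_lattice n R).
Variables (K : fieldType) (phi : {rmorphism R -> K}) (N : weyl_module K n) (j : L -> N).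
Hypothesis gF : lat_fiber [set 0] phi j.
Hypothesis char0 : forall i : nat, (i.+1)%:R != 0 :> K.
Variables (r k : nat) (g : 'I_r -> L).
Hypothesis gen : lat_generated g.
Hypothesis rel : forall i t, lspan setT (rel_set (j \o g) k t) (iter k (wd N i) (j (g t))).

Notation T := ({ffun 'I_n -> 'I_k} * 'I_r)%type.
Definition lat_gen (t : T) : L := lat_pow (@ld n R L) (fun i => t.1 i) (g t.2).

Lemma lf_lat_gen (P : set R) (F : fieldType) (psi : {rmorphism R -> F}) (W : weyl_module F n)
    (jW : L -> W) t : lat_fiber P psi jW -> jW (lat_gen t) = gen_d (jW \o g) t.
Proof. by move=> FW; rewrite (lf_powd FW). Qed.

Definition lat_rel (t : 'I_r) : set L := [set u | exists (a : 'X_{1..n + n}) s,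
  ((mdeg a < k)%N \/ [/\ mdeg a = k, s = t & (order_weight a < k)%N]) /\
  u = lat_monop a (g s)].

Lemma lat_rel_sub (P : set R) (F : fieldType) (psi : {rmorphism R -> F}) (W : weyl_module F n)
    (jW : L -> W) t : lat_fiber P psi jW -> jW @` lat_rel t `<=` rel_set (jW \o g) k t.
Proof.
by move=> FW _ [_ [a [s [H ->]]] <-]; exists a, s; rewrite (lf_monop FW).
Qed.

Lemma spread_rel : exists f : 'I_n * 'I_r -> R, forall x, phi (f x) != 0 /\
  lat_span (lat_rel x.2) (lact (f x) (iter k (@ld n R L x.1) (g x.2))).
Proof.
suff /choice [f fP] x : exists f, phi f != 0 /\
    lat_span (lat_rel x.2) (lact f (iter k (@ld n R L x.1) (g x.2))) by exists f.
suff /(spread_span gF) [f f0 fP] :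
  lspan setT (j @` lat_rel x.2) (j (iter k (@ld n R L x.1) (g x.2))) by exists f.
rewrite (lf_iter_d gF); apply: lspan_mono (rel x.1 x.2) => _ [a [s [H ->]]].
by exists (lat_monop a (g s)); [exists a, s|rewrite (lf_monop gF)].
Qed.

(** The relations between the generators are known only in the generic fiber; the factors [f t]
    absorb the torsion of the lattice. *)
Lemma spread_independent : exists (S : {set T}) (l : nat) (b : 'X_{1..n < l.+1})
    (cF : 'X_{1..n < l.+1} -> R) (cA : T -> T -> 'X_{1..n < l.+1} -> R) (f : T -> R),
  [/\ forall h : T -> {mpoly K[n]}, \sum_(s in S) xpact (h s) (j (lat_gen s)) = 0 ->
        forall s, s \in S -> h s = 0,
      phi (cF b) != 0, forall t, phi (f t) != 0 &
      forall t, lact (f t) (lat_poly cF (lat_gen t)) =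
        lact (f t) (\sum_(s in S) lat_poly (cA t s) (lat_gen s))].
Proof.
have [f t ->|S [F [A [/eqP F0 Sfree FA]]]] := max_independent (w := fun t => j (lat_gen t))
  (@xpow_linear _ _ N) (@xpowD _ _ N) (@prime_ideal0 {mpoly K[n]}).
  exact: pact0l.
pose l := (msize F + \max_t \max_s msize (A t s))%N.
have Fl : (msize F <= l.+1)%N by apply: leqW; exact: leq_addr.
have Al t s : (msize (A t s) <= l.+1)%N.
  apply: leqW; apply: leq_trans (leq_addl _ _).
  by apply: leq_trans (leq_bigmax t); exact: leq_bigmax s.
pose I := ('X_{1..n < l.+1} + T * T * 'X_{1..n < l.+1})%type.
pose c (i : I) := match i with inl b => F@_b | inr (t, s, b) => (A t s)@_b end.
have [d [e [d0 eE]]] := common_denominator c (lf_psi gF).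
pose cF b := e (inl b); pose cA t s b := e (inr (t, s, b)).
have cFE : poly_of phi cF = phi d *: F.
  rewrite [in RHS](mpolywE Fl) scaler_sumr; apply: eq_bigr => b _.
  by rewrite scalerA eE.
have cAE t s : poly_of phi (cA t s) = phi d *: A t s.
  rewrite [in RHS](mpolywE (Al t s)) scaler_sumr; apply: eq_bigr => b _.
  by rewrite scalerA eE.
have lb : (mdeg (mlead F) < l.+1)%N by rewrite mlead_deg // (leq_trans _ Fl).
have /choice [f fP] t : exists f, phi f != 0 /\ lact f (lat_poly cF (lat_gen t)) =
    lact f (\sum_(s in S) lat_poly (cA t s) (lat_gen s)).
  have /(generic_kernel gF) [f f0] :
      j (lat_poly cF (lat_gen t) - \sum_(s in S) lat_poly (cA t s) (lat_gen s)) = 0.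
    rewrite (lfD gF) (lfN gF) (lf_sum gF) (lf_poly _ _ gF) cFE.
    under eq_bigr => s _ do rewrite (lf_poly _ _ gF) cAE /xpact pactZl.
    by rewrite -scaler_sumr /xpact pactZl FA subrr.
  move=> fP; exists f; split=> //; apply/eqP; rewrite -subr_eq0; apply/eqP.
  rewrite -[RHS]fP (lactDr f); congr (_ + _); apply/eqP.
  by rewrite eq_sym -subr_eq0 opprK -(lactDr f) addNr (act0r (@lactDr _ _ L)).
exists S, l, (BMultinom lb), cF, cA, f; split=> [//||t|t]; try by have [] := fP t.
by rewrite eE /= mulf_neq0 // mleadc_eq0.
Qed.

Theorem spreading : exists (f0 : R) (rho c : nat), [/\ phi f0 != 0,
  forall l, exists (I : finType) (v : I -> N), [/\ freefam v, #|I| = (rho * 'C(l + n, n))%N &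
    forall i, gam setT (range (j \o g)) (l + n * k) (v i)] &
  forall (P : set R) (F : fieldType) (psi : {rmorphism R -> F}) (W : weyl_module F n)
    (jW : L -> W), lat_fiber P psi jW -> psi f0 != 0 ->
    (forall h (u : W), h != 0 -> xpact h u = 0 -> u = 0) /\
    forall l (I : finType) (v : I -> W), freefam v ->
      (forall i, gam setT (range (jW \o g)) l (v i)) -> (#|I| <= rho * 'C(l + c + n, n))%N].
Proof.
have [f1 f1P] := spread_rel.
have [S [l0 [b [cF [cA [f2 [Sfree cF0 f2P E]]]]]]] := spread_independent.
(* The factors keep, in order: the finiteness relations, the relations to the generators in [S], a
   nonzero coefficient of the multiplier [cF], and a characteristic larger than its degree, as
   [torsion_free] requires. *)
exists ((\prod_x f1 x) * (\prod_t f2 t) * cF b * (l0.+1)`!%:R), #|S|, l0; split.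
- rewrite !rmorphM !rmorph_prod rmorph_nat !mulf_neq0 //.
  + by apply/prodf_neq0 => x _; have [] := f1P x.
  + by apply/prodf_neq0.
  + by move: (fact_gt0 l0.+1); case: (_`!) => [|m _] //; exact: char0.
(* The monomials in the coordinates applied to the independent generators. The shift n k comes from
   the exponents below [k] of the d_i in these generators. *)
- move=> l; pose I := ({s in S} * 'X_{1..n < l.+1})%type.
  exists I, (fun i : I => xpow (i.2 : 'X_{1..n}) (j (lat_gen (val i.1)))).
  split; last first.
  + move=> [s [a al]] /=; apply: (@gam_le _ _ _ _ _ (n * k + mdeg a)%N).
      by rewrite addnC leq_add2r -ltnS.
    by rewrite (lf_lat_gen _ gF); apply/xpow_gam/gen_d_gam.
  + by rewrite card_prod card_bmnm card_sig.
  + move=> c c0 [s a].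
    pose h t := if insub t is Some s' then \sum_(a : 'X_{1..n < l.+1}) c (s', a) *: 'X_[a] else 0 : {mpoly K[n]}.
    have hs : h (val s) = 0.
      apply: Sfree (valP s); rewrite big_sub.
      pose G (s' : {x in S}) (a' : 'X_{1..n < l.+1}) :=
        c (s', a') *: xpow (a' : 'X_{1..n}) (j (lat_gen (val s'))).
      transitivity (\sum_s' \sum_a' G s' a').
        apply: eq_bigr => s' _; rewrite /h valK /xpact pact_suml; apply: eq_bigr => a' _.
        by rewrite pactZl pactX.
      by rewrite pair_bigA -[RHS]c0; apply: eq_bigr => -[s' a'].
    move: hs; rewrite /h valK => /(congr1 (mcoeff a)).
    by rewrite mcoeff0 mcoeff_lincomb //; exact: val_inj.
move=> P F psi W jW FW; rewrite !rmorphM !rmorph_prod rmorph_nat.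
rewrite mulf_eq0 negb_or => /andP []; rewrite mulf_eq0 negb_or => /andP [].
rewrite mulf_eq0 negb_or => /andP [/prodf_neq0 f1W /prodf_neq0 f2W cFW factW].
have relW i t : lspan setT (rel_set (jW \o g) k t) (iter k (wd W i) (jW (g t))).
  apply: lspan_mono (lat_rel_sub FW) _ _; rewrite -(lf_iter_d FW).
  exact: (lat_span_fiber FW (f1W (i, t) isT) (f1P (i, t)).2).
have relO i t : lspan (local_ring phi psi) (rel_set (j \o g) k t) (iter k (wd N i) (j (g t))).
  apply: lspan_mono (lat_rel_sub gF) _ _; rewrite -(lf_iter_d gF).
  exact: (lat_span_generic gF (f1W (i, t) isT) (f1P (i, t)).2).
have localO m : lspan (local_ring phi psi)
    [set v | exists a t, v = xpow a (j (lat_gen t))] (j m).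
  have [l Gm] := lf_gam gF (subring_local gF psi) (local_R phi psi) gen m.
  apply: lspan_mono (fin_gam (subring_local gF psi) relO Gm) => _ [a [t [_ ->]]].
  by exists a, t; rewrite (lf_lat_gen _ gF).
have gamW l u : gam setT (range (jW \o g)) l u ->
    lspan setT [set v | exists a t, (mdeg a <= l)%N /\ v = xpow a (jW (lat_gen t))] u.
  move=> /(fin_gam (@subringT F) relW); apply: lspan_mono => _ [a [t [al ->]]].
  by exists a, t; rewrite (lf_lat_gen _ FW).
have gen_w u : exists h : T -> {mpoly F[n]}, u = \sum_t xpact (h t) (jW (lat_gen t)).
  have [l /gamW /(lspan_xpact (@subringT F)) [h [_ _ ->]]] := lf_gen FW gen u.
  by exists h.
have F_w (P' : set R) (F' : fieldType) (psi' : {rmorphism R -> F'}) (W' : weyl_module F' n)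
    (j' : L -> W') : lat_fiber P' psi' j' -> (forall t, psi' (f2 t) != 0) ->
    forall t, xpact (poly_of psi' cF) (j' (lat_gen t)) =
      \sum_(s in S) xpact (poly_of psi' (cA t s)) (j' (lat_gen s)).
  move=> F'W f2' t; apply: (scalerI (f2' t)); rewrite -(lf_poly _ _ F'W) -(lfZ F'W) E.
  rewrite (lfZ F'W) (lf_sum F'W); congr (_ *: _); apply: eq_bigr => s _.
  exact: (lf_poly _ _ F'W).
have spec_poly c : specp phi psi (poly_of phi c) (poly_of psi c : {mpoly F[n]}).
  apply: (specp_sum gF) => b' _; apply: (specpZ gF); [exact: spec_R|exact: specpX].
have cF_neq0 := poly_of_neq0 cFW.
have S_free := fiber_independent gF FW Sfree (F_w _ _ _ _ _ gF f2P) (spec_poly _ _)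
  (fun t s => spec_poly _ (cA t s)) cF_neq0 localO.
have F_fact i : (0 < i <= msize (poly_of psi cF))%N -> (i%:R : F) != 0.
  move=> /andP [i0 il]; apply: contraNneq factW => i0F.
  have /dvdnP [q ->] : (i %| (l0.+1)`!)%N.
    by rewrite dvdn_fact // i0 (leq_trans il) // msize_poly_of.
  by rewrite natrM i0F mulr0.
have FWw := F_w _ _ _ _ _ FW (fun t => f2W t isT).
split; first by move=> h u; apply: (torsion_free gen_w FWw S_free F_fact cF_neq0).
move=> l I v fv Gv.
apply: (free_upper_bound gen_w FWw S_free F_fact cF_neq0 _ fv) => [t s|i].
  exact: msize_poly_of.
exact: gamW (Gv i).
Qed.

End Core.

Section TwistLattice.
Variables (n : nat) (R : comPzRingType) (L : weyl_lattice n R) (s : 'I_n -> 'I_n -> nat).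

(** With natural entries of [s], the change of coordinates acts on the lattice, hence on all fibers
    at once. *)
Definition lat_twist_x (i : 'I_n) (u : L) : L := lx i u - \sum_m ld m u *+ s i m.

Definition lat_twist : weyl_lattice n R := @WeylLattice n R L (@lact n R L) lat_twist_x
  (@ld n R L) (@lactDr n R L) (@lactDl n R L) (@lactM n R L) (@lact1 n R L).

Lemma lat_twist_generated (r : nat) (g : 'I_r -> L) : lat_generated g ->
  lat_generated (L := lat_twist) g.
Proof.
move=> gen B Bg B0 BD BZ BX Bd; apply: gen => // i u Bu.
have -> : lx i u = lat_twist_x i u + \sum_m ld m u *+ s i m by rewrite subrK.
apply: (BD); first exact: BX.
apply: (big_ind B) => // m _; elim: (s i m) => [|c IH]; first by rewrite mulr0n.
by rewrite mulrS; apply: (BD) => //; exact: Bd.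
Qed.

Lemma lat_twist_fiber (P : set R) (k : fieldType) (psi : {rmorphism R -> k})
    (W : weyl_module k n) (j : L -> W) (ssym : forall i m, s i m = s m i) :
  lat_fiber P psi j -> lat_fiber (L := lat_twist) P psi (W := twist W ssym) j.
Proof.
move=> F; split; [exact: lf_psi F|exact: lf_base F| |exact: lf_d F] => i u /=.
rewrite (lfD F) (lfN F) (lf_sum F) (lf_x F) /twist_x /=; congr (_ - _).
apply: eq_bigr => m _; rewrite -(lf_d F) scaler_nat.
by elim: (s i m) => [|c IH]; rewrite ?mulr0n ?(lf0 F) // !mulrS (lfD F) IH.
Qed.

End TwistLattice.

Section GenericBounds.
Variables (K : fieldType) (n : nat) (N : weyl_module K n).
Hypothesis char0 : forall j : nat, (j.+1)%:R != 0 :> K.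

Lemma gam_change (G G' : set N) c l : (forall u, G u -> gam setT G' c u) ->
  gam setT G l `<=` gam setT G' (c + l).
Proof.
move=> GG; apply: (lspan_sub (subringT K)) => u; elim=> {l u} [l u /GG|l i u _ IH|l i u _ IH].
- exact: gam_le (leq_addr _ _) _.
- by rewrite addnS; exact: gam_x.
- by rewrite addnS; exact: gam_d.
Qed.

Lemma gam_uniform (r : nat) (g : 'I_r -> N) (G : set N) :
  (forall u, exists l, gam setT G l u) -> exists c, forall l,
  gam setT (range g) l `<=` gam setT G (c + l).
Proof.
move=> GT; have /choice [d dP] t := GT (g t).
exists (\max_t d t)%N => l; apply: gam_change => _ [t _ <-].
exact: gam_le (leq_bigmax t) _ (dP t).
Qed.

Definition growth (G : set N) (C : nat) : Prop := forall l (I : finType) (v : I -> N),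
  freefam v -> (forall i, gam setT G l (v i)) -> (#|I| <= C * l.+1 ^ n)%N.

Lemma holonomic_gam_growth (r : nat) (g : 'I_r -> N) : holonomic N -> exists C, growth (range g) C.
Proof.
move=> /(holonomic_growth char0) [r' [g' [C [g'T gr]]]].
have [|c Hc] := @gam_uniform _ g (range g').
  by move=> u; have [l Hl] := g'T u; exists l; apply: lspan_mono Hl; exact: mons_words.
exists (C * c.+1 ^ n)%N => l I v fv vl.
apply: leq_trans (gr (c + l)%N I v fv _) _ => [i|].
  by apply: (gam_mons (subringT K)); apply: Hc.
rewrite -mulnA leq_mul2l -expnMn; apply/orP; right.
case: (posnP n) => [-> //|n0]; rewrite leq_exp2r //; nia.
Qed.

Variables (r : nat) (g : 'I_r -> N) (e : rat) (rho b C : nat).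
Hypothesis gT : forall u, exists l, gam setT (range g) l u.
Hypothesis g_growth : growth (range g) C.
Hypothesis lower : forall l, exists (I : finType) (v : I -> N),
  [/\ freefam v, #|I| = (rho * 'C(l + n, n))%N & forall i, gam setT (range g) (l + b) (v i)].

(** A good filtration and the one generated by [g] contain each other up to shifts. The growth bound
    therefore limits the degree of the Hilbert polynomial to n, and the free families bound its
    coefficient of degree n below by rho / n!. *)
Lemma multiplicity_ge : multiplicity N e -> rho%:R <= e.
Proof.
move=> [F [[Fsub [Fmono Fex] [i0 F0] Fmon [r' [g' [d [Fg' grF]]]]] [q [[l0 qF] ->]]]].
have spanF := filtration_span F0 grF.
have Fle := Fmono_le Fmono.
have subF i : subspace (F i) := Fsub i.
have [c Fg] : exists c : nat, forall t, F c%:Z (g t).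
  have /choice [h hP] t : exists h : nat, F h%:Z (g t).
    have [i Fi] := Fex (g t); exists `|i|%N; apply: Fle Fi; exact: lez_abs.
  by exists (\max_t h t)%N => t; apply: Fle (hP t); rewrite lez_nat leq_bigmax.
have gamF l : gam setT (range g) l `<=` F (c + l)%N%:Z.
  move=> u /(gam_mons (subringT K)); apply: (lspan_subspace (subF _)) => _ [a [_ [al [t _ <-] ->]]].
  apply: Fle (Fmon a _ _ (Fg t)); rewrite /bernstein_weight; lia.
have [c' Hc'] := gam_uniform g' gT.
have [w Fgam] : exists w : nat, forall l : nat, F l%:Z `<=` gam setT (range g) (w + l).
  exists (c' + \max_t `|d t|)%N => l u /spanF Fu; rewrite -addnA; apply: Hc'.
  apply: lspan_mono Fu => _ [[a t] /= al ->]; apply: mons_words.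
  exists a, (g' t); split=> //; have : (`|d t| <= \max_t `|d t|)%N by exact: (@leq_bigmax _ (fun t => `|d t|%N) t).
  move: al; rewrite /bernstein_weight /=; lia.
have qge l : (l0 <= l)%N -> exists2 m : nat, q.[l%:R] = m%:R &
    (forall (I : finType) (v : I -> N), freefam v -> (forall i, F l%:Z (v i)) -> (#|I| <= m)%N) /\
    (m <= C * (w + l).+1 ^ n)%N.
  move=> /qF [m [/quot_dim_free [v [Fv fv vT]] qm]]; exists m => //; split.
    move=> I v' fv' Fv'; rewrite -(card_ord m).
    by apply: (free_card_le (w := v)) fv' _ => i; apply: vT.
  by rewrite -[X in (X <= _)%N](card_ord m); apply: (g_growth fv) => i; apply/Fgam/Fv.
have sq : (size q <= n.+1)%N.
  pose p := (C%:R : rat) *: ('X + (w.+1)%:R%:P) ^+ n.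
  have : (size p <= n.+1)%N.
    apply: leq_trans (size_scale_leq _ _) _.
    by apply: leq_trans (size_poly_exp_leq _ _) _; rewrite size_XaddC mul1n.
  apply: leq_trans; apply: (@size_poly_le_growth _ _ l0) => l /qge [m -> [_ mC]].
  rewrite ler0n /= /p hornerZ horner_exp hornerD hornerX hornerC.
  by rewrite -natrD -natrX -natrM ler_nat addnC addSn.
have low : (rho%:R * (n`!%:R)^-1 : rat) <= q`_n.
  rewrite -(coef_bin_poly n (- (b + c)%N%:R)) -coefZ.
  apply: (coef_le (l0 := (l0 + b + c)%N)) => //.
    by apply: leq_trans (size_scale_leq _ _) _; rewrite size_bin_poly.
  move=> l ll; have [|m -> [mF _]] := qge l; first by lia.
  rewrite hornerZ bin_polyE; last by lia.
  rewrite -natrM ler_nat; have [I [v [fv <- vg]]] := lower (l - (b + c)).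
  apply: mF fv _ => i; apply: Fle (gamF _ _ (vg i)); lia.
have q0 : 0 <= lead_coef q.
  by apply: (lead_coef_ge0 (l0 := l0)) => l /qge [m -> _]; rewrite ler0n.
have fn0 : 0 < (n`!%:R : rat) by rewrite ltr0n fact_gt0.
rewrite /hilbert_mult; move: sq; rewrite leq_eqVlt => /orP [/eqP sqn|sqn].
  move: low; rewrite lead_coefE sqn /= ler_pdivrMr //; lra.
(* If the degree is less than n, the lower bound forces rho = 0. *)
move: low; rewrite nth_default // ler_pdivrMr // mul0r => /le_trans; apply.
by rewrite mulr_ge0 // ler0n.
Qed.

End GenericBounds.

Theorem generic_bounds (n : nat) (R : comPzRingType) (L : weyl_lattice n R)
    (K : fieldType) (phi : {rmorphism R -> K}) (N : weyl_module K n) (j : L -> N)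
    (r : nat) (g : 'I_r -> L) (e : rat) :
  lat_fiber [set 0] phi j -> (forall i : nat, (i.+1)%:R != 0 :> K) -> lat_generated g ->
  holonomic N -> multiplicity N e ->
  exists (f : R) (rho c : nat), [/\ phi f != 0, rho%:R <= e &
  forall (P : set R) (F : fieldType) (psi : {rmorphism R -> F}) (W : weyl_module F n)
    (jW : L -> W), lat_fiber P psi jW -> psi f != 0 ->
    (forall (u : W) l, u != 0 -> exists (I : finType) (v : I -> W),
      [/\ freefam v, #|I| = 'C(l + n, n) & forall i, gam setT [set u] l (v i)]) /\
    forall l (I : finType) (v : I -> W), freefam v ->
      (forall i, gam setT (range (jW \o g)) l (v i)) -> (#|I| <= rho * 'C(l + c + n, n))%N].
Proof.
move=> gF char0 gen hN eN.
have [C grow] := holonomic_gam_growth char0 (j \o g) hN.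
have [s [ssym [k rel]]] := exists_twist char0 grow.
have tF := lat_twist_fiber ssym gF.
have [f [rho [c [f0 low up]]]] := spreading tF char0 (lat_twist_generated (s := s) gen) rel.
exists f, rho, c; split=> //.
  apply: (@multiplicity_ge _ _ _ _ (j \o g) _ _ (n * k)%N C _ grow _ eN) => [u|l].
    exact: (lf_gen gF gen u).
  have [I [v [fv cI vg]]] := low l; exists I, v; split=> // i; exact: twist_gam (vg i).
move=> P F psi W jW FW fW; have [tor ub] := up P F psi _ _ (lat_twist_fiber ssym FW) fW.
split=> [u l u0|l I v fv vg]; last by apply: ub fv _ => i; apply: gam_twist.
pose W' := twist W ssym.
(* As [u] is not torsion, its multiples by monomials in the twisted coordinates are independent; the
   twist preserves Bernstein degrees. *)
exists 'X_{1..n < l.+1}, (fun a : 'X_{1..n < l.+1} => xpow (N := W') (a : 'X_{1..n}) u); split.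
- move=> d d0 a; pose h := \sum_(a : 'X_{1..n < l.+1}) d a *: 'X_[a] : {mpoly F[n]}.
  have hu : xpact (N := W') h u = 0.
    by rewrite -[RHS]d0 /xpact pact_suml; apply: eq_bigr => a' _; rewrite pactZl pactX.
  have : h = 0 by apply: contraNeq u0 => /tor /(_ hu) ->.
  move=> /(congr1 (mcoeff a)).
  by rewrite mcoeff0 mcoeff_lincomb //; exact: val_inj.
- by rewrite card_bmnm.
- move=> a; apply: (twist_gam (N := W) (ssym := ssym)).
  apply: (lspan1 (subringT F)); apply: (@words_le _ _ _ _ (0 + mdeg a)%N); first by rewrite -ltnS bmdeg.
  by rewrite mdegE; apply: powop_words => [*|]; [exact: WordX|exact: Word0].
Qed.

(** * The center in characteristic p *)

Section Center.
Variables (K : fieldType) (n : nat) (N : weyl_module K n) (p : nat).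
Hypothesis pK : p \in [pchar K].
Implicit Types (a b : 'X_{1..n + n}) (u v : N) (f : {mpoly K[n + n]}).

Notation xv := (lshift n).
Notation dv := (@rshift n n).

Lemma wd_iter_xp i j u : wd N i (iter p (wx N j) u) = iter p (wx N j) (wd N i u).
Proof. by rewrite wd_iter_x natrM (pcharf0 pK) mul0r scale0r addr0. Qed.

Lemma iter_d_x i j m u : iter m (wd N j) (wx N i u) =
  wx N i (iter m (wd N j) u) + (m * (j == i))%:R *: iter m.-1 (wd N j) u.
Proof.
elim: m => [|m IH]; first by rewrite mul0n scale0r addr0.
rewrite iterS IH linearD linearZ /=.
have /eqP := wdx j i (iter m (wd N j) u); rewrite subr_eq => /eqP ->.
rewrite -addrA addrCA; congr (_ + _); rewrite mulSn natrD scalerDl; congr (_ + _).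
by case: m {IH} => [|m]; rewrite ?mul0n ?scale0r.
Qed.

Lemma wx_iter_dp i j u : wx N i (iter p (wd N j) u) = iter p (wd N j) (wx N i u).
Proof. by rewrite iter_d_x natrM (pcharf0 pK) mul0r scale0r addr0. Qed.

Lemma monopp_wx i a u : wx N i (monop p a u) = monop p a (wx N i u).
Proof.
rewrite !monopE powop_comm => [|j v]; last by rewrite (@iter_comm _ (wx N i)) // => w; exact: wxC.
by congr powop; apply: powop_comm => j v; exact: wx_iter_dp.
Qed.

Lemma monopp_wd i a u : wd N i (monop p a u) = monop p a (wd N i u).
Proof.
rewrite !monopE powop_comm => [|j v]; last exact: wd_iter_xp.
by congr powop; apply: powop_comm => j v; rewrite (@iter_comm _ (wd N i)) // => w; exact: wdC.
Qed.

Lemma monopp_iter_wx m i a u : iter m (wx N i) (monop p a u) = monop p a (iter m (wx N i) u).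
Proof. by elim: m => //= m ->; rewrite monopp_wx. Qed.

Lemma monopp_iter_wd m i a u : iter m (wd N i) (monop p a u) = monop p a (iter m (wd N i) u).
Proof. by elim: m => //= m ->; rewrite monopp_wd. Qed.

Lemma monopp_comm c a b u : monop c b (monop p a u) = monop p a (monop c b u).
Proof.
rewrite ![monop c b _]monopE; symmetry.
rewrite [LHS]powop_comm => [|j v]; last by rewrite monopp_iter_wx.
by congr powop; apply: powop_comm => j v; rewrite monopp_iter_wd.
Qed.

(** The p-th powers commute with all x_i and d_i, so they can be collected on the left of a normally
    ordered monomial. *)
Lemma monopp_split a b u : monop 1 [multinom (p * a i + b i)%N | i < n + n] u =
  monop p a (monop 1 b u).
Proof.
rewrite /monop; set A := powop _ _ u.
have -> : A = powop (wd N) (fun i => p * a (dv i))%N (powop (wd N) (fun i => 1 * b (dv i))%N u).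
  rewrite -powop_add; last exact: wdC.
  by apply: eq_powop => i; rewrite !mul1n mnmE.
rewrite (eq_powop _ (b := fun i => p * a (xv i) + 1 * b (xv i))%N) => [|i]; last first.
  by rewrite !mul1n mnmE.
rewrite powop_add; last exact: wxC.
congr powop; symmetry; apply: powop_comm => i v; rewrite !powop_iter; symmetry.
by apply: powop_comm => j v'; exact: wx_iter_dp.
Qed.

Lemma monoppD a b u : monop p (a + b)%MM u = monop p a (monop p b u).
Proof.
have E c v : monop p c v = monop 1 [multinom (p * c i + 0%MM i)%N | i < n + n] v.
  by rewrite monopp_split monop0.
rewrite [LHS]E [in RHS](E b) -monopp_split; congr (monop 1 _ _).
by apply/mnmP => i; rewrite !mnmE !addn0 mulnDr.
Qed.

Definition cact f u : N := pact (monop p) f u.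

Let lin := @monop_linear K n N p.

HB.instance Definition _ f := GRing.isLinear.Build K N N _ (cact f) (pact_linear lin f).

Lemma cactM f g u : cact (f * g) u = cact f (cact g u).
Proof. exact: (pactM lin monoppD). Qed.

Lemma cact_monop1 f a u : monop 1 a (cact f u) = cact f (monop 1 a u).
Proof. by apply: pact_comm => b v; rewrite /= monopp_comm. Qed.

Lemma cact_wx f i u : wx N i (cact f u) = cact f (wx N i u).
Proof. by apply: pact_comm => b v; rewrite /= monopp_wx. Qed.

Lemma cact_wd f i u : wd N i (cact f u) = cact f (wd N i u).
Proof. by apply: pact_comm => b v; rewrite /= monopp_wd. Qed.

End Center.

(** * Hilbert functions of ideals *)

Section Staircase.

Lemma chain_seq (T : eqType) (U : nat -> set T) (s : seq T) :
  (forall k l, (k <= l)%N -> U k `<=` U l) -> (forall b, b \in s -> exists k, U k b) ->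
  exists k, forall b, b \in s -> U k b.
Proof.
move=> Ule; elim: s => [|b s IHs] sU; first by exists 0%N.
have [|k H] := IHs; first by move=> b' b's; apply: sU; rewrite inE b's orbT.
have [l Hl] := sU b (mem_head _ _); exists (maxn k l) => b'.
rewrite inE => /orP [/eqP ->|/H Hb].
  exact: Ule (leq_maxr _ _) _ Hl.
exact: Ule (leq_maxl _ _) _ Hb.
Qed.

Fixpoint mnms (m l : nat) : seq 'X_{1..m} := if m is m'.+1 return seq 'X_{1..m} then
  [seq mnm_cons c a | c <- iota 0 l.+1, a <- mnms m' (l - c)] else [:: 0%MM].

Lemma mnmsS m l :
  mnms m.+1 l = [seq mnm_cons c a | c <- iota 0 l.+1, a <- mnms m (l - c)].
Proof. by []. Qed.

Lemma mem_mnms m l (a : 'X_{1..m}) : (a \in mnms m l) = (mdeg a <= l)%N.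
Proof.
elim: m l a => [|m IH] l a.
  by rewrite /= inE mdegE big_ord0 leq0n; apply/eqP/mnmP => -[].
apply/allpairsPdep/idP => [[c [b [+ + ->]]]|].
  by rewrite mem_iota IH mdeg_cons; lia.
rewrite -{1}(mnm_tailK a) mdeg_cons => al.
exists (a ord0), (mnm_tail a); rewrite mem_iota IH mnm_tailK; split=> //; lia.
Qed.

Lemma mnms_uniq m l : uniq (mnms m l).
Proof.
elim: m l => // m IH l; rewrite mnmsS; apply: allpairs_uniq_dep => [|c _|].
- exact: (iota_uniq 0 l.+1).
- exact: IH.
move=> [c a] [c' a'] _ _ /= E; have := congr1 (fun b : 'X_{1..m.+1} => b ord0) E.
rewrite !mnm_cons0 => cc; subst c'.
by have := congr1 (@mnm_tail m) E; rewrite !mnm_consK => ->.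
Qed.

Lemma count_mnms m l (Q : pred 'X_{1..m}) :
  count Q (mnms m l) = #|[pred a : 'X_{1..m < l.+1} | Q a]|.
Proof.
pose A := [pred a : 'X_{1..m < l.+1} | Q a].
rewrite -size_filter cardE -(size_map val (enum A)); apply/perm_size/uniq_perm.
- by rewrite filter_uniq // mnms_uniq.
- by rewrite map_inj_uniq ?enum_uniq //; exact: val_inj.
move=> a; rewrite mem_filter mem_mnms; apply/andP/mapP => [[Qa al]|[b + ->]].
  by exists (BMultinom (al : (mdeg a < l.+1)%N)) => //; rewrite mem_enum.
by rewrite mem_enum inE => Qb; split=> //; rewrite -ltnS bmdeg.
Qed.

(** For x = (k, b), the number of monomials of degree at most l in a cone: a monomial of degree b
    times all monomials in k variables. *)
Definition cone_count (x : nat * nat) (l : nat) : nat :=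
  ((x.2 <= l) * 'C(l - x.2 + x.1, x.1))%N.

Lemma cone_count_add x c l : (c <= l)%N ->
  cone_count x (l - c) = cone_count (x.1, x.2 + c)%N l.
Proof.
move=> cl; rewrite /cone_count /= -subnDA [(c + _)%N]addnC.
by have -> : (x.2 + c <= l)%N = (x.2 <= l - c)%N by lia.
Qed.

Lemma cone_count_large x c l : (l < c)%N -> cone_count (x.1, x.2 + c)%N l = 0%N.
Proof. by move=> lc; rewrite /cone_count /=; have -> : (x.2 + c <= l)%N = false by lia. Qed.

(** Stacking shifted copies of a cone adds one free variable; numerically this is Pascal's rule,
    summed. *)
Lemma sum_cone_count k b M l : (l < b + M)%N ->
  (\sum_(c < M) cone_count (k, b + c) l = cone_count (k.+1, b) l)%N.
Proof.
elim: M b => [|M IH] b lb.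
  by rewrite big_ord0 /cone_count /=; have -> : (b <= l)%N = false by lia.
rewrite big_ord_recl /= addn0.
under eq_bigr => c _ do rewrite /bump /= add1n addnS -addSn.
rewrite IH /cone_count /=; last by lia.
case: (leqP b l) => [bl|bl]; last by have -> : (b < l)%N = false by lia.
move: bl; rewrite leq_eqVlt => /orP [/eqP <-|bl].
  by rewrite ltnn subnn !add0n !binn.
rewrite bl !mul1n subnS addnS -addSn prednK ?subn_gt0 // addnS.
by rewrite [in RHS]binS addnC.
Qed.

Definition upset (m : nat) (U : set 'X_{1..m}) : Prop :=
  forall a b, (a <= b)%MM -> U a -> U b.

Lemma mnm_cons_le (m : nat) c c' (a a' : 'X_{1..m}) : (c <= c')%N -> (a <= a')%MM ->
  (mnm_cons c a <= mnm_cons c' a')%MM.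
Proof.
move=> cc /mnm_lepP aa; apply/mnm_lepP => i; case: (unliftP ord0 i) => [j|] ->.
  by rewrite !mnm_consS.
by rewrite !mnm_cons0.
Qed.

(* Both claims are proved together: the slices of an up-set along the first
   coordinate increase, and as their union is finitely generated they stabilize. *)
Lemma upset_staircase (m : nat) (U : set 'X_{1..m}) : upset U ->
  (exists s : seq 'X_{1..m}, (forall b, b \in s -> U b) /\
     forall a, U a -> exists2 b, b \in s & (b <= a)%MM) /\
  exists cs : seq (nat * nat), forall l,
    count (fun a => ~~ `[< U a >]) (mnms m l) = (\sum_(x <- cs) cone_count x l)%N.
Proof.
elim: m U => [|m IH] U upU.
  have all0 (a : 'X_{1..0}) : a = 0%MM by apply/mnmP => -[].
  have [U0|U0] := pselect (U 0%MM).
    split; first by exists [:: 0%MM]; split=> [b _|a _]; [rewrite (all0 b)|exists 0%MM; [rewrite inE|rewrite (all0 a) lepm_refl]].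
    by exists [::] => l; rewrite big_nil /= asboolT.
  split; first by exists [::]; split=> // a; rewrite (all0 a).
  exists [:: (0%N, 0%N)] => l; rewrite big_seq1 /= asboolF //=.
  by rewrite /cone_count /= bin0.
pose Us c : set 'X_{1..m} := [set a | U (mnm_cons c a)].
have Us_up c : upset (Us c).
  by move=> a b ab; apply: upU; exact: mnm_cons_le.
have Us_le c c' : (c <= c')%N -> Us c `<=` Us c'.
  by move=> cc a; apply: upU; apply: mnm_cons_le => //; exact: lepm_refl.
have [|[t [tJ tgen]] _] := IH [set a | exists c, Us c a].
  by move=> a b ab [c Ua]; exists c; apply: Us_up Ua.
have {tJ} [c0 tc0] := chain_seq Us_le tJ.
have stab c a : Us c a -> Us (minn c c0) a.
  move=> Ua; case: (leqP c c0) => // /ltnW cc.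
  have [|b bt ba] := tgen a; first by exists c.
  exact: Us_up ba (tc0 b bt).
have /choice [s sP] c := (IH _ (Us_up c)).1.
have /choice [cs csP] c := (IH _ (Us_up c)).2.
split.
  exists [seq mnm_cons c b | c <- iota 0 c0.+1, b <- s c]; split.
    by move=> b /allpairsPdep [c [b' [_ bs ->]]]; have [H _] := sP c; exact: H.
  move=> a Ua; have /stab Ut : Us (a ord0) (mnm_tail a) by rewrite /Us /= mnm_tailK.
  have [b bs ba] := (sP (minn (a ord0) c0)).2 _ Ut.
  exists (mnm_cons (minn (a ord0) c0) b).
    by apply/allpairsPdep; exists (minn (a ord0) c0), b; rewrite mem_iota ltnS geq_minr.
  by rewrite -[X in (_ <= X)%MM]mnm_tailK; apply: mnm_cons_le => //; exact: geq_minl.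
(* Each slice below [c0] contributes its own cones, shifted by its height. The slices from [c0] on
   are equal and form cones with one more free variable. *)
exists (flatten [seq [seq (x.1, x.2 + c)%N | x <- cs c] | c <- iota 0 c0] ++
  [seq (x.1.+1, x.2 + c0)%N | x <- cs c0]) => l.
have slice c : count (fun a => ~~ `[< U (mnm_cons c a) >]) (mnms m (l - c)) =
    (\sum_(x <- cs (minn c c0)) cone_count x (l - c))%N.
  rewrite -csP; apply: eq_count => a; congr (~~ _); apply/asbool_equiv_eq.
  split; first exact: stab.
  by apply: Us_le; exact: geq_minl.
(* The sum runs past [l] over slices that contribute 0, so that it can be cut at [c0] without
   comparing [c0] with [l]. *)
have -> : count (fun a => ~~ `[< U a >]) (mnms m.+1 l) =
    (\sum_(0 <= c < c0 + l.+1) \sum_(x <- cs (minn c c0)) cone_count (x.1, x.2 + c) l)%N.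
  rewrite mnmsS count_flatten sumnE !big_map.
  rewrite (big_cat_nat (n := l.+1)) ?leq_addl //.
  have -> : (\sum_(l.+1 <= c < c0 + l.+1) \sum_(x <- cs (minn c c0)) cone_count (x.1, x.2 + c) l = 0)%N.
    rewrite big_nat_cond big1 // => c /andP [/andP [lc _] _].
    by rewrite big1 // => x _; rewrite cone_count_large.
  rewrite [RHS]addn0 /index_iota subn0 big_seq [RHS]big_seq; apply: eq_bigr => c; rewrite mem_iota => /andP [_ cl].
  rewrite count_map [LHS]slice; apply: eq_bigr => x _; rewrite cone_count_add //; lia.
rewrite (big_cat_nat (n := c0)) ?leq_addr //= big_cat /=; congr (_ + _)%N.
  rewrite big_flatten /= big_map /index_iota subn0 big_seq [RHS]big_seq; apply: eq_bigr => c.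
  rewrite mem_iota => /andP [_ cc0]; rewrite big_map; have -> : minn c c0 = c by apply/minn_idPl; lia.
  by [].
rewrite -{1}[c0]add0n big_addn addKn big_map.
under eq_bigr => c _ do rewrite (minn_idPr (leq_addl c c0)).
rewrite exchange_big; apply: eq_bigr => -[k b] _ /=.
rewrite -(@sum_cone_count k (b + c0) l.+1) ?big_mkord; last by lia.
by apply: eq_bigr => c _; rewrite -addnA (addnC c0).
Qed.

End Staircase.

(** The multiplicity is the number of cones of maximal dimension d: each of them contributes 1 / d!
    to the coefficient of degree d, and the others nothing. *)
Lemma cones_poly (cs : seq (nat * nat)) (q := \sum_(x <- cs) bin_poly x.1 (- x.2%:R)) :
  (exists l0, forall l, (l0 <= l)%N -> q.[l%:R] = (\sum_(x <- cs) cone_count x l)%:R) /\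
  (cs <> [::] -> exists2 D, (0 < D)%N & hilbert_mult q = D%:R).
Proof.
split.
  exists (\max_(x <- cs) x.2)%N => l ll; rewrite horner_sum natr_sum big_seq [RHS]big_seq.
  apply: eq_bigr => x xcs; have xl : (x.2 <= l)%N by apply: leq_trans ll; exact: leq_bigmax_seq.
  by rewrite bin_polyE // /cone_count xl mul1n.
move=> cs0; pose d := (\max_(x <- cs) x.1)%N.
have size_le : (size q <= d.+1)%N.
  apply: leq_trans (size_sum _ _ _) _; apply/bigmax_leqP_seq => x xcs _.
  by rewrite size_bin_poly ltnS; exact: leq_bigmax_seq.
pose D := count (fun x => x.1 == d) cs.
have coefE : q`_d = D%:R * (d`!%:R)^-1.
  rewrite coef_sum /D -sum1_count natr_sum mulr_suml [RHS]big_mkcond /= big_seq [RHS]big_seq.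
  apply: eq_bigr => x xcs; case: eqP => [->|xd]; first by rewrite coef_bin_poly mul1r.
  rewrite nth_default // size_bin_poly ltn_neqAle; apply/andP; split; first exact/eqP.
  exact: leq_bigmax_seq.
have D0 : (0 < D)%N.
  rewrite -has_count; apply/hasP.
  have [x xcs dx] : exists2 x, x \in cs & d = x.1.
    rewrite /d; elim: (cs) cs0 => // y [|z s] IHs _; first by exists y; rewrite ?inE ?big_seq1.
    have [//|x xs xE] := IHs; rewrite big_cons xE; case: (leqP y.1 x.1) => _.
      by exists x; rewrite // inE xs orbT.
    by exists y; rewrite // inE eqxx.
  by exists x => //; apply/eqP.
have f0 : (d`!%:R : rat) != 0 by rewrite pnatr_eq0 -lt0n fact_gt0.
have qd : q`_d != 0 by rewrite coefE mulf_neq0 ?invr_neq0 // pnatr_eq0 -lt0n.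
have sq : size q = d.+1.
  apply/eqP; rewrite eqn_leq size_le ltnNge; apply: contraNN qd => sd.
  by rewrite nth_default.
by exists D => //; rewrite /hilbert_mult lead_coefE sq /= coefE mulrC divfK.
Qed.

(** * Standard monomials of an ideal *)

Section StandardMonomials.
Variables (K : fieldType) (m : nat) (P : set {mpoly K[m]}).
Hypothesis iP : ideal P.
Implicit Types (f g h : {mpoly K[m]}) (a b : 'X_{1..m}).

Definition leading : set 'X_{1..m} := [set a | exists f, [/\ P f, f != 0 & mlead f = a]].

Lemma leading_upset : upset leading.
Proof.
move=> a b ab [f [Pf f0 fa]]; exists ('X_[b - a] * f); split.
- by case: iP => _; apply.
- by rewrite mulf_neq0 // -msupp_eq0 msuppX.
- by rewrite mleadM ?mleadXm ?fa ?submK // -msupp_eq0 msuppX.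
Qed.

Lemma mlead_cancel f g : f != 0 -> g != 0 -> mlead g = mlead f ->
  let f' := f - (f@_(mlead f) / g@_(mlead f)) *: g in
  f' != 0 -> (mlead f' < mlead f)%O.
Proof.
move=> f0 g0 gf f' f'0; have f'a : f'@_(mlead f) = 0.
  by rewrite mcoeffB mcoeffZ divfK ?subrr // -gf mleadc_eq0.
rewrite lt_neqAle; apply/andP; split.
  by apply: contraNneq f'0 => e; rewrite -mleadc_eq0 e f'a.
apply: le_trans (mleadB_le _ _) _; rewrite leUx lexx /=.
by apply: le_trans (mleadZ_le _ _) _; rewrite gf.
Qed.

(** Division by the ideal; as the monomial order compares degrees first, the remainder does not
    exceed the degree of [f]. *)
Lemma std_reduce f : exists h, [/\ P (f - h), forall a, a \in msupp h -> ~ leading a &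
  (msize h <= msize f)%N].
Proof.
have [[P0 PD] PM] := iP; elim/mleadrect: f => f IH.
case: (eqVneq f 0) => [->|f0].
  by exists 0; rewrite subr0 msize0; split=> // a; rewrite msupp0.
have [g [g0 gf gP]] : exists g, [/\ g != 0, mlead g = mlead f &
    exists h, [/\ P (g - h), forall a, a \in msupp h -> ~ leading a & (msize h <= msize f)%N]].
  have [[g [Pg g0 gf]]|nl] := pselect (leading (mlead f)).
    exists g; split=> //; exists 0; rewrite subr0 msize0; split=> // a; by rewrite msupp0.
  exists 'X_[mlead f]; rewrite mleadXm -msupp_eq0 msuppX; split=> //.
  exists 'X_[mlead f]; rewrite subrr msizeX -mlead_deg //; split=> // a.
  by rewrite msuppX inE => /eqP ->.
have [h [Ph hs hl]] := gP.
set c := f@_(mlead f) / g@_(mlead f); pose f' := f - c *: g.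
have [h' [Ph' h's h'l]] : exists h, [/\ P (f' - h), forall a, a \in msupp h -> ~ leading a &
    (msize h <= msize f)%N].
  case: (eqVneq f' 0) => [->|f'0].
    by exists 0; rewrite subr0 msize0; split=> // a; rewrite msupp0.
  have lt := mlead_cancel f0 g0 gf f'0; have [h' [Ph' h's h'l]] := IH _ lt.
  exists h'; split=> //; apply: leq_trans h'l _.
  by rewrite -!mlead_deg // ltnS lemc_mdeg // ltW.
exists (c *: h + h'); split.
- have -> : f - (c *: h + h') = c%:MP * (g - h) + (f' - h').
    by rewrite mul_mpolyC /f' scalerBr; ring.
  by apply: PD => //; apply: PM.
- by move=> a /msuppD_le; rewrite mem_cat => /orP [/msuppZ_le|]; [exact: hs|exact: h's].
- apply: leq_trans (msizeD_le _ _) _; rewrite geq_max h'l andbT.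
  exact: leq_trans (msizeZ_le _ _) hl.
Qed.

Lemma std_independent h : P h -> (forall a, a \in msupp h -> ~ leading a) -> h = 0.
Proof.
move=> Ph hs; apply: contrapT => /eqP h0.
by apply: (hs _ (mlead_supp h0)); exists h.
Qed.

Definition stdb a := ~~ `[< leading a >].
Definition hilb l := count stdb (mnms m l).

Lemma stdbP a : reflect (~ leading a) (stdb a).
Proof. by rewrite /stdb; apply: (iffP idP) => [/asboolPn|/asboolPn]. Qed.

Lemma hilb_cones : ~ P 1 -> exists2 cs, cs <> [::] &
  forall l, hilb l = (\sum_(x <- cs) cone_count x l)%N.
Proof.
move=> P1; have [_ [cs csP]] := upset_staircase leading_upset; exists cs => // cs0.
have := csP 0%N; rewrite cs0 big_nil => /eqP; rewrite -leqn0 leqNgt -has_count => /negP; apply.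
apply/hasP; exists 0%MM; first by rewrite mem_mnms mdeg0.
apply/asboolPn => -[f [Pf f0 flead]]; apply: P1.
have fC : f = (f@_0%MM)%:MP by apply: msize1_polyC; rewrite -mlead_deg // flead mdeg0.
have c0 : f@_0%MM != 0 by apply: contraNneq f0 => c0; rewrite fC c0.
have -> : 1 = (f@_0%MM)^-1%:MP * f by rewrite [in X in _ * X]fC -mpolyCM mulVf.
by case: iP => _; apply.
Qed.

End StandardMonomials.

(** * Degree of the projective closure *)

Section ClosureDegree.
Variables (K : fieldType) (m : nat) (P : set {mpoly K[m]}).
Hypothesis iP : ideal P.

Lemma dehomogX (a : 'X_{1..m.+1}) : dehomog 'X_[a] = 'X_[mnm_tail a] :> {mpoly K[m]}.
Proof.
rewrite /dehomog comp_mpolyX big_ord_recl tnth0 expr1n mul1r [RHS]mpolyXE_id.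
by apply: eq_bigr => i _; rewrite tnthS tnth_mktuple mnmE.
Qed.

Lemma dehomog_linear : linear (@dehomog K m).
Proof. by move=> c f g; rewrite /dehomog linearP. Qed.

HB.instance Definition _ := GRing.isLinear.Build K {mpoly K[m.+1]} {mpoly K[m]} _
  (@dehomog K m) dehomog_linear.

Lemma msize_dehomog l (f : {mpoly K[m.+1]}) : f \is l.-homog -> (msize (dehomog f) <= l.+1)%N.
Proof.
move=> /dhomogP fl; rewrite {1}[f]mpolyE linear_sum big_seq.
apply: leq_trans (msize_sum _ _ _) _; apply/bigmax_leqP_seq => a _ af /=.
rewrite linearZ /= dehomogX; apply: leq_trans (msizeZ_le _ _) _.
by rewrite msizeX ltnS -(fl a af) -[X in (_ <= mdeg X)%N]mnm_tailK mdeg_cons leq_addl.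
Qed.

(** The standard monomials of degree at most l, homogenized to degree l by t_0, give a basis of the
    quotient. *)
Lemma closure_quot_dim l : quot_dim [set f : {mpoly K[m.+1]} | f \is l.-homog]
  [set f : {mpoly K[m.+1]} | f \is l.-homog /\ P (dehomog f)] (hilb P l).
Proof.
rewrite /hilb count_mnms; pose A := [pred a : 'X_{1..m < l.+1} | stdb P a].
rewrite -/A; pose mn (i : 'I_#|A|) : 'X_{1..m} := val (enum_val i).
have mnl i : (mdeg (mn i) <= l)%N by rewrite -ltnS bmdeg.
have mns i : ~ leading P (mn i) by apply/stdbP; exact: (enum_valP i).
have mn_inj : injective mn by move=> i i' /val_inj/enum_val_inj.
pose b i : {mpoly K[m.+1]} := 'X_[mnm_cons (l - mdeg (mn i)) (mn i)].
have bh i : b i \is l.-homog by rewrite dhomogX /= mdeg_cons subnK.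
have db i : dehomog (b i) = 'X_[mn i] by rewrite dehomogX mnm_consK.
have dsum (c : 'I_#|A| -> K) : dehomog (\sum_i c i *: b i) = \sum_i c i *: 'X_[mn i].
  by rewrite linear_sum; apply: eq_bigr => i _; rewrite linearZ /= db.
have csum (c : 'I_#|A| -> K) i : (\sum_i c i *: 'X_[mn i])@_(mn i) = c i.
  exact: mcoeff_lincomb.
have ssum (c : 'I_#|A| -> K) a : a \in msupp (\sum_i c i *: 'X_[mn i]) -> ~ leading P a.
  move=> /msupp_sum_le /flatten_mapP [i _ /msuppZ_le]; rewrite msuppX inE => /eqP ->.
  exact: mns.
exists b; split=> // f fl; have [h [Ph hs hl]] := std_reduce iP (dehomog f).
have hE : h = \sum_i h@_(mn i) *: 'X_[mn i].
  apply/mpolyP => a; have [ah|ah] := boolP (a \in msupp h); last first.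
    rewrite memN_msupp_eq0 // raddf_sum big1 // => i _ /=; rewrite mcoeffZ mcoeffX.
    case: eqP => [E|_]; last by rewrite mulr0.
    by rewrite E memN_msupp_eq0 // mul0r.
  have al : (mdeg a < l.+1)%N.
    exact: leq_trans (msize_mdeg_lt ah) (leq_trans hl (msize_dehomog fl)).
  have aA : BMultinom al \in A by apply/stdbP/hs.
  have -> : a = mn (enum_rank_in aA (BMultinom al)) by rewrite /mn enum_rankK_in.
  by rewrite csum.
exists (fun i => h@_(mn i)); split.
  split; last by rewrite linearB /= dsum -hE.
  by rewrite rpredB // rpred_sum // => i _; rewrite rpredZ.
move=> c [_ Pc] i; apply/eqP; rewrite -subr_eq0; apply/eqP.
have E : \sum_i (c i - h@_(mn i)) *: 'X_[mn i] = (dehomog f - h) - dehomog (f - \sum_i c i *: b i).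
  under eq_bigr => i' _ do rewrite scalerBl.
  by rewrite sumrB -hE linearB /= dsum; ring.
have Z : \sum_i (c i - h@_(mn i)) *: 'X_[mn i] = 0 :> {mpoly K[m]}.
  apply: (std_independent (P := P)); last exact: ssum.
  by rewrite E; apply: idealB.
by have := csum (fun i => c i - h@_(mn i)) i; rewrite Z mcoeff0 => <-.
Qed.

Lemma closure_degree_hilb q l0 : (forall l, (l0 <= l)%N -> q.[l%:R] = (hilb P l)%:R) ->
  closure_degree P (hilbert_mult q).
Proof.
move=> qP; exists q; split=> //; exists l0 => l ll; exists (hilb P l); split; last exact: qP.
exact: closure_quot_dim.
Qed.

End ClosureDegree.

(** * Associated primes and ranks *)

(** The up-sets of leading monomials stabilize, their union being finitely generated, and division
    shows that nested ideals with the same leading monomials are equal. *)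
Lemma ideal_chain_stable (K : fieldType) (m : nat) (I : nat -> set {mpoly K[m]}) :
  (forall k, ideal (I k)) -> (forall k, I k `<=` I k.+1) -> exists k, I k.+1 `<=` I k.
Proof.
move=> iI Imono.
have Ile k l : (k <= l)%N -> I k `<=` I l.
  by move=> /subnK <-; elim: (l - k)%N => // d IH f /IH; rewrite addSn; exact: Imono.
have Lle k l : (k <= l)%N -> leading (I k) `<=` leading (I l).
  by move=> kl a [f [If f0 fa]]; exists f; split=> //; exact: Ile If.
have [|[s [sL sgen]] _] := @upset_staircase m [set a | exists k, leading (I k) a].
  by move=> a b ab [k La]; exists k; exact: leading_upset La.
have {sL} [k sk] := chain_seq Lle sL.
exists k => f If; have [h [Ih hs _]] := std_reduce (iI k) f.
suff h0 : h = 0 by rewrite -[f]subr0 -h0.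
apply: contrapT => /eqP h0; apply: (hs _ (mlead_supp h0)).
have [|b bs ba] := sgen (mlead h).
  exists k.+1, h; split=> //; have -> : h = f - (f - h) by rewrite opprB addrC subrK.
  by apply: idealB => //; exact: Imono.
exact: leading_upset (iI k) _ _ ba (sk b bs).
Qed.

(** Gaussian elimination with cross multiplication in place of division, so that it takes place in
    [C] without the fraction field of C / P. *)
Lemma linear_relation_mod (C : comPzRingType) (P : set C) (I J : finType) (M : I -> J -> C) :
  prime_ideal P -> (#|J| < #|I|)%N ->
  exists2 c : I -> C, exists i, ~ P (c i) & forall j, P (\sum_i c i * M i j).
Proof.
move=> [[P0 PD] PM P1 PP] ltJI.
suff H r : forall (A : {set I}) (M : I -> nat -> C), (r < #|A|)%N ->
    exists2 c : I -> C, exists2 i, i \in A & ~ P (c i) &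
      forall j, (j < r)%N -> P (\sum_(i in A) c i * M i j).
  have [|c [i _ ci] cP] := H #|J| [set: I]%SET
    (fun i k => if (insub k : option 'I_#|J|) is Some k' then M i (enum_val k') else 0).
    by rewrite cardsT.
  exists c => [|j]; first by exists i.
  have := cP _ (ltn_ord (enum_rank j)); rewrite valK.
  by under eq_bigr => i' _ do rewrite enum_rankK; under eq_bigl => i' do rewrite finset.in_setT.
elim: r => [|r IH] A {}M rA.
  have [i iA] : exists i, i \in A by apply/set0Pn; rewrite -card_gt0.
  by exists (fun=> 1) => //; exists i.
have [[i0 i0A Pi0]|none] := pselect (exists2 i, i \in A & ~ P (M i r)); last first.
  have [|c [i iA ci] cP] := IH A M; first exact: ltnW.
  exists c => [|j]; first by exists i.
  rewrite ltnS leq_eqVlt => /orP [/eqP ->|/cP //].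
  apply: (big_ind P) => // i' i'A; apply: PM; apply: contrapT => nP.
  by apply: none; exists i'.
have rA' : (r < #|A :\ i0|)%N by move: rA; rewrite (finset.cardsD1 i0 A) i0A.
have [c [i iA ci] cP] := IH _ (fun i j => M i0 r * M i j - M i r * M i0 j) rA'.
pose c' i := if i == i0 then - \sum_(i in A :\ i0) c i * M i r else M i0 r * c i.
move: iA; rewrite finset.in_setD1 => /andP [ii0 iA].
exists c' => [|j].
  by exists i; rewrite // /c' (negPf ii0) => /PP [].
have -> : \sum_(i' in A) c' i' * M i' j =
    \sum_(i' in A :\ i0) c i' * (M i0 r * M i' j - M i' r * M i0 j).
  rewrite (big_setD1 i0) //= {1}/c' eqxx mulNr mulr_suml -sumrN -big_split /=.
  apply: eq_bigr => i'; rewrite finset.in_setD1 => /andP [/negPf i'0 _].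
  by rewrite /c' i'0; ring.
rewrite ltnS leq_eqVlt => /orP [/eqP ->|/cP //].
by rewrite big1 // => i' _; rewrite mulrC [_ * M i' r]mulrC subrr mul0r.
Qed.

Section AssociatedPrime.
Variables (K : fieldType) (V : lmodType K) (m : nat) (phi : 'X_{1..m} -> V -> V).
Hypothesis phi_lin : forall a, linear (phi a).
Hypothesis phi0 : forall u, phi 0%MM u = u.
Hypothesis phiD : forall a b u, phi (a + b)%MM u = phi a (phi b u).
Notation act := (pact phi).

Definition ann (u : V) : set {mpoly K[m]} := [set f | act f u = 0].

Lemma ann_ideal u : ideal (ann u).
Proof.
split; [split|] => [|f g fu gu|f g gu]; rewrite /ann /=.
- exact: pact0l.
- by rewrite pactDl fu gu addr0.
- by rewrite (pactM phi_lin phiD) gu (pact0r phi_lin).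
Qed.

Variable P : set {mpoly K[m]}.
Hypothesis Pp : prime_ideal P.

(* An annihilator that is maximal among those contained in [P] is prime, since
   multiplying the vector by some [s] outside [P] does not change it. *)
Lemma associated_prime : (exists u, ann u `<=` P) ->
  (forall u, prime_ideal (ann u) -> ann u `<=` P -> ann u = P) ->
  exists w, forall f, act f w = 0 <-> P f.
Proof.
have [[P0 PD] PM P1 PP] := Pp.
move=> [u0 u0P] Pmin; have [w wP wmax] : exists2 w, ann w `<=` P &
    forall u, ann w `<=` ann u -> ann u `<=` P -> ann u `<=` ann w.
  apply: contrapT => none.
  have /choice [next nextP] u : exists u', ann u `<=` P ->
      [/\ ann u `<=` ann u', ann u' `<=` P & ~ ann u' `<=` ann u].
    have [uP|] := pselect (ann u `<=` P); last by exists u.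
    apply: contrapT => nu; apply: none; exists u => // u' uu' u'P.
    by apply: contrapT => nsub; apply: nu; exists u'.
  pose s k := iter k next u0.
  have sP k : ann (s k) `<=` P by elim: k => //= k IH; have [] := nextP _ IH.
  have [k|k ks] := @ideal_chain_stable K m (fun k => ann (s k)) (fun k => ann_ideal _).
    by have [] := nextP _ (sP k).
  by have [_ _] := nextP _ (sP k).
have annM s u : ann u `<=` ann (act s u).
  by move=> f fu; rewrite /ann /= (pactAC phi_lin phiD) fu (pact0r phi_lin).
have stable s : ~ P s -> ann (act s w) `<=` ann w.
  move=> Ps; apply: wmax; first exact: annM.
  by move=> f; rewrite /ann /= -(pactM phi_lin phiD) => /wP /PP [].
have pw : prime_ideal (ann w).
  have [[A0 AD] AM] := ann_ideal w; split=> //; first by move/wP.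
  move=> f g fg; have [gw|gw] := pselect (ann w g); first by right.
  left; apply: contrapT => fw; have sub : ann (act g w) `<=` P -> False.
    move=> gP; apply: fw; apply: (wmax _ (annM g w) gP).
    by rewrite /ann /= -(pactM phi_lin phiD).
  apply: sub => s; rewrite /ann /= (pactAC phi_lin phiD) => sg.
  by apply: contrapT => Ps; apply: gw; exact: stable Ps _ sg.
exists w => f; have <- := Pmin _ pw wP; exact: iff_refl.
Qed.

(** Independence over C / P, for vectors that [P] need not kill; this covers the vectors that
    represent the rank at [P]. *)
Definition cfree (I : finType) (v : I -> V) : Prop := forall c : I -> {mpoly K[m]},
  \sum_i act (c i) (v i) = 0 -> forall i, P (c i).

(** Multiply each vector by the standard monomials of degree at most l: a combination of standard
    monomials that lies in [P] is zero. *)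
Lemma cfree_std (I : finType) (v : I -> V) l : cfree v ->
  exists (J : finType) (a : J -> 'X_{1..m}), [/\ #|J| = (#|I| * hilb P l)%N,
    forall j, (mdeg (a j) <= l)%N & exists i : J -> I, freefam (fun j => phi (a j) (v (i j)))].
Proof.
have iP := ideal_prime Pp.
move=> fv; pose A := [pred a : 'X_{1..m < l.+1} | stdb P a]; pose T := {x in A}.
exists (I * T)%type, (fun j => val (val j.2)); split.
- by rewrite card_prod card_sig /hilb count_mnms.
- by move=> j; rewrite -ltnS bmdeg.
exists fst => c c0 [i a].
pose h i := \sum_(a : T) c (i, a) *: 'X_[val (val a)] : {mpoly K[m]}.
have csum (a' : T) : (h i)@_(val (val a')) = c (i, a').
  by apply: (mcoeff_lincomb (a := fun a : T => val (val a))) => b b' /val_inj/val_inj.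
suff h0 : h i = 0 by rewrite -csum h0 mcoeff0.
apply: (std_independent (P := P)) => [|b].
  apply: fv; pose G i a := c (i, a) *: phi (val (val a)) (v i).
  transitivity (\sum_i \sum_a G i a).
    by apply: eq_bigr => i' _; rewrite /h pact_suml; apply: eq_bigr => a' _; rewrite pactZl pactX.
  by rewrite pair_bigA -[RHS]c0; apply: eq_bigr => -[].
move=> /msupp_sum_le /flatten_mapP [a' _ /msuppZ_le]; rewrite msuppX inE => /eqP ->.
by apply/stdbP; exact: (valP a').
Qed.

End AssociatedPrime.

(** * Ranks over the center *)

Section NormalOrder.
Variables (K : fieldType) (n : nat) (N : weyl_module K n).
Implicit Types (a b : 'X_{1..n + n}) (u v : N).

Notation xv := (lshift n).
Notation dv := (@rshift n n).

Let minus_x (i : 'I_n) : {linear N -> N} := \- wx N i.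

Let minus_xC i j u : minus_x i (minus_x j u) = minus_x j (minus_x i u).
Proof. by rewrite /minus_x /= !linearN !opprK wxC. Qed.

Let minus_xd i j u : minus_x i (wd N j u) - wd N j (minus_x i u) = (i == j)%:R *: u.
Proof. by rewrite /minus_x /= linearN opprK addrC wdx eq_sym. Qed.

(** The Fourier transform: d_i takes the role of x_i and -x_i that of d_i. It derives the commutator
    of x_i with powers of the d_i from [wd_powx]. *)
Definition fourier : weyl_module K n := WeylModule (@wdC K n N) minus_xC minus_xd.

Lemma powd_x i (b : 'I_n -> nat) u : powop (wd N) b (wx N i u) =
  wx N i (powop (wd N) b u) + (b i)%:R *: powop (wd N) (fun j => b j - (i == j))%N u.
Proof.
have linP : linear (powop (wd N) b) by apply: powop_linear => j c v v'; exact: linearP.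
pose l : {linear N -> N} := HB.pack (powop (wd N) b) (GRing.isLinear.Build K N N _ _ linP).
have E : - wx N i (l u) = l (- wx N i u) +
  (b i)%:R *: powop (wd N) (fun j => b j - (i == j))%N u := wd_powx (N := fourier) i b u.
rewrite -[LHS]/(l (wx N i u)); move: E; rewrite linearN /= => /eqP.
rewrite -subr_eq0 -opprD oppr_eq0 addrA => /eqP E.
apply/eqP; rewrite -subr_eq0 -[X in X == _]opprK oppr_eq0 opprB -E; apply/eqP; rewrite /=.
by rewrite addrAC.
Qed.

Lemma mon_dr i a u : monop 1 a (wd N i u) = monop 1 (a + U_(dv i))%MM u.
Proof.
rewrite /monop.
have -> : powop (wd N) (fun j => 1 * (a + U_(dv i))%MM (dv j))%N u =
    powop (wd N) (fun j => 1 * a (dv j))%N (wd N i u).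
  rewrite -(powop_comm (g := wd N i)) => [|j v]; last exact: wdC.
  rewrite -(@powop1 _ _ _ (fun j => wd N j)); last exact: wdC.
  by apply: eq_powop => j; rewrite !mul1n mnmDE mnm1E (inj_eq (@rshift_inj _ _)).
by apply: eq_powop => j; rewrite mnmDE mnm1E eq_rlshift addn0.
Qed.

Lemma mon_xr i a u : monop 1 a (wx N i u) = wx N i (monop 1 a u) +
  (a (dv i))%:R *: monop 1 (a - U_(dv i))%MM u.
Proof.
rewrite /monop powd_x.
have linP : linear (powop (wx N) (fun j => 1 * a (xv j))%N).
  by apply: powop_linear => j c v v'; exact: linearP.
rewrite addrC linP mul1n addrC; congr (_ + _ *: _).
  by symmetry; apply: (powop_comm (g := wx N i)) => j v; exact: wxC.
rewrite (eq_powop _ (b := fun j => 1 * (a - U_(dv i))%MM (xv j))%N) => [|j]; last first.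
  by rewrite mnmBE mnm1E eq_rlshift subn0.
congr powop; apply: eq_powop => j.
by rewrite !mul1n mnmBE mnm1E (inj_eq (@rshift_inj _ _)).
Qed.

End NormalOrder.

(** * Operators with central coefficients *)

Section Azumaya.
Variables (K : fieldType) (n : nat) (N : weyl_module K n) (p : nat).
Hypothesis pK : p \in [pchar K].
Variables (P : set {mpoly K[n + n]}) (w : N).
Hypothesis Pp : prime_ideal P.
Hypothesis annP : forall f, cact p f w = 0 <-> P f.
Notation C := {mpoly K[n + n]}.
Implicit Types (a b : 'X_{1..n + n}) (u v : N).

Notation xv := (lshift n).
Notation dv := (@rshift n n).

Definition cyc : set N := [set v | exists l, gam setT [set w] l v].

Lemma cyc_x i v : cyc v -> cyc (wx N i v).
Proof. by move=> [l vl]; exists l.+1; exact: gam_x. Qed.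

Lemma cyc_d i v : cyc v -> cyc (wd N i v).
Proof. by move=> [l vl]; exists l.+1; exact: gam_d. Qed.

Lemma cyc_w : cyc w.
Proof. by exists 0%N; apply: (lspan1 (subringT K)); exact: Word0. Qed.

Lemma cyc_mon a v : cyc v -> cyc (monop 1 a v).
Proof. by move=> [l vl]; exists (l + 1 * mdeg a)%N; exact: monop_gam. Qed.

Lemma P_cyc f v : P f -> cyc v -> cact p f v = 0.
Proof.
move=> Pf [l]; elim=> [|c {}v u _ vw _ IH]; first exact: linear0.
rewrite linearP /= IH addr0; suff -> : cact p f v = 0 by rewrite scaler0.
elim: vw => {l v} [l v ->|l i v _ IHv|l i v _ IHv]; first exact/annP.
  by rewrite -(cact_wx pK) IHv linear0.
by rewrite -(cact_wd pK) IHv linear0.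
Qed.

Definition nop (f : {mpoly C[n + n]}) v : N := \sum_(a <- msupp f) cact p f@_a (monop 1 a v).

Lemma nopE k f v : (msize f <= k)%N ->
  nop f v = \sum_(a : 'X_{1..(n + n) < k}) cact p f@_a (monop 1 a v).
Proof.
move=> fk; pose I : subFinType _ := 'X_{1..(n + n) < k}.
rewrite /nop (big_mksub I) ?msupp_uniq //=; first last.
  by move=> a /msize_mdeg_lt /leq_trans; apply.
rewrite big_rmcond //= => a /memN_msupp_eq0 ->; exact: pact0l.
Qed.

Lemma nopD f g v : nop (f + g) v = nop f v + nop g v.
Proof.
pose k := maxn (msize (f + g)) (maxn (msize f) (msize g)).
rewrite !(nopE (k := k)) ?leq_max ?leqnn ?orbT // -big_split; apply: eq_bigr => a _.
by rewrite mcoeffD /cact pactDl.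
Qed.

Lemma nop0 v : nop 0 v = 0. Proof. by rewrite /nop msupp0 big_nil. Qed.

Lemma nop_sum (I : Type) (r : seq I) (Q : pred I) (F : I -> {mpoly C[n + n]}) v :
  nop (\sum_(i <- r | Q i) F i) v = \sum_(i <- r | Q i) nop (F i) v.
Proof. exact: (big_morph (nop^~ v) (fun f g => nopD f g v) (nop0 v)). Qed.

Lemma nopZX c a v : nop (c *: 'X_[a]) v = cact p c (monop 1 a v).
Proof.
have fk : (msize (c *: 'X_[a] : {mpoly C[n + n]}) <= (mdeg a).+1)%N.
  by apply: leq_trans (msizeZ_le _ _) _; rewrite msizeX.
rewrite (nopE _ fk) (bigD1 (BMultinom (leqnn (mdeg a).+1))) //=.
rewrite mcoeffZ mcoeffX eqxx mulr1 big1 ?addr0 // => b ba.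
have : (a == b :> 'X_{1..n + n}) = false.
  by apply: contraNF ba => /eqP e; apply/eqP/val_inj.
by rewrite mcoeffZ mcoeffX => ->; rewrite mulr0 /cact pact0l.
Qed.

Lemma nop_deriv i f v : nop f^`M(i) v =
  \sum_(a <- msupp f) cact p f@_a ((a i)%:R *: monop 1 (a - U_(i))%MM v).
Proof.
rewrite {1}[f]mpolyE raddf_sum nop_sum; apply: eq_bigr => a _ /=.
rewrite mderivZ mderivX scalerA nopZX linearZ /=.
by rewrite -[(a i)%:R in LHS]mpolyC_nat mulrC mul_mpolyC /cact pactZl.
Qed.

Lemma nop_deriv_x i f v : nop f^`M(xv i) v = wd N i (nop f v) - nop f (wd N i v).
Proof.
rewrite nop_deriv /nop linear_sum /= -sumrB; apply: eq_bigr => a _.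
by rewrite (cact_wd pK) -linearB /= mon_dr mon_d addrC addKr.
Qed.

Lemma nop_deriv_d i f v : nop f^`M(dv i) v = nop f (wx N i v) - wx N i (nop f v).
Proof.
rewrite nop_deriv /nop linear_sum /= -sumrB; apply: eq_bigr => a _.
by rewrite (cact_wx pK) -linearB /= mon_xr addrC addKr.
Qed.

(* Commutators with [x_i] and [d_i] differentiate the symbol, which reduces the
   claim to constants. *)
Lemma nop_cyc_eq0 f : (forall a i, (p <= a i)%N -> f@_a = 0) ->
  (forall v, cyc v -> nop f v = 0) -> forall a, P f@_a.
Proof.
have [[P0 PD] PM P1 PP] := Pp.
(* The induction is on a bound for the degree modulo [P], which a derivative lowers by one. *)
have [D] : exists D, forall a, (D < mdeg a)%N -> P f@_a.
  exists (msize f) => a fa; rewrite memN_msupp_eq0 //.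
  by apply: contraL fa => /msize_mdeg_lt; rewrite -leqNgt; apply: ltnW.
(* Coefficients in [P] act as zero on the cyclic module, so that only the constant term acts on
   [w]. *)
have base g : nop g w = 0 -> (forall a, a != 0%MM -> P g@_a) -> forall a, P g@_a.
  move=> g0 Pnz a; case: (eqVneq a 0%MM) => [->|]; last exact: Pnz.
  have [m0|m0] := boolP (0%MM \in msupp g); last by rewrite memN_msupp_eq0.
  apply/annP; rewrite -g0 /nop (bigD1_seq 0%MM) ?msupp_uniq //= monop0.
  by rewrite big1 ?addr0 // => b /Pnz Pb; apply: P_cyc Pb _; apply: cyc_mon; exact: cyc_w.
elim: D f => [|D IH] f fD fp f0; apply: base (f0 _ cyc_w) _ => a; rewrite -mdeg_eq0 -lt0n.
  exact: fD.
rewrite mdegE lt0n sum_nat_eq0 negb_forall => /existsP [i].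
rewrite implyTb => ai0; have ai : (0 < a i)%N by rewrite lt0n.
have : P (f^`M(i))@_(a - U_(i))%MM.
  apply: IH => [b Db|b j bj|v cv].
  - rewrite mcoeff_deriv -mulr_natr mulrC; apply: PM; apply: fD.
    by rewrite mdegDU.
  - rewrite mcoeff_deriv (fp _ j) ?mul0rn // mnmDE; exact: leq_trans bj (leq_addr _ _).
  case: (split_ordP i) => k ->.
    by rewrite nop_deriv_x (f0 _ cv) (f0 _ (cyc_d k cv)) linear0 subr0.
  by rewrite nop_deriv_d (f0 _ cv) (f0 _ (cyc_x k cv)) linear0 subr0.
rewrite mcoeff_deriv mnm_subK1 // mnmBE mnm1E eqxx subn1 prednK //.
case: (leqP p (a i)) => [pa|pa]; first by rewrite (fp _ i).
rewrite -mulr_natr -mpolyC_nat mulrC mul_mpolyC => Pa.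
(* The coefficient of [f] is recovered from that of its derivative, because 0 < a_i < p. *)
have ai_neq0 : (a i)%:R != 0 :> K.
  rewrite -(dvdn_pcharf pK); apply/negP => /dvdn_leq; rewrite ai => /(_ isT).
  by rewrite leqNgt pa.
by have := PM ((a i)%:R^-1)%:MP _ Pa; rewrite mul_mpolyC scalerA mulVf // scale1r.
Qed.

End Azumaya.

Section AzumayaRank.
Variables (K : fieldType) (n : nat) (N : weyl_module K n) (p : nat).
Hypothesis pK : p \in [pchar K].
Notation C := {mpoly K[n + n]}.
Notation B := {ffun 'I_(n + n) -> 'I_p}.
Implicit Types (a b : 'X_{1..n + n}) (u v : N).

Definition mnm_box (t : B) : 'X_{1..n + n} := [multinom (t i : nat) | i < n + n].

Lemma mon_box a u : exists t q, (p * mdeg q <= mdeg a)%N /\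
  monop 1 a u = monop p q (monop 1 (mnm_box t) u).
Proof.
have p0 : (0 < p)%N by apply: prime_gt0; exact: pcharf_prime pK.
exists [ffun i => Ordinal (ltn_pmod (a i) p0)], [multinom (a i %/ p)%N | i < n + n]; split.
  rewrite !mdegE big_distrr /=; apply: leq_sum => i _.
  by rewrite mnmE mulnC leq_divM.
rewrite -(monopp_split pK); congr (monop 1 _ _); apply/mnmP => i.
by rewrite !mnmE ffunE /= mulnC -divn_eq.
Qed.

Variables (P : set C) (w : N).
Hypothesis Pp : prime_ideal P.
Hypothesis annP : forall f, cact p f w = 0 <-> P f.
Notation E t := (monop 1 (mnm_box t) w).

Lemma cyc_box v : cyc w v -> exists d : B -> C, v = \sum_t cact p (d t) (E t).
Proof.
move=> [l] /(gam_mons (subringT K)) vl.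
pose A : set N := [set v | exists d : B -> C, v = \sum_t cact p (d t) (E t)].
have sA : subspace A.
  split; first by exists (fun=> 0); rewrite big1 // => t _; exact: pact0l.
  move=> c _ _ [d ->] [d' ->]; exists (fun t => c *: d t + d' t).
  rewrite scaler_sumr -big_split; apply: eq_bigr => t _.
  by rewrite /cact pactDl pactZl.
apply: (lspan_subspace sA) vl => _ [a [_ [_ -> ->]]].
have [t [q [_ ->]]] := mon_box a w; exists (fun t' => if t' == t then 'X_[q] else 0).
rewrite (bigD1 t) //= eqxx big1 ?addr0 => [|t' /negPf ->]; last exact: pact0l.
by rewrite /cact pactX.
Qed.

(* If [s A_n w] lies in the [C]-span of the [E t] with [t] in [S], and
   [#|S|^2 < p^(2n)], then some combination of the monomials of degree [< p] in each
   variable acts on this span by a zero matrix modulo [P]. *)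
Lemma azumaya_rank : exists2 S : {set B},
  cfree (@monop K n N p) P (fun t : {x in S} => E (val t)) & (p ^ (n + n) <= #|S| ^ 2)%N.
Proof.
have [[P0 PD] PM P1 PP] := Pp.
have Pcyc f v : P f -> cyc w v -> cact p f v = 0 := @P_cyc _ _ _ _ pK _ _ annP f v.
have cycE t : cyc w (E t) by apply/cyc_mon/cyc_w.
have [f t Pf|S [s [A [nPs Sfree sA]]]] := max_independent (w := fun t => E t)
  (@monop_linear _ _ N p) (monoppD pK) Pp; first exact: Pcyc.
exists S.
  move=> c c0 t; pose c' t := if insub t is Some t' then c t' else 0.
  have -> : c t = c' (val t) by rewrite /c' valK.
  apply: Sfree (valP t); rewrite big_sub -[RHS]c0; apply: eq_bigr => t' _.
  by rewrite /c' valK.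
have sE v : cyc w v -> exists d : B -> C, cact p s v = \sum_(j in S) cact p (d j) (E j).
  move=> /cyc_box [d ->]; exists (fun j => \sum_t d t * A t j).
  rewrite linear_sum /=; under [RHS]eq_bigr => j _ do rewrite /cact pact_suml.
  rewrite [RHS]exchange_big /=; apply: eq_bigr => t _.
  rewrite -(cactM pK) mulrC (cactM pK) [cact p s _]sA (linear_sum (cact p _)) /=.
  by apply: eq_bigr => j _; rewrite -(cactM pK).
rewrite leqNgt; apply/negP => ltSB.
have /choice [M ME] (x : B * B) : exists d : B -> C,
    cact p s (monop 1 (mnm_box x.1) (E x.2)) = \sum_(j in S) cact p (d j) (E j).
  by apply: sE; apply: cyc_mon.
pose J := ({x in S} * {x in S})%type.
(* p^(2n) unknowns against the #|S|^2 entries of a matrix on the span of [S]. *)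
have [|c [t0 ct0] cP] := linear_relation_mod (J := J)
    (fun t (x : J) => M (t, val x.1) (val x.2)) Pp.
  by rewrite card_prod card_sig card_ffun !card_ord ltSB.
pose Th (v : N) := \sum_t cact p (c t) (monop 1 (mnm_box t) v).
have Th_act g v : Th (cact p g v) = cact p g (Th v).
  rewrite /Th linear_sum; apply: eq_bigr => t _ /=.
  by rewrite (cact_monop1 pK) -!(cactM pK) mulrC.
have Th_sum (I : finType) (Q : {set I}) (F : I -> N) : Th (\sum_(i in Q) F i) = \sum_(i in Q) Th (F i).
  rewrite /Th exchange_big; apply: eq_bigr => t _; by rewrite !linear_sum.
have sTh t : t \in S -> cact p s (Th (E t)) = 0.
  move=> tS; rewrite /Th linear_sum /=.
  transitivity (\sum_(j in S) cact p (\sum_t' c t' * M (t', t) j) (E j)).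
    under [RHS]eq_bigr => j _ do rewrite /cact pact_suml.
    rewrite [RHS]exchange_big; apply: eq_bigr => t' _ /=.
    rewrite -(cactM pK) mulrC (cactM pK) (ME (t', t)) linear_sum; apply: eq_bigr => j _.
    by rewrite -/(cact p _ _) (cactM pK).
  rewrite big1 // => j jS; apply: Pcyc => //.
  exact: (cP (Sub t tS, Sub j jS)).
(* One factor [s] moves [v] into the span of [S], the other one expresses the images of the basis
   vectors in that span, where the matrix vanishes modulo [P]. *)
have ssTh v : cyc w v -> cact p (s * s) (Th v) = 0.
  move=> /sE [d sv]; rewrite (cactM pK) -Th_act sv Th_sum linear_sum /= big1 // => j jS.
  by rewrite Th_act -(cactM pK) mulrC (cactM pK) sTh // linear0.
pose h : {mpoly C[n + n]} := \sum_t (s * s * c t) *: 'X_[mnm_box t].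
have box_inj : injective mnm_box.
  move=> t t' /mnmP tt'; apply/ffunP => i; apply/val_inj.
  by have := tt' i; rewrite !mnmE.
have hE t : h@_(mnm_box t) = s * s * c t.
  exact: mcoeff_lincomb.
have /(_ (mnm_box t0)) : forall a, P h@_a.
  apply: (nop_cyc_eq0 pK Pp annP) => [a i pa|v cv].
    rewrite /h raddf_sum big1 // => t _ /=; rewrite mcoeffZ mcoeffX.
    case: eqP => [ta|_]; last by rewrite mulr0.
    by move: pa; rewrite -ta mnmE leqNgt ltn_ord.
  rewrite -[RHS](ssTh v cv) /h nop_sum /Th linear_sum; apply: eq_bigr => t _ /=.
  by rewrite nopZX (cactM pK).
by rewrite hE => /PP [/PP []|].
Qed.

End AzumayaRank.

(** * Bounds on the fibers *)

Section SupportBounds.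
Variables (K : fieldType) (n : nat) (N : weyl_module K n) (p : nat).
Hypothesis pK : p \in [pchar K].
Notation C := {mpoly K[n + n]}.
Implicit Types (a b : 'X_{1..n + n}) (u v : N).

Let lin := @monop_linear K n N p.
Let actD := monoppD (N := N) pK.

Variables (G : set N) (rho c : nat).
Hypothesis GT : forall u, exists l, gam setT G l u.
Hypothesis tor : forall u l, u != 0 -> exists (I : finType) (v : I -> N),
  [/\ freefam v, #|I| = 'C(l + n, n) & forall i, gam setT [set u] l (v i)].
Hypothesis ub : forall l (I : finType) (v : I -> N), freefam v ->
  (forall i, gam setT G l (v i)) -> (#|I| <= rho * 'C(l + c + n, n))%N.

Variable P : set C.
Hypothesis Pg : p_support_generic N p P.

Let Pp : prime_ideal P := Pg.1.1.
Let iP : ideal P := ideal_prime Pp.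

Lemma support_vector : exists w : N, forall f, cact p f w = 0 <-> P f.
Proof.
apply: (associated_prime lin actD Pp); first exact: Pg.1.2.
by move=> u up uP; apply: Pg.2 => //; split=> //; exists u.
Qed.

(** Dividing exponents by p writes a monomial operator of degree pl as a central monomial of degree
    at most l times one of p^(2n) monomials. On [w], central polynomials may be replaced by their
    standard remainders. *)
Lemma hilb_lower l : ('C(p * l + n, n) <= p ^ (n + n) * hilb P l)%N.
Proof.
have [w annP] := support_vector.
have w0 : w != 0.
  apply/eqP => w0; have [_ _ P1 _] := Pp; apply/P1/annP.
  by rewrite w0 linear0.
have [I [v [fv <- vw]]] := tor (p * l) w0.
pose B := {ffun 'I_(n + n) -> 'I_p}.
pose T := {x in [pred a : 'X_{1..(n + n) < l.+1} | stdb P a]}.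
pose y (j : B * T) := monop p (val (val j.2)) (monop 1 (mnm_box j.1) w).
have -> : (p ^ (n + n) * hilb P l = #|{: B * T}|)%N.
  by rewrite card_prod card_ffun !card_ord card_sig /hilb count_mnms.
apply: (free_lspan_card_le (w := y) (A := range y)) fv _ _ => [u [j _ <-]|i]; first by exists j.
have := gam_mons (subringT K) (vw i); apply: (lspan_sub (subringT K)) => u [a [_ [al -> ->]]].
have [t [q [qa ->]]] := mon_box pK a w.
have p0 : (0 < p)%N by apply: prime_gt0; exact: pcharf_prime pK.
have ql : (mdeg q <= l)%N by rewrite -(leq_pmul2l p0) (leq_trans qa).
have [h [Ph hs hl]] := std_reduce iP 'X_[q].
have -> : monop p q (monop 1 (mnm_box t) w) = cact p h (monop 1 (mnm_box t) w).
  rewrite -(pactX (@monop K n N p) q) -/(cact p _ _); apply/subr0_eq.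
  rewrite -[LHS](pactBl (@monop K n N p)) -/(cact p _ _).
  by apply: (P_cyc pK annP Ph); apply/cyc_mon/cyc_w.
apply: lext_lspan => b bh; have bl : (mdeg b < l.+1)%N.
  apply: leq_trans (msize_mdeg_lt bh) (leq_trans hl _).
  by rewrite msizeX ltnS.
have bA : BMultinom bl \in [pred a : 'X_{1..(n + n) < l.+1} | stdb P a] by apply/stdbP/hs.
by exists (t, (Sub (BMultinom bl) bA : T)).
Qed.

(** A standard monomial of degree l in the center raises the Bernstein degree by pl; [c'] accounts
    for the degrees of the [v i]. *)
Lemma hilb_upper (I : finType) (v : I -> N) : cfree (@monop K n N p) P v ->
  exists c', forall l, (#|I| * hilb P l <= rho * 'C(p * l + c' + n, n))%N.
Proof.
move=> fv; have /choice [d dP] i := GT (v i).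
exists (\max_i d i + c)%N => l.
have [J [a [<- al [i fJ]]]] := cfree_std Pp l fv.
rewrite addnA [(p * l + _)%N]addnC; apply: ub fJ _ => j.
apply: (@gam_le _ _ _ _ _ (d (i j) + p * mdeg (a j))%N); last exact: monop_gam.
by apply: leq_add; [exact: leq_bigmax (i j)|rewrite leq_mul2l al orbT].
Qed.

Lemma leq_bin_exp (x m : nat) : ('C(x + m, m) * m`! <= (x + m) ^ m)%N.
Proof.
rewrite bin_ffact; move: (x + m)%N => y; elim: m => [|m IH]; first by rewrite ffactn0.
by rewrite ffactnSr expnSr leq_mul // leq_subr.
Qed.

Lemma hilbert_bounds : exists (q : {poly rat}) (D : nat),
  [/\ exists l0, forall l, (l0 <= l)%N -> q.[l%:R] = (hilb P l)%:R,
      hilbert_mult q = D%:R, (0 < D <= rho)%N &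
  forall (I : finType) (v : I -> N), cfree (@monop K n N p) P v -> (#|I| <= rho * p ^ n)%N].
Proof.
have [_ _ P1 _] := Pp; have [cs cs0 csP] := hilb_cones iP P1.
have [[l0 ql] /(_ cs0) [D D0 qD]] := cones_poly cs.
set q := \sum_(x <- cs) _ in ql qD; exists q, D.
have {}ql l : (l0 <= l)%N -> q.[l%:R] = (hilb P l)%:R by move=> /ql ->; rewrite csP.
have p0 : (0 < p)%N by apply: prime_gt0; exact: pcharf_prime pK.
have low : (n.+1 <= size q)%N.
  (* Scaled by p^(2n), [q] dominates binom(l + n, n), so its degree is at least n. *)
  rewrite -(size_bin_poly n (- 0%:R)); apply: leq_trans (size_scale_leq (p ^ (n + n))%:R q).
  apply: (@size_poly_le_growth _ _ l0) => l /ql ll.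
  rewrite bin_polyE // ler0n /= hornerZ ll -natrM ler_nat subn0.
  apply: leq_trans (hilb_lower l); apply: leq_bin2l; rewrite leq_add2r.
  by rewrite leq_pmull.
(* The binomial coefficient is replaced by the power (pl + c' + n)^n, whose leading coefficient is
   p^n; the factor n! turns that of [q] into the multiplicity once its degree is known to be n. *)
have up (I : finType) (v : I -> N) : cfree (@monop K n N p) P v -> exists r : {poly rat},
    [/\ size r = n.+1, lead_coef r = (p ^ n)%:R & forall l, (l0 <= l)%N ->
      ((#|I| * n`!)%:R *: q).[l%:R] <= (rho%:R *: r).[l%:R]].
  move=> /hilb_upper [c' Hc']; pose s := p%:R *: 'X + (c' + n)%:R%:P : {poly rat}.
  have pr : (p%:R : rat) != 0 by rewrite pnatr_eq0 -lt0n.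
  have s2 : size s = 2%N.
    by rewrite size_addl size_scale ?size_polyX // ltnS size_polyC_leq1.
  exists (s ^+ n); split.
  - rewrite -[size _]prednK ?size_exp ?s2 ?mul1n //.
    by rewrite size_poly_gt0 expf_neq0 // -size_poly_eq0 s2.
  - rewrite lead_coef_exp natrX; congr (_ ^+ _).
    by rewrite lead_coefDl ?lead_coefZ ?lead_coefX ?mulr1 // size_scale // size_polyX ltnS size_polyC_leq1.
  move=> l /ql ll; rewrite !hornerZ ll horner_exp /s hornerD hornerZ hornerX hornerC.
  rewrite -!natrM -natrD -natrX -natrM ler_nat mulnAC.
  apply: (@leq_trans (rho * 'C(p * l + c' + n, n) * n`!)%N); first by rewrite leq_mul2r Hc' orbT.
  by rewrite -mulnA leq_mul2l addnA leq_bin_exp orbT.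
have [w annP] := support_vector.
have [S Sfree Scard] := azumaya_rank pK Pp annP.
have S0 : (p ^ n <= #|{: {x in S}}|)%N.
  by rewrite card_sig -(@leq_exp2r _ _ 2) // -expnM muln2 -addnn.
have sq : size q = n.+1.
  apply/eqP; rewrite eqn_leq low andbT.
  have [r [sr _ rP]] := up _ _ Sfree.
  rewrite -sr; apply: leq_trans (size_scale_leq rho%:R r).
  apply: (@size_poly_le_growth _ _ l0) => l ll; apply/andP; split; first by rewrite ql ?ler0n.
  apply: le_trans (rP l ll); rewrite hornerZ ql // ler_peMl ?ler0n //.
  by rewrite ler1n muln_gt0 fact_gt0 (leq_trans _ S0) // expn_gt0 p0.
have main (I : finType) (v : I -> N) : cfree (@monop K n N p) P v -> (#|I| * D <= rho * p ^ n)%N.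
  move=> /up [r [sr lr rP]]; rewrite -(ler_nat rat) !natrM.
  have := coef_le (n := n) _ _ rP; rewrite !(leq_trans (size_scale_leq _ _)) ?sq ?sr // => /(_ isT isT).
  rewrite !coefZ -lr lead_coefE sr /= -qD /hilbert_mult lead_coefE sq /=.
  by rewrite natrM mulrA.
split=> //.
- by exists l0.
- rewrite D0 /=; have := main _ _ Sfree; rewrite (mulnC rho) => H.
  have : (p ^ n * D <= p ^ n * rho)%N by apply: leq_trans H; rewrite leq_mul2r S0 orbT.
  by rewrite leq_pmul2l // expn_gt0 p0.
- by move=> I v /main; apply: leq_trans; rewrite leq_pmulr.
Qed.

End SupportBounds.

Lemma free_extend (k : fieldType) (V : lmodType k) (r : nat) (b : 'I_r -> V) (u : V) :
  freefam b -> ~ (exists c : 'I_r -> k, u = \sum_i c i *: b i) ->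
  freefam (fun i : 'I_r.+1 => if unlift ord0 i is Some j then b j else u).
Proof.
move=> fb nu c; rewrite big_ord_recl unlift_none => c0.
have {}c0 : c ord0 *: u + \sum_i c (lift ord0 i) *: b i = 0.
  by rewrite -[RHS]c0; congr (_ + _); apply: eq_bigr => i _; rewrite liftK.
have c00 : c ord0 = 0.
  apply: contrapT => /eqP c00; apply: nu; exists (fun i => - (c ord0)^-1 * c (lift ord0 i)).
  under eq_bigr => i _ do rewrite -scalerA.
  rewrite -scaler_sumr -[\sum_i _](addKr (c ord0 *: u)) c0 addr0 scalerN scaleNr opprK.
  by rewrite scalerA mulVf // scale1r.
move: c0; rewrite c00 scale0r add0r => /fb cb i.
by case: (unliftP ord0 i) => [j|] ->; rewrite ?cb.
Qed.

Section Rank.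
Variables (K : fieldType) (n : nat) (N : weyl_module K n) (p : nat).
Hypothesis pK : p \in [pchar K].
Notation C := {mpoly K[n + n]}.
Variables (P : set C) (bound : nat).
Hypothesis Pp : prime_ideal P.
Hypothesis cfree_bound : forall (I : finType) (v : I -> N),
  cfree (@monop K n N p) P v -> (#|I| <= bound)%N.

(* [u] lies in [P N]. *)
Definition in_PN (u : N) : Prop := forall A : set N, A 0 ->
  (forall f v v', P f -> A v' -> A (cact p f v + v')) -> A u.

(* Independence of the classes in [N (x) k(P)], expressed without [k(P)]. *)
Definition fiber_free (r : nat) (v : 'I_r -> N) : Prop := forall (c : 'I_r -> C) s,
  ~ P s -> in_PN (cact p s (\sum_i cact p (c i) (v i))) -> forall i, P (c i).

Lemma fiber_free_bound r (v : 'I_r -> N) : fiber_free v -> (r <= bound)%N.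
Proof.
have [_ _ P1 _] := Pp.
move=> fv; rewrite -(card_ord r); apply: (@cfree_bound _ v) => c c0; apply: (fv _ 1) => // A A0 _.
have -> : \sum_i cact p (c i) (v i) = 0 := c0.
by rewrite linear0.
Qed.

Section ResidueField.
Variables (kz : fieldType) (psi : {rmorphism C -> kz}).
Hypothesis psiP : residue_field_at P psi.
Variables (W : lmodType kz) (j : N -> W).
Hypothesis jW : base_change (center_act p) psi j.

Let jD u v : j (u + v) = j u + j v := jW.1.1 u v.
Let jZ f u : j (cact p f u) = psi f *: j u := jW.1.2 f u.
Let j0 : j 0 = 0. Proof. by apply: (addIr (j 0)); rewrite -jD !add0r. Qed.
Let j_sum (I : finType) (f : I -> N) : j (\sum_i f i) = \sum_i j (f i).
Proof. exact: (big_morph j jD j0). Qed.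

Lemma in_PN_ker u : in_PN u -> j u = 0.
Proof.
move=> /(_ (fun u => j u = 0)); apply=> [//|f v v' /psiP.1 f0 jv'].
by rewrite jD jZ jv' addr0 f0 scale0r.
Qed.

Lemma ker_in_PN u : ker_sub (center_act (N := N) p) psi u -> in_PN u.
Proof. by move=> ku A A0 AS; elim: ku => // q v v' /psiP.1 Pq _; exact: AS. Qed.

Lemma fiber_freeP r (v : 'I_r -> N) : fiber_free v <-> freefam (fun i => j (v i)).
Proof.
split=> [fv d d0 i|fv c s Ps Pc i].
  have [s [c [s0 cE]]] := common_denominator d psiP.
  suff Pc : P (c i).
    move/psiP.1: Pc; rewrite cE => /eqP; rewrite mulf_eq0 (negPf s0) => /eqP //.
  have : j (\sum_i cact p (c i) (v i)) = 0.
    rewrite j_sum -[RHS](scaler0 _ (psi s)) -[X in _ *: X]d0 scaler_sumr.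
    by apply: eq_bigr => i' _; rewrite jZ cE scalerA.
  move=> /(base_change_kernel _ _ _ _ psiP jW) [].
  - by move=> f u u'; exact: (pactDr (@monop_linear K n N p)).
  - by move=> f g u; exact: pactDl.
  - by move=> f g u; exact: (cactM pK).
  - by move=> u; exact: (pact1 (@monop0 K n N p)).
  move=> f f0 kf; apply: (fv c f) => [/psiP.1|]; first by move/eqP; apply/negP.
  exact: (ker_in_PN kf).
move/in_PN_ker/eqP: Pc; rewrite jZ scaler_eq0 => /orP [/eqP/psiP.1 //|/eqP].
rewrite j_sum; under eq_bigr => i' _ do rewrite jZ.
by move=> /fv /(_ i) /psiP.1.
Qed.

Lemma fiber_quot_dim r (v : 'I_r -> N) : fiber_free v ->
  (forall v' : 'I_r.+1 -> N, ~ fiber_free v') -> quot_dim [set: W] [set 0] r.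
Proof.
move=> /fiber_freeP fv vmax; exists (fun i => j (v i)); split=> // u _.
have [c uE] : exists c : 'I_r -> kz, u = \sum_i c i *: j (v i).
  elim: (base_change_span jW u) => [|d _ u' _ [x _ <-] _ [c' ->]].
    by exists (fun=> 0); rewrite big1 // => i _; rewrite scale0r.
  have [c xE] : exists c : 'I_r -> kz, j x = \sum_i c i *: j (v i).
    apply: contrapT => /(free_extend fv) fx.
    apply: (vmax (fun i => if unlift ord0 i is Some i' then v i' else x)).
    apply/fiber_freeP => e e0; apply: fx; rewrite -[RHS]e0; apply: eq_bigr => i _.
    by case: (unlift ord0 i).
  exists (fun i => d * c i + c' i); rewrite xE scaler_sumr -big_split.
  by apply: eq_bigr => i _; rewrite scalerDl scalerA.
exists c; split=> [|c']; first by rewrite uE /= subrr.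
rewrite uE /= -sumrB => E i; apply/eqP; rewrite eq_sym -subr_eq0; apply/eqP.
apply: (fv (fun i => c i - c' i)); rewrite -[RHS]E; apply: eq_bigr => i' _.
by rewrite scalerBl.
Qed.

End ResidueField.

(** [p_rank] quantifies over all residue fields and base changes, so [r] is fixed beforehand as the
    largest size of a [fiber_free] family, a notion inside [N]. *)
Lemma p_rank_exists : exists r, p_rank N p P r /\ (r <= bound)%N.
Proof.
pose good r := `[< exists v : 'I_r -> N, fiber_free v >].
have good0 : exists r, good r.
  by exists 0%N; apply/asboolP; exists (fun=> 0) => c s _ _ [].
have goodb r : good r -> (r <= bound)%N by move=> /asboolP [v /fiber_free_bound].
have [r /asboolP [v fv] rmax] := ex_maxnP good0 goodb.
exists r; split; last exact: fiber_free_bound fv.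
move=> kz psi psiP W j jW; apply: (fiber_quot_dim psiP jW fv) => v' fv'.
suff /rmax : good r.+1 by rewrite ltnn.
by apply/asboolP; exists v'.
Qed.

End Rank.

(** * Schemes *)

Lemma fiber_bounds (K : fieldType) (n : nat) (N : weyl_module K n) (p : nat) (G : set N)
    (rho c : nat) (P : set {mpoly K[n + n]}) :
  p \in [pchar K] -> (forall u, exists l, gam setT G l u) ->
  (forall (u : N) l, u != 0 -> exists (I : finType) (v : I -> N),
    [/\ freefam v, #|I| = 'C(l + n, n) & forall i, gam setT [set u] l (v i)]) ->
  (forall l (I : finType) (v : I -> N), freefam v ->
    (forall i, gam setT G l (v i)) -> (#|I| <= rho * 'C(l + c + n, n))%N) ->
  p_support_generic N p P ->
  (exists D, closure_degree P D%:R /\ (D <= rho)%N) /\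
  exists r, p_rank N p P r /\ (r <= rho * p ^ n)%N.
Proof.
move=> pK GT tor ub Pg; have Pp := Pg.1.1.
have [q [D [[l0 ql] qD /andP [_ Drho] bound]]] := hilbert_bounds pK GT tor ub Pg.
split; last by have H := p_rank_exists pK Pp bound; exact: H.
by exists D; split=> //; rewrite -qD; apply: closure_degree_hilb ql; exact: ideal_prime.
Qed.

Section RingedSpaces.
Variable S : ringed_space.

Lemma unit_at_mem (V : opens S) (f : Osh V) (x : S) : unit_at f x -> oset V x.
Proof. by move=> [W [Wx [WV _]]]; exact: WV. Qed.

Lemma open_basic_open (V : opens S) (f : Osh V) : open (basic_open f).
Proof.
rewrite openE => x [W [Wx [WV Wf]]]; apply: (@filterS _ _ _ W); last first.
  by apply: open_nbhs_nbhs; split=> //; exact: open_oset.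
by move=> y Wy; exists W; split=> //; exists WV.
Qed.

(** Two sections over an empty set agree on the empty cover. *)
Lemma sections_empty (V : opens S) (f g : Osh V) : (forall x, ~ oset V x) -> f = g.
Proof.
move=> V0; have [_ [_ sh]] := @Osh_sheaf S.
have [|uniq _] := sh V void (fun i => match i with end) (fun i => match i with end).
  by move=> x /V0.
by apply: uniq => -[].
Qed.

End RingedSpaces.

Section AffineNeighbourhood.
Variables (n : nat) (S : scheme) (X : affine_space n S) (M : dmodule X).
Variables (V : opens S) (affV : affine V).

Let act (a : Osh V) (u : dm M (opi X V)) := as_com X V a *: u.

Let actDr a u v : act a (u + v) = act a u + act a v. Proof. exact: scalerDr. Qed.
Let actDl a b u : act (a + b) u = act a u + act b u.
Proof. by rewrite /act rmorphD scalerDl. Qed.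
Let actM a b u : act (a * b) u = act a (act b u).
Proof. by rewrite /act rmorphM scalerA. Qed.
Let act1 u : act 1 u = u. Proof. by rewrite /act rmorph1 scale1r. Qed.

Definition sections : weyl_lattice n (Osh V) := WeylLattice
  (fun i u => Ores (sub_otop (U := opi X V)) (as_x X i) *: u)
  (fun i u => dm_der i u) actDr actDl actM act1.

(** An element of the residue field is the value of a section near [s]; on a small basic open subset
    of [V] this section is a fraction of sections over [V]. *)
Lemma affine_fractions (s : S) (Vs : oset V s) (k : residue_field s) :
  residue_field_at [set f : Osh V | ~ unit_at f s] (rf_ev k Vs).
Proof.
split=> [f|c]; first exact: rf_ker.
have [V' [V's [f' <-]]] := rf_surj c.
have [_ _ base loc] := affV.
pose W : opens S := Opens (openI (open_oset V) (open_oset V')).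
have [|f [fs fW]] := base W s _ (conj Vs V's); first by move=> x [].
pose B : opens S := Opens (open_basic_open f).
have BV : B `<=` V by move=> x /fW [].
have BV' : B `<=` V' by move=> x /fW [].
have Bs : oset B s := fs.
have [/(_ (Ores BV' f')) [m [a aE]] _] := loc f B BV erefl.
have f0 : rf_ev k Vs f != 0 by apply/eqP => /rf_ker; apply.
exists a, (f ^+ m); rewrite rmorphXn expf_neq0 //; split=> //.
have := congr1 (rf_ev k Bs) aE; rewrite rmorphM rmorphXn !(rf_res _ _ Vs Bs) (rf_res _ _ V's Bs) => ->.
by rewrite mulrC mulKf // expf_neq0.
Qed.

Lemma sections_fiber (s : S) (Vs : oset V s) (k : residue_field s) (W : fiber M k) :
  lat_fiber (L := sections) [set f : Osh V | ~ unit_at f s] (rf_ev k Vs) (W := W)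
    (fib_map W Vs).
Proof.
split; first exact: affine_fractions.
- exact: fib_base_change.
- by move=> i u; exact: fib_x.
- by move=> i u; exact: fib_d.
Qed.

(** Functions over the preimage of [V] are polynomials in the coordinates over O(V), so closure
    under O(V) and the x_i gives closure under all of them. *)
Lemma sections_generated (r : nat) (g : 'I_r -> dm M (opi X V)) :
  (forall B : set (dm M (opi X V)), (forall i, B (g i)) -> B 0 ->
      (forall u v, B u -> B v -> B (u + v)) -> (forall f u, B u -> B (f *: u)) ->
      (forall i u, B u -> B (dm_der i u)) -> forall u, B u) ->
  lat_generated (L := sections) g.
Proof.
move=> gen B Bg B0 BD BZ BX Bd; apply: gen => // f u Bu.
have [/(_ f) [ms [c ->]] _] := as_free X affV.
rewrite scaler_suml; apply: (big_ind B) => // m _; rewrite -scalerA; apply: BZ.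
apply: (big_ind (fun h => forall u, B u -> B (h *: u))) Bu => [v|h h' Bh Bh' v Bv|i _ v Bv].
- by rewrite scale1r.
- by rewrite -scalerA; apply/Bh/Bh'.
elim: (m i) => [|l IH]; first by rewrite expr0 scale1r.
by rewrite exprS -scalerA; exact: BX.
Qed.

End AffineNeighbourhood.

Section GenericPoint.
Variables (S : scheme) (mu : S) (k : residue_field mu).
Hypothesis S_integral : integral_scheme S.
Hypothesis mu_generic : generic_point mu.

Lemma generic_mem (U : set S) : open U -> U !=set0 -> U mu.
Proof.
move=> oU [x Ux]; have : closure [set mu] x by rewrite mu_generic.
by move=> /(_ U) [|y [-> //]]; apply: open_nbhs_nbhs.
Qed.

(** A section that is not a unit at [mu] is a unit nowhere, since [mu] lies in every nonempty open
    set. It is then nilpotent on [V], hence zero in a domain. *)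
Lemma generic_residue_field (V : opens S) (affV : affine V) (Vmu : oset V mu) :
  residue_field_at [set 0] (rf_ev k Vmu).
Proof.
have [kerE frac] := affine_fractions affV Vmu k; split=> // f; split; last by move=> ->; rewrite rmorph0.
move/kerE => /= nf; have [_ dom] := S_integral.
have [V1 V0] := dom V (ex_intro _ mu Vmu).
pose B : opens S := Opens (open_basic_open f).
have B0 x : ~ oset B x.
  move=> Bx; apply: nf; apply: (@generic_mem (basic_open f)); first exact: open_basic_open.
  by exists x.
have BV : B `<=` V by move=> x /B0.
(* Over the empty set 1 = 0, so the localization property gives f^m = 0. *)
have [_ _ _ loc] := affV; have [_ /(_ 1) []] := loc f B BV erefl.
  exact: sections_empty.
move=> m; rewrite mulr1; elim: m => [|m IH]; first by rewrite expr0 => /V1.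
by rewrite exprS => /V0 [].
Qed.

(** Dominance makes each positive integer a unit at some point, hence at [mu]. *)
Lemma generic_char0 : dominant_over_Z S -> forall i : nat, (i.+1)%:R != 0 :> k.
Proof.
move=> dom i; have [x xu] := dom i.+1%:Z isT.
have mu_unit : unit_at (i.+1%:Z%:~R : Osh (otop S)) mu.
  by apply: (@generic_mem (basic_open _)); [exact: open_basic_open|exists x].
apply/eqP => i0; have := (rf_ker k (V := otop S) (I : oset (otop S) mu) (i.+1%:Z%:~R)).1.
by rewrite rmorph_int; apply.
Qed.

End GenericPoint.

Theorem theorem4p3p3 (n : nat) (S : scheme) (X : affine_space n S)
    (M : dmodule X) (mu : S) (kmu : residue_field mu) (Mmu : fiber M kmu)
    (e : rat)
    (S_integral : integral_scheme S)
    (S_finite_type : finite_type_over_Z S)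
    (S_dominant : dominant_over_Z S)
    (M_coherent : coherent M)
    (mu_generic : generic_point mu)
    (Mmu_nonzero : exists m : Mmu, m <> 0)
    (Mmu_holonomic : holonomic Mmu)
    (e_mult : multiplicity Mmu e) :
  exists U : set S, open U /\ dense U /\
    forall u : S, U u -> closed [set u] ->
    forall (ku : residue_field u) (Mu : fiber M ku) (p : nat),
      p \in [pchar ku] ->
    forall z : set {mpoly ku[n + n]}, p_support_generic Mu p z ->
      (exists d : rat, closure_degree z d /\ d <= e) /\
      (exists r : nat, p_rank Mu p z r /\ r%:R <= e * (p ^ n)%:R).
Proof.
have [V [Vmu affV]] := sch_affine mu.
have [_ [r [g /(sections_generated affV) gen]]] := M_coherent _ (as_affine X affV).
have gF : lat_fiber (L := sections M V) [set 0] (rf_ev kmu Vmu) (W := Mmu) (fib_map Mmu Vmu).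
  have := sections_fiber affV Vmu Mmu; case=> _ *; split=> //.
  exact: generic_residue_field.
have [f [rho [c [f0 rho_e bounds]]]] := generic_bounds gF
  (generic_char0 kmu mu_generic S_dominant) gen Mmu_holonomic e_mult.
have unit_neq0 (s : S) (Vs : oset V s) (k : residue_field s) : unit_at f s <-> rf_ev k Vs f != 0.
  split=> [fs|/eqP fs]; first by apply/eqP => /rf_ker.
  by apply: contrapT => /(rf_ker k Vs).
exists (basic_open f); split; first exact: open_basic_open.
split.
  (* The generic point meets every nonempty open set, and it lies in [basic_open f] because [f] is
     nonzero in [kmu]. *)
  move=> O O0 oO; exists mu; split; first exact: generic_mem.
  exact/(unit_neq0 mu Vmu kmu).
move=> u fu _ ku Mu p pk z zP; have Vu := unit_at_mem fu.
have FW := sections_fiber affV Vu Mu.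
have [tor ub] := bounds _ _ _ _ _ FW ((unit_neq0 _ Vu ku).1 fu).
have [[D [zD Drho]] [d [zd drho]]] := fiber_bounds pk (lf_gen FW gen) tor ub zP.
split.
  by exists D%:R; split=> //; apply: le_trans rho_e; rewrite ler_nat.
exists d; split=> //; apply: (@le_trans _ _ (rho * p ^ n)%:R); first by rewrite ler_nat.
by rewrite natrM ler_wpM2r // ler0n.
Qed.
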